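(* Let $n\ge2$ and let $f$ be a log-concave probability density function on $\mathbb{R}^n$ with finite covariance matrix $\Sigma$. Put $C(n)=(2\pi e)^{n/2}$ and $D(n)=\left(\frac{n^2e^2}{2\sqrt2\,(n+2)}\right)^{n/2}$. Then for all $1\le p\le\infty$ and $1\le q\le\infty$, $$\|f\|_p\le C(n)^{1-\frac1q}\,D(n)^{1-\frac1p}\,|\Sigma|^{\frac12\left(\frac1p-\frac1q\right)}\,\|f\|_q ,$$ where $|\Sigma|$ denotes the determinant of $\Sigma$.
   Context: A probability density function (with respect to Lebesgue measure) $f:\mathbb{R}^n\to\mathbb{R}$ is log-concave if $f(\theta x+(1-\theta)y)\ge f(x)^\theta f(y)^{1-\theta}$ for all $x,y\in\mathbb{R}^n$ and $0\le\theta\le1$. For $1\le p<\infty$, $\|f\|_p=\left(\int_{\mathbb{R}^n} f(x)^p\,d^nx\right)^{1/p}$, and $\|f\|_\infty=\operatorname{ess\,sup}_{x\in\mathbb{R}^n}|f(x)|$ (Lebesgue measure). Convention: $1/\infty=0$. $\Sigma$ is the covariance matrix of a random vector $X$ with density $f$. *)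

(* Defs.v *)
From HB Require Import structures.
From mathcomp Require Import all_boot all_order all_algebra.
From mathcomp Require Import all_classical all_reals all_analysis.

Set Implicit Arguments.
Unset Strict Implicit.
Unset Printing Implicit Defensive.

Import Order.TTheory GRing.Theory Num.Theory.
Import numFieldNormedType.Exports.

Local Open Scope classical_set_scope.
Local Open Scope ring_scope.

Definition measure_rV_display : measure_display.
Proof. exact: default_measure_display. Qed.

(* The sigma-algebra generated by the coordinate maps (which is the Borel
   sigma-algebra), as for the library's instance on [n.-tuple R]. *)
Section measurable_rV.
Context (R : realType) (n : nat).

Let coor (i : 'I_n) (x : 'rV[R]_n) : R := x ord0 i.

Let rV_set0 : g_sigma_preimage coor set0.
Proof. exact: sigma_algebra0. Qed.

Let rV_setC A : g_sigma_preimage coor A -> g_sigma_preimage coor (~` A).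
Proof. exact: sigma_algebraC. Qed.

Let rV_bigcup (F : (set _)^nat) : (forall i, g_sigma_preimage coor (F i)) ->
  g_sigma_preimage coor (\bigcup_i (F i)).
Proof. exact: sigma_algebra_bigcup. Qed.

HB.instance Definition _ := @isMeasurable.Build measure_rV_display
  'rV[R]_n (g_sigma_preimage coor) rV_set0 rV_setC rV_bigcup.

End measurable_rV.

Lemma measurable_coord (R : realType) (n : nat) (i : 'I_n) :
  measurable_fun [set: 'rV[R]_n] (fun x : 'rV[R]_n => x ord0 i).
Proof.
move=> _ Y mY; rewrite setTI; apply: sub_sigma_algebra.
rewrite -bigcup_seq/=; exists i => /=; first by rewrite mem_index_enum.
by exists Y => //; rewrite setTI.
Qed.

Lemma measurable_fun_rVP d (T : measurableType d) (R : realType) (n : nat)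
    (f : T -> 'rV[R]_n) :
  measurable_fun [set: T] f <->
  forall i, measurable_fun [set: T] (fun t => f t ord0 i).
Proof.
split=> [mf i|mf _ A].
  exact: (measurableT_comp (@measurable_coord R n i) mf).
rewrite setTI; suff: measurable `<=` [set A | measurable (f @^-1` A)] by apply.
apply: smallest_sub.
  split=> [|B mB|F mF] /=.
  - by rewrite preimage_set0.
  - by rewrite setTD -preimage_setC; exact: measurableC.
  - by rewrite preimage_bigcup; apply: bigcup_measurable => k _; exact: mF.
rewrite -bigcup_seq => B [i _ [C mC <-]] /=.
by rewrite setTI -[X in measurable X]setTI; exact: mf.
Qed.

Section lebesgue_measure_rV.
Context (R : realType).
Local Open Scope ereal_scope.

Definition cons_rV (n : nat) (u : measurableTypeR R * 'rV[R]_n) : 'rV[R]_n.+1 :=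
  row_mx (u.1)%:M u.2 : 'rV[R]_(1 + n).

Definition uncons_rV (n : nat) (x : 'rV[R]_n.+1) : measurableTypeR R * 'rV[R]_n :=
  (x ord0 ord0, \row_j x ord0 (lift ord0 j)).

Lemma cons_rV0 (n : nat) (u : measurableTypeR R * 'rV[R]_n) :
  cons_rV u ord0 ord0 = u.1.
Proof.
have -> : @ord0 n = lshift n (@ord0 0) by exact/val_inj.
by rewrite /cons_rV [LHS](row_mxEl (u.1)%:M u.2) mxE eqxx.
Qed.

Lemma cons_rVS (n : nat) (u : measurableTypeR R * 'rV[R]_n) (j : 'I_n) :
  cons_rV u ord0 (lift ord0 j) = u.2 ord0 j.
Proof.
have -> : lift ord0 j = rshift 1 j by exact/val_inj.
by rewrite /cons_rV [LHS](row_mxEr (u.1)%:M u.2).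
Qed.

Lemma cons_rVK (n : nat) : cancel (@cons_rV n) (@uncons_rV n).
Proof.
move=> [a x]; rewrite /uncons_rV cons_rV0; congr pair.
by apply/rowP => j; rewrite mxE cons_rVS.
Qed.

Lemma measurable_cons_rV (n : nat) : measurable_fun setT (@cons_rV n).
Proof.
apply/measurable_fun_rVP => i; case: (unliftP ord0 i) => [j ->|->].
  under eq_fun do rewrite cons_rVS.
  by apply: (measurableT_comp (@measurable_coord R n j)).
under eq_fun do rewrite cons_rV0.
exact: measurable_fst.
Qed.

Lemma measurable_uncons_rV (n : nat) : measurable_fun setT (@uncons_rV n).
Proof.
apply: measurable_fun_pair; first exact: measurable_coord.
apply/measurable_fun_rVP => i; under eq_fun do rewrite mxE.
exact: measurable_coord.
Qed.

Section cons_measure.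
Context (n : nat) (mu : {sigma_finite_measure set 'rV[R]_n -> \bar R}).

Definition cons_measure : set 'rV[R]_n.+1 -> \bar R :=
  pushforward (lebesgue_measure \x mu) (@cons_rV n).

Let cons_measure0 : cons_measure set0 = 0.
Proof. by rewrite /cons_measure /pushforward preimage_set0 measure0. Qed.

Let cons_measure_ge0 A : 0 <= cons_measure A.
Proof. by apply: integral_ge0. Qed.

Let cons_measure_sigma_additive : semi_sigma_additive cons_measure.
Proof.
move=> F mF tF mUF; rewrite /cons_measure /pushforward preimage_bigcup.
have mcF A : measurable A -> measurable (@cons_rV n @^-1` A).
  by move=> mA; rewrite -[X in measurable X]setTI; exact: measurable_cons_rV.
apply: measure_semi_sigma_additive => [k||].
- exact: mcF.
- apply/trivIsetP => /= i j _ _ ij; rewrite -preimage_setI.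
  by move/trivIsetP : tF => /(_ _ _ _ _ ij) ->//; rewrite preimage_set0.
- by rewrite -preimage_bigcup; exact: mcF.
Qed.

HB.instance Definition _ := isMeasure.Build _ _ _ cons_measure
  cons_measure0 cons_measure_ge0 cons_measure_sigma_additive.

Let cons_measure_sigma_finite : sigma_finite setT cons_measure.
Proof.
have /sigma_finiteP[F [TF ndF Foo]] := sigma_finiteT (@lebesgue_measure R).
have /sigma_finiteP[G [TG ndG Goo]] := sigma_finiteT mu.
exists (fun k => @uncons_rV n @^-1` (F k `*` G k)).
  rewrite -preimage_bigcup (_ : \bigcup_k (F k `*` G k) = setT) ?preimage_setT//.
  apply/seteqP; split=> // -[x y] _.
  have [i _ Fix] : (\bigcup_k F k) x by rewrite -TF.
  have [j _ Gjy] : (\bigcup_k G k) y by rewrite -TG.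
  exists (maxn i j) => //; split => /=.
  - by move: x Fix; exact/subsetPset/ndF/leq_maxl.
  - by move: y Gjy; exact/subsetPset/ndG/leq_maxr.
move=> k; have [mF Fk] := Foo k; have [mG Gk] := Goo k; split.
  rewrite -[X in measurable X]setTI; apply: measurable_uncons_rV => //.
  exact: measurableX.
rewrite /cons_measure /pushforward -comp_preimage.
rewrite (_ : _ \o _ = id); last by apply/funext => u /=; rewrite cons_rVK.
by rewrite preimage_id product_measure1E// lte_mul_pinfty// ge0_fin_numE.
Qed.

HB.instance Definition _ := Measure_isSigmaFinite.Build _ _ _ cons_measure
  cons_measure_sigma_finite.

End cons_measure.

Fixpoint lebesgue_measure_rV (n : nat) :
    {sigma_finite_measure set 'rV[R]_n -> \bar R} :=
  match n with
  | 0 => \d_(0%R : 'rV[R]_0)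
  | m.+1 => cons_measure (lebesgue_measure_rV m)
  end.

Lemma lebesgue_measure_rV_box (n : nat) (A : 'I_n -> set (measurableTypeR R)) :
  (forall i, measurable (A i)) ->
  lebesgue_measure_rV n [set x | forall i, A i (x ord0 i)] =
  \prod_(i < n) lebesgue_measure (A i).
Proof.
elim: n A => [|n IHn] A mA /=.
  by rewrite big_ord0 diracE mem_set// => -[].
rewrite big_ord_recl -IHn// /cons_measure /pushforward.
rewrite -product_measure1E//; last first.
  rewrite [X in measurable X](_ : _ =
      \bigcap_(i in [set: 'I_n]) ((fun x : 'rV[R]_n => x ord0 i) @^-1` A (lift ord0 i))).
    apply: fin_bigcap_measurable => // i _.
    rewrite -[X in measurable X]setTI; apply: measurable_coord => //.
    exact: mA.
  by apply/seteqP; split=> [x Ax i _|x Ax i]; [exact: Ax|exact: (Ax i)].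
congr (product_measure1 _ _ _); apply/seteqP; split => [u Au|u [Au1 Au2] i] /=.
  split=> [|i] /=; first by rewrite -cons_rV0; exact: Au.
  by rewrite -cons_rVS; exact: Au.
by case: (unliftP ord0 i) => [j ->|->]; rewrite ?cons_rV0// cons_rVS; exact: Au2.
Qed.

End lebesgue_measure_rV.

Section log_concave_density.
Context (R : realType) (n : nat).
Implicit Types f : 'rV[R]_n -> R.

Definition probability_density f :=
  [/\ measurable_fun setT f, forall x, 0 <= f x &
      (\int[lebesgue_measure_rV R n]_x (f x)%:E = 1)%E].

(* [powR] satisfies [0 `^ 0 = 1] and [0 `^ a = 0] for [a != 0]. *)
Definition log_concave f := forall (x y : 'rV[R]_n) (t : R), 0 <= t <= 1 ->
  f x `^ t * f y `^ (1 - t) <= f (t *: x + (1 - t) *: y).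

End log_concave_density.

Section random_vector.
Context d (T : measurableType d) (R : realType) (n : nat).
Context (P : probability T R) (X : {RV P >-> 'rV[R]_n}).

Definition has_density (f : 'rV[R]_n -> R) := forall A, measurable A ->
  (distribution P X A = \int[lebesgue_measure_rV R n]_(x in A) (f x)%:E)%E.

Definition component (i : 'I_n) (w : T) : R := X w ord0 i.

(* Every entry [E[(X_i - E[X_i]) (X_j - E[X_j])]] is a convergent integral;
   outside this case [covariance] and [fine] return default values. *)
Definition finite_covariance :=
  (forall i, P.-integrable setT (EFin \o component i)) /\
  (forall i j, P.-integrable setT (EFin \o
     ((component i \- cst (fine 'E_P[component i])) *
      (component j \- cst (fine 'E_P[component j])))%R)).

Definition covariance_mx : 'M[R]_n :=
  \matrix_(i, j) fine (covariance P (component i) (component j)).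

End random_vector.

(* [1 / p] with [1 / +oo = 0]. *)
Definition recip (R : realType) (p : \bar R) : R := fine (p^-1)%E.

Definition C_bound (R : realType) (n : nat) : R :=
  (2 * pi * expR 1) `^ (n%:R / 2).

Definition D_bound (R : realType) (n : nat) : R :=
  ((n%:R ^+ 2 * expR 1 ^+ 2) / (2 * Num.sqrt 2 * (n%:R + 2))) `^ (n%:R / 2).

(* Main.v *)
Require Import Defs.
From HB Require Import structures.
From mathcomp Require Import all_boot all_order all_algebra.
From mathcomp Require Import all_classical all_reals all_analysis.
From mathcomp Require Import measurable_realfun ess_sup_inf ring lra.

Set Implicit Arguments.
Unset Strict Implicit.
Unset Printing Implicit Defensive.

Import Order.TTheory GRing.Theory Num.Theory.
Import numFieldNormedType.Exports.

Local Open Scope classical_set_scope.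
Local Open Scope ring_scope.

(** Both sides are compared with the Gaussian value and with the peak of the density.

    Lower bound for [||f||_q]. With [gamma] the Gaussian density having the mean and covariance
    of [f] and [a = 1 / (C(n) sqrt |Sigma|)], integrating
    [f^q / a^(q-1) >= f + (q - 1) (f ln (gamma / a) + f - gamma)] gives [int f^q >= a^(q-1)],
    hence [||f||_q >= a^(1-1/q)].

    Upper bound for [||f||_p]. It suffices that [f <= M := D(n) / sqrt |Sigma|], since then
    [||f||_p <= M^(1-1/p)]. The autocorrelation [g(z) = int f(z + y) f(y) dy] is an even
    probability density with covariance [2 Sigma], log-concave by Prekopa-Leindler, and
    [f <= 2^n g(0)]. Put [tau = n/(n+2)]; log-concavity gives
    [int g^tau g(0)^(1-tau) <= tau^-n]. Averaging [det Gram(v_1, ..., v_k, z)] (for the form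
    [(2 Sigma)^-1]) against [g] selects successively [v_1, ..., v_(n-1)] whose Gram determinant
    is large compared with the values [g(v_i)]. On their span [g] dominates, by log-concavity,
    an explicit weight supported on a cross-polytope, so [m(0)] is bounded below, where
    [m(s)] is the integral of [g] over the translate of the span by [s e]. The marginal [m] is
    even and log-concave, hence [2 m(0)^2 int s^2 m <= (int m)^3], and [int s^2 m] is again
    the average of a Gram determinant. All factors depending on the [v_i] cancel for this
    choice of [tau], which leaves an explicit bound on [g(0)^2 |Sigma|]. *)

(** * Changes of variables *)

(** In the lower bound the logarithm enters only through [ln (gamma / a) = (n - |y|^2) / 2], where
    [y] is the whitened variable. Its mean under [f] is zero because [f] and [gamma] share mean and
    covariance, so no integral of [f ln f] has to converge.

    Passing to [g] buys evenness: the peak sits at the origin, moments need no centring, and signs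
    of coordinates are irrelevant on a section. The price is the factor [2^n]; after squaring it is
    [4^n], of which [2^n] is regained from [\det (2 Sigma) = 2^n |Sigma|].

    The obstacle is that vectors spanning a large volume may lie where [g] is exponentially small,
    which weakens the bound on the central section. The comparison with [g^tau g(0)^(1-tau)] in the
    selection turns smallness into a gain: a selected [v] enlarges the Gram determinant by a factor
    [(g(0) / g(v))^(1-tau)]. The loss on the section is governed by the mean of the exponents over a
    cross-polytope, by Jensen's inequality, and is exactly paid for by this gain.

    The selection is a contradiction with an average, so it needs a constant strictly above
    [tau^-n]; this slack is absorbed by the numerical comparison with [D(n)]. *)

Section line.
Context (R : realType).
Local Notation mu := (@lebesgue_measure R).
Local Open Scope ereal_scope.

(** For a positive slope the scaled pushforward agrees with Lebesgue measure on the intervals []c,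
    d]], which determine it. A negative slope would exchange the open and the closed end, so it is
    first made positive by a reflection. *)
Lemma lebesgue_measure_affine (a b : R) (A : set R) : a != 0%R ->
  measurable A ->
  `|a|%:E * mu ((fun x => a * x + b)%R @^-1` A) = mu A.
Proof.
move=> a0 mA.
wlog a_gt0 : a b A a0 mA / (0 < a)%R.
  move=> hw; have [|aneg|a00] := ltgtP a 0%R; last by rewrite a00 eqxx in a0.
    move=> an; have mNA : measurable (-%R @^-1` A : set R).
      rewrite -[X in measurable X]setTI; exact: (measurable_funN (@measurable_id _ (measurableTypeR R) setT)).
    rewrite -[RHS]lebesgue_measureN// /pushforward -(hw (- a)%R (- b)%R (-%R @^-1` A)) ?oppr_eq0 ?oppr_gt0//.
    rewrite normrN; congr (_ * _); congr (lebesgue_measure _).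
    apply/seteqP; split => x /=; rewrite ?opprD ?mulNr ?opprK//.
  exact: hw.
have mf : measurable_fun setT ((fun x => a * x + b)%R : measurableTypeR R -> measurableTypeR R).
  by apply: measurable_funD => //; exact: measurable_funM.
pose phi := (fun x => a * x + b)%R : measurableTypeR R -> measurableTypeR R.
pose nu := mscale (NngNum (normr_ge0 a)) (pushforward mu phi).
have -> : mu A = nu mf A; last by [].
apply: (@lebesgue_measure_unique _ (nu mf)) => // _ [[c d]] _ <-.
rewrite /nu/= /mscale/= /pushforward/=.
have -> : phi @^-1` `]c, d]%classic = `]((c - b) / a)%R, ((d - b) / a)%R]%classic.
  apply/seteqP; split => x; rewrite /= !in_itv/= ltr_pdivrMr// ler_pdivlMr// (mulrC x) ltrBlDr lerBrDr//.
rewrite !lebesgue_measure_itv/= !lte_fin ltr_pM2r ?invr_gt0// ltrD2r.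
case: ifPn => [cd|_]; last by rewrite mule0.
rewrite gtr0_norm// -!EFinB -EFinM; congr EFin.
by field.
Qed.

Lemma integral_affine (a b : R) (f : R -> \bar R) : a != 0%R ->
  measurable_fun setT f -> (forall x, 0 <= f x) ->
  `|a|%:E * \int[mu]_x f (a * x + b)%R = \int[mu]_x f x.
Proof.
move=> a0 mf f0.
have mg : measurable_fun setT ((fun x => a * x + b)%R : measurableTypeR R -> measurableTypeR R).
  by apply: measurable_funD => //; exact: measurable_funM.
pose phi := (fun x => a * x + b)%R : measurableTypeR R -> measurableTypeR R.
pose nu := mscale (NngNum (normr_ge0 a)) (pushforward mu phi).
rewrite [RHS](eq_measure_integral (nu mg)); last first.
  by move=> A mA _; first [exact: (lebesgue_measure_affine b a0 mA) | exact: (esym (lebesgue_measure_affine b a0 mA))].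
rewrite ge0_integral_mscale//= (ge0_integral_pushforward mg)//.
Qed.

Lemma integral_shift (b : R) (f : R -> \bar R) :
  measurable_fun setT f -> (forall x, 0 <= f x) ->
  \int[mu]_x f (x + b)%R = \int[mu]_x f x.
Proof.
move=> mf f0; rewrite -(@integral_affine 1 b f)// normr1 mul1e.
by apply: eq_integral => x _; rewrite mul1r.
Qed.

Lemma integral_oppr (f : R -> \bar R) :
  measurable_fun setT f -> (forall x, 0 <= f x) ->
  \int[mu]_x f (- x)%R = \int[mu]_x f x.
Proof.
move=> mf f0; rewrite -(@integral_affine (-1) 0 f)// ?oppr_eq0// normrN normr1 mul1e.
by apply: eq_integral => x _; rewrite mulN1r addr0.
Qed.

End line.

Section rV_measure.
Context (R : realType).
Local Notation leb n := (lebesgue_measure_rV R n).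
Local Notation mu := (@lebesgue_measure R).
Local Open Scope ereal_scope.

Lemma measurable_pair_cons_rV (n : nat) (f : 'rV[R]_n.+1 -> \bar R) :
  measurable_fun setT f -> measurable_fun setT (f \o @cons_rV R n).
Proof. by move=> mf; apply: measurableT_comp mf _; exact: measurable_cons_rV. Qed.

Lemma integral_cons_rV (n : nat) (f : 'rV[R]_n.+1 -> \bar R) :
  measurable_fun setT f -> (forall x, 0 <= f x) ->
  \int[leb n.+1]_x f x = \int[mu]_s \int[leb n]_t f (cons_rV (s, t)).
Proof.
move=> mf f0; have mc := @measurable_cons_rV R n.
rewrite [LHS](ge0_integral_pushforward mc)// preimage_setT.
rewrite (fubini_tonelli1 (f \o @cons_rV R n))//.
exact: measurable_pair_cons_rV.
by move=> x; exact: f0.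
Qed.

Lemma integral_cons_rV_sym (n : nat) (f : 'rV[R]_n.+1 -> \bar R) :
  measurable_fun setT f -> (forall x, 0 <= f x) ->
  \int[leb n.+1]_x f x = \int[leb n]_t \int[mu]_s f (cons_rV (s, t)).
Proof.
move=> mf f0; rewrite integral_cons_rV//.
apply: (fubini_tonelli (f \o @cons_rV R n)) => [|x]; last exact: f0.
exact: measurable_pair_cons_rV.
Qed.

End rV_measure.

Section cons_algebra.
Context (R : realType).

Lemma uncons_rVK (n : nat) : cancel (@uncons_rV R n) (@cons_rV R n).
Proof.
move=> x; apply/rowP => i; case: (unliftP ord0 i) => [j ->|->].
  by rewrite cons_rVS mxE.
by rewrite cons_rV0.
Qed.

Lemma cons_rVD (n : nat) (s s' : R) (t t' : 'rV[R]_n) :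
  cons_rV (s, t) + cons_rV (s', t') = cons_rV (s + s', t + t').
Proof.
apply/rowP => i; rewrite mxE; case: (unliftP ord0 i) => [j ->|->].
  by rewrite !cons_rVS mxE.
by rewrite !cons_rV0.
Qed.

Lemma cons_rVZ (n : nat) (a s : R) (t : 'rV[R]_n) :
  a *: cons_rV (s, t) = cons_rV (a * s, a *: t).
Proof.
apply/rowP => i; rewrite mxE; case: (unliftP ord0 i) => [j ->|->].
  by rewrite !cons_rVS mxE.
by rewrite !cons_rV0.
Qed.

Lemma cons_rV00 (n : nat) : cons_rV (0, 0) = 0 :> 'rV[R]_n.+1.
Proof.
apply/rowP => i; rewrite [RHS]mxE; case: (unliftP ord0 i) => [j ->|->].
  by rewrite !cons_rVS mxE.
by rewrite !cons_rV0.
Qed.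

Lemma mul_cons_rV_block (n : nat) (s : R) (t : 'rV[R]_n)
    (a : R) (b : 'rV[R]_n) (c : 'cV[R]_n) (D : 'M[R]_n) :
  cons_rV (s, t) *m (block_mx a%:M b c D : 'M[R]_(1 + n)) =
  cons_rV (s * a + (t *m c) ord0 ord0, s *: b + t *m D).
Proof.
rewrite /cons_rV/= [LHS](mul_row_block s%:M t a%:M b c D) -scalar_mxM mul_scalar_mx; congr row_mx.
by rewrite [X in _ + X]mx11_scalar -raddfD.
Qed.

Lemma mul_cons_rV_col (n m : nat) (s : R) (t : 'rV[R]_n)
    (e : 'rV[R]_m) (V : 'M[R]_(n, m)) :
  cons_rV (s, t) *m (col_mx e V : 'M[R]_(1 + n, m)) = s *: e + t *m V.
Proof. by rewrite /cons_rV/= [LHS](mul_row_col s%:M t e V) mul_scalar_mx. Qed.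

End cons_algebra.

Section linear_change.
Context (R : realType).
Local Notation leb n := (lebesgue_measure_rV R n).
Local Notation mu := (@lebesgue_measure R).
Local Open Scope ereal_scope.

Lemma measurable_rV_affine (m n : nat) (A : 'M[R]_(m, n)) (b : 'rV[R]_n) :
  measurable_fun setT (fun x : 'rV[R]_m => x *m A + b)%R.
Proof.
apply/measurable_fun_rVP => i.
under eq_fun do rewrite !mxE.
apply: measurable_funD => //; apply: measurable_sum => j.
by apply: measurable_funM => //; exact: measurable_coord.
Qed.

Lemma measurable_rV_mul (m n : nat) (A : 'M[R]_(m, n)) :
  measurable_fun setT (fun x : 'rV[R]_m => x *m A)%R.
Proof.
rewrite (_ : (fun x => _) = (fun x : 'rV[R]_m => x *m A + 0)%R).
  exact: measurable_rV_affine.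
by apply/funext => x; rewrite addr0.
Qed.

Lemma measurable_rV_shift (n : nat) (b : 'rV[R]_n) :
  measurable_fun setT (fun x : 'rV[R]_n => x + b)%R.
Proof.
rewrite (_ : (fun x => _) = (fun x : 'rV[R]_n => x *m 1%:M + b)%R).
  exact: measurable_rV_affine.
by apply/funext => x; rewrite mulmx1.
Qed.

Lemma measurable_cons_rVl (n : nat) (f : 'rV[R]_n.+1 -> \bar R) (s : R) :
  measurable_fun setT f -> measurable_fun setT (fun t => f (cons_rV (s, t))).
Proof.
move=> mf; apply: (measurableT_comp mf).
exact: (measurableT_comp (@measurable_cons_rV R n) (measurable_pair1 s)).
Qed.

Lemma measurable_cons_rVr (n : nat) (f : 'rV[R]_n.+1 -> \bar R) (t : 'rV[R]_n) :
  measurable_fun setT f -> measurable_fun setT (fun s : measurableTypeR R => f (cons_rV (s, t))).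
Proof.
move=> mf; apply: (measurableT_comp mf).
exact: (measurableT_comp (@measurable_cons_rV R n) (measurable_pair2 t)).
Qed.

Lemma measurable_integral_cons_rV (n : nat) (f : 'rV[R]_n.+1 -> \bar R) :
  measurable_fun setT f -> (forall x, 0 <= f x) ->
  measurable_fun setT (fun s : measurableTypeR R => \int[leb n]_t f (cons_rV (s, t))).
Proof.
move=> mf f0.
apply: (measurable_fun_fubini_tonelli_F (f \o @cons_rV R n)) => [|x]; last exact: f0.
exact: measurable_pair_cons_rV.
Qed.

Lemma measurable_integral_cons_rV_sym (n : nat) (f : 'rV[R]_n.+1 -> \bar R) :
  measurable_fun setT f -> (forall x, 0 <= f x) ->
  measurable_fun setT (fun t => \int[mu]_s f (cons_rV (s, t))).
Proof.
move=> mf f0.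
apply: (measurable_fun_fubini_tonelli_G (f \o @cons_rV R n)) => [|x]; last exact: f0.
exact: measurable_pair_cons_rV.
Qed.

Lemma integral_rV0 (f : 'rV[R]_0 -> \bar R) : measurable_fun setT f ->
  (forall x, 0 <= f x) -> \int[leb 0]_x f x = f 0%R.
Proof. by move=> mf f0; rewrite /= integral_dirac// diracT mul1e. Qed.

Lemma integral_rV_shift (n : nat) (b : 'rV[R]_n) (f : 'rV[R]_n -> \bar R) :
  measurable_fun setT f -> (forall x, 0 <= f x) ->
  \int[leb n]_x f (x + b)%R = \int[leb n]_x f x.
Proof.
elim: n b f => [|n IH] b f mf f0.
  by apply: eq_integral => x _; congr f; apply/rowP => -[].
rewrite !integral_cons_rV//; last first.
  by apply: (measurableT_comp mf); exact: measurable_rV_shift.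
rewrite -(uncons_rVK b); case: (uncons_rV b) => b0 b'.
under eq_integral => s _ do under eq_integral => t _ do rewrite cons_rVD.
under eq_integral => s _.
  rewrite (IH b' (fun t => f (cons_rV ((s + b0)%R, t))))//; last exact: measurable_cons_rVl.
  over.
rewrite (integral_shift b0 (f := fun s => \int[leb n]_t f (cons_rV (s, t))))//.
  exact: measurable_integral_cons_rV.
by move=> s; exact: integral_ge0.
Qed.

(** Isolated as a property of [A] because it is stable under products: a matrix is then treated
    factor by factor. *)
Definition linear_change_of_variables (n : nat) (A : 'M[R]_n) :=
  forall f : 'rV[R]_n -> \bar R, measurable_fun setT f -> (forall x, 0 <= f x) ->
  `|\det A|%:E * \int[leb n]_x f (x *m A) = \int[leb n]_x f x.

Lemma linear_change_mul (n : nat) (A B : 'M[R]_n) :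
  linear_change_of_variables A -> linear_change_of_variables B ->
  linear_change_of_variables (A *m B).
Proof.
move=> hA hB f mf f0; rewrite det_mulmx normrM EFinM (muleC `|\det A|%:E) -muleA.
under eq_integral => x _ do rewrite mulmxA.
rewrite (hA (fun x => f (x *m B)))//; first exact: hB.
by apply: (measurableT_comp mf); exact: measurable_rV_mul.
Qed.

Lemma linear_change_lower (n : nat) (b : 'rV[R]_n) (D : 'M[R]_n) :
  linear_change_of_variables D ->
  linear_change_of_variables (block_mx 1%:M b 0 D : 'M[R]_(1 + n)).
Proof.
move=> hD f mf f0; rewrite (det_ublock (1%:M : 'M[R]_1)) det1 mul1r.
rewrite !integral_cons_rV//; last first.
  by apply: (measurableT_comp mf); exact: measurable_rV_mul.
have mfl s := measurable_cons_rVl s mf.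
rewrite -ge0_integralZl//; last 2 first.
- apply: (@measurable_integral_cons_rV _ (fun x => f (x *m _))) => //.
  by apply: (measurableT_comp mf); exact: measurable_rV_mul.
- by move=> s _; exact: integral_ge0.
apply: eq_integral => s _.
under eq_integral => t _ do
  rewrite mul_cons_rV_block mulmx0 mxE mulr1 addr0 addrC.
rewrite (hD (fun t => f (cons_rV (s, t + s *: b)%R)))//.
  by rewrite (integral_rV_shift _ (f := fun t => f (cons_rV (s, t)))).
by apply: (measurableT_comp (mfl s)); exact: measurable_rV_shift.
Qed.

Lemma linear_change_upper (n : nat) (a : R) (c : 'cV[R]_n) : a != 0%R ->
  linear_change_of_variables (block_mx a%:M 0 c 1%:M : 'M[R]_(1 + n)).
Proof.
move=> a0 f mf f0; rewrite (det_lblock (a%:M : 'M[R]_1)) det1 mulr1 det_scalar1.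
rewrite !integral_cons_rV_sym//; last first.
  by apply: (measurableT_comp mf); exact: measurable_rV_mul.
rewrite -ge0_integralZl//; last 2 first.
- apply: (@measurable_integral_cons_rV_sym _ (fun x => f (x *m _))) => //.
  by apply: (measurableT_comp mf); exact: measurable_rV_mul.
- by move=> s _; exact: integral_ge0.
apply: eq_integral => t _.
under eq_integral => s _ do
  rewrite mul_cons_rV_block scaler0 add0r mulmx1 (mulrC s).
rewrite (integral_affine _ (f := fun s => f (cons_rV (s, t))) a0)//.
exact: measurable_cons_rVr.
Qed.

(** Induction on the dimension. If the lower right block [D] is invertible, the matrix is the
    product of a map that keeps the first coordinate and acts on the others by [D] and a
    translation, and of a map that keeps the others and acts affinely on the first. Tonelli's
    theorem handles each factor. *)
Lemma integral_linear_change (n : nat) (A : 'M[R]_n) : \det A != 0%R ->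
  linear_change_of_variables A.
Proof.
elim: n A => [|n IH] A detA.
  move=> f mf f0; rewrite det_mx00 normr1 mul1e.
  by apply: eq_integral => x _; congr f; apply/rowP => -[].
have block (a : R) (b : 'rV[R]_n) (c : 'cV[R]_n) (D : 'M[R]_n) :
    \det (block_mx a%:M b c D : 'M[R]_(1 + n)) != 0%R -> \det D != 0%R ->
    linear_change_of_variables (block_mx a%:M b c D : 'M[R]_(1 + n)).
  move=> dB dD; have uD : D \in unitmx by rewrite unitmxE unitfE.
  pose c' := (invmx D *m c)%R; pose a' := (a - (b *m c') ord0 ord0)%R.
  have E : block_mx a%:M b c D =
      (block_mx 1%:M b 0 D : 'M[R]_(1 + n)) *m (block_mx a'%:M 0 c' 1%:M : 'M[R]_(1 + n)).
    rewrite mulmx_block !mul1mx !mulmx1 !mulmx0 !mul0mx !add0r /c' mulKVmx//.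
    congr block_mx; rewrite [X in (_ + X)%R]mx11_scalar -raddfD /a'/=.
    by rewrite subrK.
  rewrite E; apply: linear_change_mul.
    by apply: linear_change_lower; exact: IH.
  apply: linear_change_upper; apply: contraNneq dB => a'0.
  by rewrite E det_mulmx (det_lblock (a'%:M : 'M[R]_1)) a'0 det_scalar1 mul0r mulr0.
have [a [b [c [D EA]]]] : exists a b c D, A = block_mx a%:M b c D :> 'M[R]_(1 + n).
  exists (ulsubmx (A : 'M[R]_(1 + n)) ord0 ord0), (ursubmx (A : 'M[R]_(1 + n))).
  exists (dlsubmx (A : 'M[R]_(1 + n))), (drsubmx (A : 'M[R]_(1 + n))).
  by rewrite -mx11_scalar submxK.
have [D0|dD] := eqVneq (\det D) 0%R; last by rewrite EA; apply: block => //; rewrite -EA.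
(* A singular [D] is replaced by [c *m u + D], through a shear with [u *m k^T = 1]. If [x] is in the
   left kernel of the new block, multiplying by [k^T] gives [x *m c = 0], then [x *m D = 0], so
   [(0, x)] is in the left kernel of [A]. *)
have [k k0 Dk] : exists2 k : 'rV[R]_n, k != 0%R & (k *m D^T = 0)%R.
  by apply/det0P; rewrite det_tr D0.
have [j kj] : exists j, k ord0 j != 0%R.
  apply/existsP; apply: contra_neqT k0 => /existsPn k0.
  by apply/rowP => j; rewrite mxE; apply/eqP; move: (k0 j); rewrite negbK.
pose u : 'rV[R]_n := ((k ord0 j)^-1 *: delta_mx ord0 j)%R.
have Dkt : (D *m k^T = 0)%R by rewrite -[D]trmxK -trmx_mul Dk trmx0.
have uk : (u *m k^T = 1%:M)%R.
  rewrite -scalemxAl -rowE; apply/rowP => i; rewrite !mxE ord1.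
  by rewrite ?ord1 mulVf //.
pose E : 'M[R]_(1 + n) := block_mx 1%:M u 0 1%:M.
pose E' : 'M[R]_(1 + n) := block_mx 1%:M (- u)%R 0 1%:M.
have detE : \det E = 1%R by rewrite (det_ublock (1%:M : 'M[R]_1)) !det1 mulr1.
have EE' : (E *m E' = 1%:M)%R.
  rewrite mulmx_block !mul1mx !mulmx1 !mulmx0 !mul0mx !add0r !addr0.
  by rewrite addNr -scalar_mx_block.
have -> : A = ((A : 'M[R]_(1 + n)) *m E *m E')%R by rewrite -mulmxA EE' mulmx1.
apply: linear_change_mul; last first.
  by apply: linear_change_lower => f mf f0; rewrite det1 normr1 mul1e; apply: eq_integral => x _; rewrite mulmx1.
have AE : (A : 'M[R]_(1 + n)) *m E = block_mx a%:M (a *: u + b)%R c (c *m u + D)%R.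
  by rewrite EA mulmx_block !mulmx1 !mulmx0 !addr0 mul_scalar_mx.
rewrite AE; apply: block; first by rewrite -AE det_mulmx detE mulr1.
apply/negP => /det0P[x x0 xD].
have xc : (x *m c = 0)%R.
  have := congr1 (fun z => z *m k^T)%R xD.
  by rewrite mul0mx mulmxDr mulmxDl -!mulmxA Dkt uk mulmx1 mulmx0 addr0.
have xD0 : (x *m D = 0)%R by move: xD; rewrite mulmxDr mulmxA xc mul0mx add0r.
have : cons_rV (0%R, x) *m A = 0%R.
  rewrite EA mul_cons_rV_block xc xD0 mul0r scale0r !mxE !addr0.
  exact: cons_rV00.
move/(congr1 (mulmx^~ (invmx A))); rewrite mulmxK ?unitmxE ?unitfE// mul0mx.
move/rowP => x00; move/eqP: x0; apply; apply/rowP => i.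
by have := x00 (lift ord0 i); rewrite cons_rVS !mxE.
Qed.

Lemma integral_rV_scale (n : nat) (a : R) (f : 'rV[R]_n -> \bar R) : (0 < a)%R ->
  measurable_fun setT f -> (forall x, 0 <= f x) ->
  (a ^+ n)%:E * \int[leb n]_x f (a *: x)%R = \int[leb n]_x f x.
Proof.
move=> a0 mf f0; have := @integral_linear_change n a%:M _ f mf f0.
rewrite det_scalar expf_neq0 ?gt_eqF// => /(_ isT) <-.
rewrite ger0_norm ?exprn_ge0 ?ltW//; congr (_ * _).
by apply: eq_integral => x _; rewrite mul_mx_scalar.
Qed.

Lemma integral_rVN (n : nat) (f : 'rV[R]_n -> \bar R) :
  measurable_fun setT f -> (forall x, 0 <= f x) ->
  \int[leb n]_x f (- x)%R = \int[leb n]_x f x.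
Proof.
move=> mf f0; have := @integral_linear_change n (-1)%:M _ f mf f0.
rewrite det_scalar expf_neq0 ?oppr_eq0 ?oner_neq0// => /(_ isT) <-.
rewrite normrX normrN1 expr1n mul1e.
by apply: eq_integral => x _; rewrite mul_mx_scalar scaleN1r.
Qed.

End linear_change.

(** * The Prekopa-Leindler inequality *)

Section prekopa_leindler_line.
Context (R : realType).
Local Notation mu := (@lebesgue_measure R).
Local Open Scope ereal_scope.

(** With [a = max A] and [b = min B], the copies [t A + (1 - t) b] and [t a + (1 - t) B] lie in [C]
    on either side of their common point [t a + (1 - t) b]. Removing the null set [{a}] from [A]
    makes them disjoint, and their measures add up. *)
Lemma brunn_minkowski_compact (t : R) (A B C : set R) : (0 < t < 1)%R ->
  compact A -> compact B -> A !=set0 -> B !=set0 -> measurable C ->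
  (forall a b, A a -> B b -> C (t * a + (1 - t) * b)%R) ->
  t%:E * mu A + (1 - t)%:E * mu B <= mu C.
Proof.
move=> /andP[t0 t1] cA cB A0 B0 mC ABC.
have t1' : (0 < 1 - t)%R by rewrite subr_gt0.
have cid X : {within X, continuous (@idfun R)} by apply: continuous_subspaceT => x; exact: cvg_id.
have [a /set_mem Aa amax] := compact_EVT_max A0 cA (cid A).
have [b /set_mem Bb bmin] := compact_EVT_min B0 cB (cid B).
have mA := compact_measurable cA; have mB := compact_measurable cB.
have image_affine (s c : R) (X : set R) : (0 < s)%R -> measurable X ->
    measurable ((fun z => s^-1 * z + (- (s^-1 * c)))%R @^-1` X) /\
    mu ((fun z => s^-1 * z + (- (s^-1 * c)))%R @^-1` X) = s%:E * mu X.
  move=> s0 mX; split.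
    rewrite -[X in measurable X]setTI.
    suff : measurable_fun setT (fun z : measurableTypeR R => s^-1 * z + (- (s^-1 * c)))%R by apply.
    by apply: measurable_funD => //; exact: measurable_funM.
  rewrite -(@lebesgue_measure_affine _ s^-1 (- (s^-1 * c))%R X) ?invr_eq0 ?gt_eqF//.
  by rewrite muleA gtr0_norm ?invr_gt0// -EFinM mulfV ?gt_eqF// mul1e.
have mA' : measurable (A `\ a) by exact: measurableD.
have [mS1 <-] := image_affine (1 - t)%R (t * a)%R B t1' mB.
have -> : mu A = mu (A `\ a).
  rewrite -[in LHS](setD1K Aa) measureU//.
    by rewrite -[X in X + _]/(lebesgue_measure _) lebesgue_measure_set1 add0e.
  by rewrite setDE setICA setICr setI0.
have [mS2 <-] := image_affine t ((1 - t) * b)%R (A `\ a) t0 mA'.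
rewrite -measureU//; last first.
  apply/seteqP; split => // z [[/= Az za] Bz].
  have := amax _ (mem_set Az); have := bmin _ (mem_set Bz) => /=.
  set z1 := (t^-1 * z + _)%R in Az za *; set z2 := (_ + _)%R in Bz *.
  have E1 : (z = t * z1 + (1 - t) * b)%R by rewrite /z1; field; rewrite gt_eqF.
  have E2 : (z = t * a + (1 - t) * z2)%R by rewrite /z2; field; rewrite gt_eqF.
  move=> bz2 z1a; apply: za; apply/eqP; rewrite eq_le z1a /=.
  rewrite -(ler_pM2l t0) -(lerD2r ((1 - t) * b)) -E1 E2 lerD2l.
  by rewrite ler_pM2l.
apply: le_measure; rewrite ?inE//; first exact: measurableU.
move=> z [[Az _]|Bz].
  have -> : (z = t * (t^-1 * z + - (t^-1 * ((1 - t) * b))) + (1 - t) * b)%R.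
    by field; rewrite gt_eqF.
  exact: ABC.
have -> : (z = t * a + (1 - t) * ((1 - t)^-1 * z + - ((1 - t)^-1 * (t * a))))%R.
  by field; rewrite gt_eqF.
exact: ABC.
Qed.

(** Inner regularity reduces the claim to compact subsets, kept nonempty by adjoining [a] and [b].
    The two suprema are taken one after the other, which subtraction allows once [mu C] is
    finite. *)
Lemma brunn_minkowski_line (t : R) (A B C : set R) : (0 < t < 1)%R ->
  measurable A -> measurable B -> A !=set0 -> B !=set0 -> measurable C ->
  (forall a b, A a -> B b -> C (t * a + (1 - t) * b)%R) ->
  t%:E * mu A + (1 - t)%:E * mu B <= mu C.
Proof.
move=> t01 mA mB [a Aa] [b Bb] mC ABC; have /andP[t0 t1] := t01.
have t1' : (0 < 1 - t)%R by rewrite subr_gt0.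
have [->|Cfin] := eqVneq (mu C) +oo; first exact: leey.
have {}Cfin : mu C \is a fin_num by rewrite ge0_fin_numE// ltey.
have H K L : compact K -> K `<=` A -> compact L -> L `<=` B ->
    t%:E * mu K + (1 - t)%:E * mu L <= mu C.
  move=> cK KA cL LB.
  have cK' : compact (K `|` [set a]) by apply: compactU => //; exact: compact_set1.
  have cL' : compact (L `|` [set b]) by apply: compactU => //; exact: compact_set1.
  have K0 : K `|` [set a] !=set0 by exists a; right.
  have L0 : L `|` [set b] !=set0 by exists b; right.
  apply: (le_trans _ (@brunn_minkowski_compact t _ _ C t01 cK' cL' K0 L0 mC _)); last first.
    by move=> x y [/KA ?|->] [/LB ?|->]; exact: ABC.
  by apply: leeD; rewrite lee_pmul2l//; apply: le_measure => //;
    rewrite ?inE; exact: compact_measurable.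
have muE X : measurable X -> mu X = ereal_sup [set mu K | K in [set K | compact K /\ K `<=` X]].
  exact: lebesgue_regularity_inner_sup.
have HA L : compact L -> L `<=` B -> t%:E * mu A + (1 - t)%:E * mu L <= mu C.
  move=> cL LB.
  have Lfin : (1 - t)%:E * mu L \is a fin_num.
    rewrite fin_numM// ge0_fin_numE//; exact: compact_finite_measure.
  rewrite -leeBrDr// -lee_pdivlMl// muE//; apply: ge_ereal_sup => _ [K [cK KA] <-].
  by rewrite lee_pdivlMl// leeBrDr//; exact: H.
have [Afin|] := boolP (t%:E * mu A \is a fin_num); last first.
  rewrite ge0_fin_numE; last by apply: mule_ge0 => //; rewrite lee_fin ltW.
  rewrite -leNgt leye_eq => /eqP tA.
  have := HA set0 compact0 (sub0set _).
  by rewrite tA measure0 mule0 adde0 leye_eq => /eqP CE; rewrite CE in Cfin.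
rewrite addeC -leeBrDr// -lee_pdivlMl// [mu B]muE//; apply: ge_ereal_sup => _ [K [cK KA] <-].
by rewrite lee_pdivlMl// leeBrDr// addeC; exact: HA.
Qed.

Lemma measurable_hypograph (u : R -> R) : measurable_fun setT u ->
  measurable [set p : measurableTypeR R * measurableTypeR R | (0 < p.2 < u p.1)%R].
Proof.
move=> mf; set A := [set p | _].
rewrite (_ : A = (fun p : measurableTypeR R * measurableTypeR R => (0 < p.2)%R && (p.2 < u p.1)%R) @^-1` [set true]); last first.
  by apply/seteqP; split => p.
rewrite -[X in measurable X]setTI.
suff : measurable_fun setT (fun p : measurableTypeR R * measurableTypeR R => (0 < p.2)%R && (p.2 < u p.1)%R) by apply.
apply: measurable_and; apply: measurable_fun_ltr => //; try exact: measurable_snd.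
by apply: (measurableT_comp mf); exact: measurable_fst.
Qed.

Lemma superlevelE (u : R -> R) (y : R) :
  [set x | (0 < y < u x)%R] =
  ysection [set p : measurableTypeR R * measurableTypeR R | (0 < p.2 < u p.1)%R] y.
Proof. by apply/seteqP; split => x /=; rewrite /ysection/= inE. Qed.

Lemma measurable_superlevel (u : R -> R) (y : R) : measurable_fun setT u ->
  measurable ([set x | (0 < y < u x)%R] : set (measurableTypeR R)).
Proof.
by move=> mu'; rewrite superlevelE; apply: measurable_ysection; exact: measurable_hypograph.
Qed.

Lemma measurable_fun_superlevel (u : R -> R) : measurable_fun setT u ->
  measurable_fun setT (fun y : measurableTypeR R => mu [set x | (0 < y < u x)%R]).
Proof.
move=> mu'; under eq_fun do rewrite superlevelE.
exact: (measurable_fun_ysection mu (measurable_hypograph mu')).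
Qed.

(** Tonelli's theorem for the region under the graph. The condition [0 < y] in the level set lets
    the outer integral run over the whole line. *)
Lemma layer_cake (u : R -> R) : measurable_fun setT u -> (forall x, 0 <= u x)%R ->
  \int[mu]_x (u x)%:E = \int[mu]_y mu [set x | (0 < y < u x)%R].
Proof.
move=> mf u0.
pose A := [set p : measurableTypeR R * measurableTypeR R | (0 < p.2 < u p.1)%R].
have mA : measurable A by exact: measurable_hypograph.
have mI : measurable_fun setT (fun p => (\1_A p)%:E : \bar R).
  by apply/measurable_EFinP; exact: measurable_indic.
have := @fubini_tonelli _ _ _ _ R mu mu _ mI (fun p => _).
under eq_integral => x _.
  rewrite (_ : \int[mu]_y (\1_A (x, y))%:E = (u x)%:E); last first.
    rewrite (eq_integral (fun y : measurableTypeR R => (\1_(`]0%R, u x[%classic : set R) y)%:E)).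
      rewrite integral_indic// setIT [LHS]lebesgue_measure_itv/= lte_fin sube0.
      by case: ltP => // ux; congr EFin; apply/eqP; rewrite eq_le ux u0.
    by move=> y _; congr EFin.
  over.
move=> ->; last by move=> p; rewrite lee_fin.
apply: eq_integral => y _.
have mS := measurable_superlevel y mf.
transitivity (\int[mu]_x (\1_([set x | (0 < y < u x)%R] : set (measurableTypeR R)) x)%:E).
  by [].
rewrite integral_indic// ?setIT//.
Qed.

(** Allows a product of powers of possibly infinite integrals to be tested on finite positive lower
    bounds. If one factor is infinite, its lower bound can be chosen to make the product exceed any
    real. *)
Lemma poweR_le_of_lt (I J H : \bar R) (t : R) : (0 < t < 1)%R ->
  0 <= I -> 0 <= J -> 0 <= H ->
  (forall a b : R, (0 < a)%R -> (0 < b)%R -> a%:E < I -> b%:E < J ->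
     (a `^ t * b `^ (1 - t))%:E <= H) ->
  I `^ t * J `^ (1 - t) <= H.
Proof.
move=> /andP[t0 t1] I0 J0 H0 abH.
have t1' : (0 < 1 - t)%R by rewrite subr_gt0.
case: H H0 abH => [h||]//; last by move=> _ _; exact: leey.
rewrite lee_fin => h0 abH.
have [I00|In0] := eqVneq I 0; first by rewrite I00 poweR0r ?gt_eqF// mul0e.
have [J00|Jn0] := eqVneq J 0; first by rewrite J00 poweR0r ?gt_eqF// mule0.
have {I0 In0} I0 : 0 < I by rewrite lt_neqAle eq_sym In0.
have {J0 Jn0} J0 : 0 < J by rewrite lt_neqAle eq_sym Jn0.
have ex_lt (K : \bar R) : 0 < K -> exists2 b : R, (0 < b)%R & b%:E < K.
  case: K => [k||]//; last by move=> _; exists 1%R => //; rewrite ltry.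
  by rewrite lte_fin => k0; exists (k / 2)%R; rewrite ?lte_fin; lra.
have big (s b : R) : (0 < s)%R -> (0 < b)%R ->
    exists2 a : R, (0 < a)%R & (h < a `^ s * b)%R.
  move=> s0 b0; have hb : (0 < (h + 1) / b)%R by rewrite divr_gt0// ltr_wpDl.
  exists (((h + 1) / b) `^ s^-1)%R; first exact: powR_gt0.
  by rewrite -powRrM mulVf ?gt_eqF// powRr1 ?ltW// divfK ?gt_eqF// ltrDl.
have ylt (a : R) : a%:E < +oo by exact: ltry.
case: I I0 abH => [i||]// I0 abH; last first.
  have [b b0 bJ] := ex_lt J J0.
  have [a a0 ha] := big t (b `^ (1 - t))%R t0 (powR_gt0 _ b0).
  by have := abH a b a0 b0 (ylt a) bJ; rewrite lee_fin leNgt ha.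
case: J J0 abH => [j||]// J0 abH; last first.
  have [b b0 bI] := ex_lt i%:E I0.
  have [a a0 ha] := big (1 - t)%R (b `^ t)%R t1' (powR_gt0 _ b0).
  by have := abH b a b0 a0 bI (ylt a); rewrite lee_fin leNgt mulrC ha.
rewrite !lte_fin in I0 J0.
rewrite !poweR_EFin -EFinM lee_fin.
apply/ler_addgt0Pr => e e0.
set k := (i `^ t * j `^ (1 - t))%R.
have k0 : (0 < k)%R by rewrite mulr_gt0// powR_gt0.
(* Both integrals are shrunk by the same [c < 1]; as the exponents add up to 1, the product [k] is
   shrunk by exactly [c], and [c * k <= h] yields [k <= h + e]. *)
pose c := (k / (k + e))%R.
have c01 : (0 < c < 1)%R.
  by rewrite divr_gt0 ?addr_gt0//= ltr_pdivrMr ?addr_gt0// mul1r ltrDl.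
have /andP[c0 c1] := c01.
have := abH (c * i)%R (c * j)%R (mulr_gt0 c0 I0) (mulr_gt0 c0 J0).
rewrite 2!lte_fin !gtr_pMl// => /(_ c1 c1); rewrite lee_fin.
rewrite (powRM _ (ltW c0) (ltW I0)) (powRM _ (ltW c0) (ltW J0)) mulrACA -powRD; last first.
  by rewrite subrKC oner_eq0.
rewrite subrKC powRr1 ?(ltW c0)// -/k /c.
have ke : (0 < k + e)%R by rewrite addr_gt0.
rewrite mulrAC ler_pdivrMr// => hk.
have := k0; nra.
Qed.

Lemma le_mine_nat (a : \bar R) (m n : nat) : (m <= n)%N ->
  mine a m%:R%:E <= mine a n%:R%:E.
Proof. by move=> mn; rewrite le_min !ge_min lexx/= lee_fin ler_nat mn orbT. Qed.

(** Weighted arithmetic-geometric inequality, from Young's inequality with the conjugate exponents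
    [1 / t] and [1 / (1 - t)]. *)
Lemma young_ereal (t : R) (I J : \bar R) : (0 < t < 1)%R -> 0 <= I -> 0 <= J ->
  I `^ t * J `^ (1 - t) <= t%:E * I + (1 - t)%:E * J.
Proof.
move=> /andP[t0 t1]; have t1' : (0 < 1 - t)%R by rewrite subr_gt0.
case: I => [i||]//; last first.
  move=> _ J0; rewrite gt0_muley ?lte_fin// addye ?leey// gt_eqF//.
  by rewrite (lt_le_trans ltNy0)// mule_ge0// lee_fin ltW.
case: J => [j||]//; last first.
  by move=> _ _; rewrite gt0_muley ?lte_fin// addey// leey.
rewrite 2!lee_fin => i0 j0; rewrite !poweR_EFin -!EFinM -EFinD lee_fin.
have := @conjugate_powR R (i `^ t)%R (j `^ (1 - t))%R t^-1%R (1 - t)^-1%R (powR_ge0 _ _) (powR_ge0 _ _).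
rewrite !invr_gt0 !invrK subrKC => /(_ t0 t1' erefl) /le_trans; apply.
by rewrite -!powRrM !mulfV ?gt_eqF// !powRr1// !(mulrC t) (mulrC (1 - t)%R).
Qed.

(** Brunn-Minkowski needs nonempty sets, so [f] and [g] are divided by their suprema [a] and [b],
    and [h] by [a^t b^(1-t)]. All levels in []0, 1[] are then nonempty for both, and the other
    levels contribute nothing to the left side. Integrating over the levels gives an additive
    inequality, and the arithmetic-geometric inequality turns it into the multiplicative one. The
    bound [M] makes the suprema finite. *)
Lemma prekopa_leindler_bounded (t : R) (f g h : R -> R) (M : R) : (0 < t < 1)%R ->
  measurable_fun setT f -> measurable_fun setT g -> measurable_fun setT h ->
  (forall x, 0 <= f x <= M)%R -> (forall x, 0 <= g x <= M)%R -> (forall x, 0 <= h x)%R ->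
  (forall x y, f x `^ t * g y `^ (1 - t) <= h (t * x + (1 - t) * y))%R ->
  (\int[mu]_x (f x)%:E) `^ t * (\int[mu]_x (g x)%:E) `^ (1 - t) <= \int[mu]_x (h x)%:E.
Proof.
move=> t01 mf mg mh fM gM h0 fgh; have /andP[t0 t1] := t01.
have t1' : (0 < 1 - t)%R by rewrite subr_gt0.
have bounded (u : R -> R) : (forall x, 0 <= u x <= M)%R ->
    (forall x, u x = 0%R) \/ exists c : R, [/\ (0 < c)%R, (forall x, u x <= c)%R &
      (forall l : R, l < 1 -> exists x, l * c < u x)%R].
  move=> uM; have su : has_sup (range u).
    split; first by exists (u 0%R); exists 0%R.
    by exists M => _ [x _ <-]; case/andP: (uM x).
  have uc x : (u x <= sup (range u))%R by apply: sup_upper_bound => //; exists x.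
  have [u0|c0] := leP (sup (range u)) 0%R; [left|right].
    by move=> x; apply/eqP; rewrite eq_le (le_trans (uc x) u0); case/andP: (uM x).
  exists (sup (range u)); split => // l l1.
  have [_ [x _ <-] lx] : exists2 y, range u y & (sup (range u) - (1 - l) * sup (range u) < y)%R.
    by apply: sup_adherent => //; rewrite mulr_gt0// subr_gt0.
  by exists x; move: lx; rewrite mulrBl mul1r opprB addrC subrK.
have H0 : 0 <= \int[mu]_x (h x)%:E by apply: integral_ge0 => x _; rewrite lee_fin.
have [f0|[a [a0 fa la]]] := bounded f fM.
  under eq_integral => x _ do rewrite f0.
  by rewrite integral0 poweR0r ?gt_eqF// mul0e.
have [g0|[b [b0 gb lb]]] := bounded g gM.
  under [X in _ * X `^ _]eq_integral => x _ do rewrite g0.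
  by rewrite integral0 [X in _ * X]poweR0r ?gt_eqF// mule0.
pose c := (a `^ t * b `^ (1 - t))%R.
have c0 : (0 < c)%R by rewrite mulr_gt0// powR_gt0.
have scale (k : R) (u : R -> R) : (0 < k)%R -> measurable_fun setT u -> (forall x, 0 <= u x)%R ->
   \int[mu]_x (u x)%:E = k%:E * \int[mu]_y mu [set x | (0 < y < k^-1 * u x)%R].
  move=> k0 mu' u0; rewrite -layer_cake; last 2 first.
  - exact: measurable_funM.
  - by move=> x; rewrite mulr_ge0// invr_ge0 ltW.
  under [in RHS]eq_integral => x _ do rewrite EFinM.
  rewrite ge0_integralZl_EFin ?invr_ge0 ?ltW//.
  - by rewrite muleA -EFinM mulfV ?gt_eqF// mul1e.
  - by move=> x _; rewrite lee_fin.
  - exact/measurable_EFinP.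
have f0 x : (0 <= f x)%R by case/andP: (fM x).
have g0 x : (0 <= g x)%R by case/andP: (gM x).
rewrite (scale a f)// (scale b g)// (scale c h)//.
set F := fun y : R => mu [set x | (0 < y < a^-1 * f x)%R].
set G := fun y : R => mu [set x | (0 < y < b^-1 * g x)%R].
set H := fun y : R => mu [set x | (0 < y < c^-1 * h x)%R].
have mscaled (k : R) (u : R -> R) : measurable_fun setT u -> measurable_fun setT (fun x => k^-1 * u x)%R.
  by move=> mu'; exact: measurable_funM.
have mset (k y : R) (u : R -> R) : measurable_fun setT u -> measurable [set x | (0 < y < k^-1 * u x)%R].
  by move=> mu'; apply: measurable_superlevel; exact: mscaled.
have FGH y : t%:E * F y + (1 - t)%:E * G y <= H y.
  have [y0|y0] := leP y 0%R.
    have E (u : R -> R) : mu [set x | (0 < y < u x)%R] = 0.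
      rewrite (_ : [set x | _] = set0) ?measure0//.
      by apply/seteqP; split => // x /= /andP[/lt_le_trans/(_ y0)]; rewrite ltxx.
    by rewrite /F /G /H !E !mule0 adde0.
  have [y1|y1] := leP 1%R y.
    have E (k : R) (u : R -> R) : (0 < k)%R -> (forall x, u x <= k)%R -> mu [set x | (0 < y < k^-1 * u x)%R] = 0.
      move=> k0 uk; rewrite (_ : [set x | _] = set0) ?measure0//.
      apply/seteqP; split => // x /= /andP[_]; rewrite ltNge => /negP; apply.
      by rewrite (le_trans _ y1)// ler_pdivrMl// mulr1.
    by rewrite /F /G !E// !mule0 adde0.
  have ne (k : R) (u : R -> R) : (0 < k)%R -> (forall l : R, l < 1 -> exists x, l * k < u x)%R ->
      [set x | (0 < y < k^-1 * u x)%R] !=set0.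
    move=> k0 /(_ _ y1)[x yx]; exists x => /=.
    by rewrite y0/= ltr_pdivlMl// mulrC.
  apply: brunn_minkowski_line => //; [exact: mset|exact: mset|exact: ne|exact: ne|exact: mset|].
  move=> x z /= /andP[_ yx] /andP[_ yz]; rewrite y0/=.
  rewrite ltr_pdivlMl// in yx; rewrite ltr_pdivlMl// in yz; rewrite ltr_pdivlMl//.
  apply: lt_le_trans (fgh x z).
  have -> : (c * y = (a * y) `^ t * (b * y) `^ (1 - t))%R.
    rewrite (powRM _ (ltW a0) (ltW y0)) (powRM _ (ltW b0) (ltW y0)) mulrACA -powRD.
      by rewrite subrKC powRr1// ltW.
    by rewrite subrKC oner_eq0.
  by apply: ltr_pM; rewrite ?powR_ge0//; apply: gt0_ltr_powR => //;
    rewrite nnegrE ?f0 ?g0 ?(mulr_ge0 (ltW a0) (ltW y0)) ?(mulr_ge0 (ltW b0) (ltW y0)).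
have mF : measurable_fun setT F by apply: measurable_fun_superlevel; exact: mscaled.
have mG : measurable_fun setT G by apply: measurable_fun_superlevel; exact: mscaled.
have mH : measurable_fun setT H by apply: measurable_fun_superlevel; exact: mscaled.
have F0 y : 0 <= F y by exact: measure_ge0.
have G0 y : 0 <= G y by exact: measure_ge0.
have I0 : 0 <= \int[mu]_y F y by exact: integral_ge0.
have J0 : 0 <= \int[mu]_y G y by exact: integral_ge0.
rewrite !poweRM ?lee_fin ?(ltW a0) ?(ltW b0)// !poweR_EFin muleACA -EFinM -/c.
rewrite lee_pmul2l//.
apply: le_trans (young_ereal t01 I0 J0) _.
rewrite -!ge0_integralZl_EFin ?(ltW t0) ?(ltW t1')// -ge0_integralD//=; last 4 first.
- by move=> x _; rewrite mule_ge0// lee_fin ltW.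
- exact: measurable_funeM.
- by move=> x _; rewrite mule_ge0// lee_fin ltW.
- exact: measurable_funeM.
apply: ge0_le_integral => //.
- by move=> x _; rewrite adde_ge0// mule_ge0// lee_fin ltW.
- by apply: emeasurable_funD; exact: measurable_funeM.
Qed.

(** Truncating all three functions at the same [N] preserves the hypothesis because
    [N^t N^(1-t) = N]; monotone convergence removes the truncation. *)
Lemma prekopa_leindler_line (t : R) (f g h : R -> \bar R) : (0 < t < 1)%R ->
  measurable_fun setT f -> measurable_fun setT g -> measurable_fun setT h ->
  (forall x, 0 <= f x) -> (forall x, 0 <= g x) -> (forall x, 0 <= h x) ->
  (forall x y, f x `^ t * g y `^ (1 - t) <= h (t * x + (1 - t) * y)%R) ->
  (\int[mu]_x f x) `^ t * (\int[mu]_x g x) `^ (1 - t) <= \int[mu]_x h x.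
Proof.
move=> t01 mf mg mh f0 g0 h0 fgh; have /andP[t0 t1] := t01.
have t1' : (0 < 1 - t)%R by rewrite subr_gt0.
pose trunc (u : R -> \bar R) (N : nat) := fun x => mine (u x) N%:R%:E.
have trunc_fin u N x : 0 <= u x -> (fine (trunc u N x))%:E = trunc u N x.
  move=> u0; rewrite fineK// /trunc ge0_fin_numE; last by rewrite le_min u0 /= lee_fin ler0n.
  by rewrite gt_min ltry orbT.
have mtrunc u N : measurable_fun setT u -> measurable_fun setT (trunc u N).
  by move=> mu'; apply: measurable_mine.
have trunc0 u N x : 0 <= u x -> 0 <= trunc u N x by move=> u0; rewrite le_min u0 /= lee_fin ler0n.
have cvg_trunc u : measurable_fun setT u -> (forall x, 0 <= u x) ->
    \int[mu]_x trunc u N x @[N --> \oo] --> \int[mu]_x u x.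
  move=> mu' u0; rewrite [X in _ --> X](_ : _ = \int[mu]_x (limn (trunc u ^~ x))).
    apply: cvg_monotone_convergence => //.
    - by move=> N; exact: mtrunc.
    - by move=> N x _; exact: trunc0.
    - by move=> x _ m n mn; exact: le_mine_nat.
  apply: eq_integral => x _; apply/esym/cvg_lim => //.
  have := u0 x; case ux : (u x) => [r||]// _.
    apply: cvg_near_cst; near=> N; rewrite /trunc ux; apply/min_idPl.
    by rewrite lee_fin; near: N; exact: nbhs_infty_ger.
  apply/cvgeyPge => A; near=> N; rewrite /trunc ux min_r ?leey// lee_fin.
  by near: N; exact: nbhs_infty_ger.
have H0 : 0 <= \int[mu]_x h x by exact: integral_ge0.
apply: poweR_le_of_lt => //; [exact: integral_ge0|exact: integral_ge0|].
have ex_trunc u (a : R) : measurable_fun setT u -> (forall x, 0 <= u x) ->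
    a%:E < \int[mu]_x u x -> exists N0, forall N, (N0 <= N)%N -> a%:E <= \int[mu]_x trunc u N x.
  move=> mu' u0 au; have [N0 aN0] : exists N0, a%:E < \int[mu]_x trunc u N0 x.
    apply: contrapT => /forallNP H; have : \int[mu]_x u x <= a%:E.
      apply: (cvge_le _ (cvg_trunc u mu' u0)); near=> N.
      by rewrite leNgt; apply/negP; exact: H.
    by rewrite leNgt au.
  exists N0 => N N0N; apply: (le_trans (ltW aN0)); apply: ge0_le_integral => //.
  - by move=> x _; exact: trunc0.
  - exact: mtrunc.
  - exact: mtrunc.
  - by move=> x _; exact: le_mine_nat.
move=> a b a0 b0 /(ex_trunc f a mf f0)[N1 aN] /(ex_trunc g b mg g0)[N2 bN].
pose N := maxn N1 N2.
have := @prekopa_leindler_bounded t (fine \o trunc f N) (fine \o trunc g N) (fine \o trunc h N) N%:R t01.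
have mfine u : measurable_fun setT u -> measurable_fun setT (fine \o trunc u N).
  by move=> mu'; apply: measurableT_comp => //; exact: mtrunc.
have bnd u x : 0 <= u x -> (0 <= fine (trunc u N x) <= N%:R)%R.
  move=> u0; rewrite fine_ge0 ?trunc0//= -lee_fin trunc_fin// ge_min lexx orbT//.
move=> /(_ (mfine f mf) (mfine g mg) (mfine h mh) (fun x => bnd f x (f0 x)) (fun x => bnd g x (g0 x))).
have h0' x : (0 <= fine (trunc h N x))%R by case/andP: (bnd h x (h0 x)).
move=> /(_ h0') PL.
have le_poweR (r : R) (A B : \bar R) : (0 <= r)%R -> 0 <= A -> A <= B -> A `^ r <= B `^ r.
  move=> r0 A0 AB; apply: gt0_ler_poweR => //; rewrite in_itv/= leey andbT//.
  exact: le_trans AB.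
apply: (@le_trans _ _ ((\int[mu]_x trunc f N x) `^ t * (\int[mu]_x trunc g N x) `^ (1 - t))).
  rewrite EFinM -!poweR_EFin; apply: lee_pmul; rewrite ?poweR_ge0//.
    by apply: le_poweR; rewrite ?lee_fin ?(ltW t0) ?(ltW a0)// aN// leq_maxl.
  by apply: le_poweR; rewrite ?lee_fin ?(ltW t1') ?(ltW b0)// bN// leq_maxr.
apply: (@le_trans _ _ (\int[mu]_x trunc h N x)); last first.
  apply: ge0_le_integral => //; [by move=> x _; exact: trunc0|exact: mtrunc|].
  by move=> x _; rewrite /trunc ge_min lexx.
have fineE u : (forall x, 0 <= u x) -> \int[mu]_x trunc u N x = \int[mu]_x ((fine \o trunc u N) x)%:E.
  by move=> u0; apply: eq_integral => x _; rewrite /= trunc_fin.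
rewrite !fineE//; apply: PL => x y /=.
rewrite -lee_fin EFinM -!poweR_EFin !trunc_fin// /trunc le_min; apply/andP; split.
  apply: le_trans (fgh x y); apply: lee_pmul; rewrite ?poweR_ge0//;
    by apply: le_poweR; rewrite ?(ltW t0) ?(ltW t1') ?trunc0//  ge_min lexx.
apply: (@le_trans _ _ ((N%:R%:E : \bar R) `^ t * (N%:R%:E) `^ (1 - t))).
  apply: lee_pmul; rewrite ?poweR_ge0//;
    by apply: le_poweR; rewrite ?(ltW t0) ?(ltW t1') ?trunc0//  ge_min lexx orbT.
rewrite !poweR_EFin -EFinM -powRD ?subrKC ?powRr1 ?oner_eq0//.
Unshelve. all: by end_near. Qed.

End prekopa_leindler_line.

Section prekopa_leindler.
Context (R : realType).
Local Notation leb n := (lebesgue_measure_rV R n).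
Local Open Scope ereal_scope.

(** Induction on the dimension: for fixed first coordinates the statement in dimension [n] says that
    the marginals satisfy the hypothesis on the line. Extended values are needed because a marginal
    may be infinite. *)
Lemma prekopa_leindler (n : nat) (t : R) (f g h : 'rV[R]_n -> \bar R) :
  (0 < t < 1)%R ->
  measurable_fun setT f -> measurable_fun setT g -> measurable_fun setT h ->
  (forall x, 0 <= f x) -> (forall x, 0 <= g x) -> (forall x, 0 <= h x) ->
  (forall x y, f x `^ t * g y `^ (1 - t) <= h (t *: x + (1 - t) *: y)%R) ->
  (\int[leb n]_x f x) `^ t * (\int[leb n]_x g x) `^ (1 - t) <= \int[leb n]_x h x.
Proof.
move=> t01; elim: n f g h => [|n IH] f g h mf mg mh f0 g0 h0 fgh.
  rewrite !integral_rV0//; apply: le_trans (fgh _ _) _.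
  by rewrite le_eqVlt; apply/orP; left; apply/eqP; congr h; apply/rowP => -[].
rewrite !integral_cons_rV//.
apply: prekopa_leindler_line => //; try exact: measurable_integral_cons_rV;
  try by move=> s; exact: integral_ge0.
move=> s r; apply: IH => //; try exact: measurable_cons_rVl.
by move=> x y; rewrite -cons_rVD -!cons_rVZ.
Qed.

End prekopa_leindler.

(** * Autocorrelation of a log-concave density *)

Section symmetrization.
Context (R : realType) (n : nat) (f : 'rV[R]_n -> R).
Hypothesis df : probability_density f.
Hypothesis lf : log_concave f.
Local Notation leb := (lebesgue_measure_rV R n).
Local Open Scope ereal_scope.

Let mf : measurable_fun setT f. Proof. by case: df. Qed.
Let f0 x : (0 <= f x)%R. Proof. by case: df => _ f0 _. Qed.
Let intf : \int[leb]_x (f x)%:E = 1. Proof. by case: df. Qed.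

Lemma log_concave_midpoint (h : 'rV[R]_n -> R) (x y : 'rV[R]_n) : log_concave h ->
  (forall x, 0 <= h x)%R ->
  (h x * h y <= h (2^-1 *: (x + y)) ^+ 2)%R.
Proof.
move=> lh h0; have := lh x y 2^-1%R.
have -> : (1 - 2^-1 = 2^-1 :> R)%R by field.
have h01 : (0 <= (2^-1 : R) <= 1)%R by apply/andP; split; lra.
rewrite -scalerDr => /(_ h01); rewrite -(@ler_pXn2r _ 2) ?nnegrE ?mulr_ge0 ?powR_ge0//.
apply: le_trans.
rewrite exprMn -!powR_mulrn ?powR_ge0// -!powRrM mulVf ?pnatr_eq0// !powRr1//.
Qed.

Lemma integral_shift_scale (a : R) (b : 'rV[R]_n) (h : 'rV[R]_n -> R) : (0 < a)%R ->
  measurable_fun setT h -> (forall x, 0 <= h x)%R ->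
  \int[leb]_x (h (a *: (x + b)))%:E = (a ^- n)%:E * \int[leb]_x (h x)%:E.
Proof.
move=> a0 mh h0.
have mh' : measurable_fun setT (fun x => (h x)%:E) by exact/measurable_EFinP.
rewrite -(integral_rV_scale a0 mh'); last by move=> x; rewrite lee_fin.
rewrite muleA -EFinM mulVf ?mul1e; last by rewrite expf_neq0// gt_eqF.
rewrite (integral_rV_shift b (f := fun x => (h (a *: x))%:E)) ?mul1e//.
  apply/measurable_EFinP; apply: (measurableT_comp mh).
  have := measurable_rV_mul (a%:M : 'M[R]_n).
  by congr (measurable_fun _ _); apply/funext => x; rewrite mul_mx_scalar.
by move=> x; rewrite lee_fin.
Qed.

(** Integrating [sqrt (f x) * sqrt (f y) <= f ((x + y) / 2)] in [y] bounds [sqrt (f x)] times the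
    integral of [sqrt f] by [2^n], and that integral is positive. Boundedness makes [f] square
    integrable, hence the autocorrelation finite. *)
Lemma log_concave_bounded : exists B : R, forall x, (f x <= B)%R.
Proof.
pose s x := Num.sqrt (f x).
have ms : measurable_fun setT s.
  rewrite (_ : s = fun x => (f x `^ 2^-1)%R).
    exact: (measurableT_comp (@measurable_powR R 2^-1%R) mf).
  by apply/funext => x; rewrite powR12_sqrt.
have S0 : 0 < \int[leb]_x (s x)%:E.
  rewrite lt_neqAle integral_ge0 ?andbT; last by move=> x _; rewrite lee_fin sqrtr_ge0.
  apply/negP => /eqP/esym S0.
  have /ae_eq_integral_abs : \int[leb]_x `|(s x)%:E| = 0.
    by rewrite -S0; apply: eq_integral => x _; rewrite gee0_abs// lee_fin sqrtr_ge0.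
  move=> /(_ measurableT); rewrite ?EFin_measurable_fun.
  move=> /(_ ltac:(exact/measurable_EFinP)) ae0.
  have : \int[leb]_x (f x)%:E = \int[leb]_x (cst 0 x).
    apply: ae_eq_integral => //; first exact/measurable_EFinP.
    apply: filterS ae0 => x /= /(_ Logic.I) [] /eqP; rewrite sqrtr_eq0 => fx _.
    by congr EFin; apply/eqP; rewrite eq_le fx f0.
  by rewrite intf integral0 => /eqP; rewrite onee_eq0.
(* The integral of [sqrt f] might be infinite; any finite positive lower bound serves. *)
have [c c0 cS] : exists2 c : R, (0 < c)%R & c%:E <= \int[leb]_x (s x)%:E.
  move: S0; case: (\int[leb]_x _) => [r||]//; last by exists 1%R => //; rewrite leey.
  by rewrite lte_fin => r0; exists r.
exists ((2 ^+ n / c) ^+ 2)%R => x.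
have : (s x)%:E * \int[leb]_y (s y)%:E <= (2 ^+ n)%:E.
  rewrite -ge0_integralZl_EFin ?sqrtr_ge0//; last 2 first.
  - by move=> y _; rewrite lee_fin sqrtr_ge0.
  - exact/measurable_EFinP.
  have -> : (2 ^+ n)%:E = \int[leb]_y (f (2^-1 *: (y + x)))%:E.
    by rewrite integral_shift_scale// intf mule1 -exprVn invrK.
  apply: ge0_le_integral => //.
  - by move=> y _; rewrite lee_fin mulr_ge0// sqrtr_ge0.
  - by apply/measurable_EFinP; exact: measurable_funM.
  - apply/measurable_EFinP; apply: (measurableT_comp mf).
    have := @measurable_rV_affine R n n (2^-1)%:M (2^-1 *: x).
    by congr (measurable_fun _ _); apply/funext => y; rewrite mul_mx_scalar scalerDr.
  move=> y _; rewrite lee_fin -sqrtrM// -(@ler_pXn2r _ 2) ?nnegrE ?sqrtr_ge0//.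
  by rewrite sqr_sqrtr ?mulr_ge0// addrC log_concave_midpoint.
move=> sS; have {sS} : ((s x) * c <= 2 ^+ n)%R.
  rewrite -lee_fin EFinM; apply: le_trans sS.
  by apply: lee_wpmul2l => //; rewrite lee_fin sqrtr_ge0.
rewrite -ler_pdivlMr// => sx.
rewrite -(sqr_sqrtr (f0 x)) ler_pXn2r ?nnegrE ?sqrtr_ge0// divr_ge0 ?exprn_ge0// ltW//.
Qed.

Let corr (z : 'rV[R]_n) (y : 'rV[R]_n) : R := (f (z + y) * f y)%R.

Let corr0 z y : (0 <= corr z y)%R. Proof. by rewrite mulr_ge0. Qed.

Let measurable_add : measurable_fun setT (fun p : 'rV[R]_n * 'rV[R]_n => p.1 + p.2)%R.
Proof.
apply/measurable_fun_rVP => i; under eq_fun do rewrite mxE.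
apply: measurable_funD; first exact: (measurableT_comp (@measurable_coord R n i) measurable_fst).
exact: (measurableT_comp (@measurable_coord R n i) measurable_snd).
Qed.

Let mcorr2 : measurable_fun setT (fun p : 'rV[R]_n * 'rV[R]_n => corr p.1 p.2).
Proof.
apply: measurable_funM; first exact: (measurableT_comp mf measurable_add).
exact: (measurableT_comp mf measurable_snd).
Qed.

Let mcorr z : measurable_fun setT (corr z).
Proof. exact: (measurableT_comp mcorr2 (measurable_pair1 z)). Qed.

(* The density of the difference of two independent vectors of density [f]. *)
Definition autocorrelation (z : 'rV[R]_n) : R :=
  fine (\int[leb]_y (f (z + y) * f y)%:E).

Local Notation g := autocorrelation.

Lemma integral_sq_lty : \int[leb]_y (f y ^+ 2)%:E < +oo.
Proof.
have [B fB] := log_concave_bounded.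
have B0 : (0 <= B)%R := le_trans (f0 0%R) (fB 0%R).
apply: (@le_lt_trans _ _ (\int[leb]_y (B%:E * (f y)%:E))).
  apply: ge0_le_integral => //.
  - by move=> x _; rewrite lee_fin exprn_ge0.
  - by apply/measurable_EFinP; exact: measurable_funX.
  - by apply: measurable_funeM; exact/measurable_EFinP.
  - by move=> x _; rewrite -EFinM lee_fin expr2 ler_wpM2r.
rewrite ge0_integralZl_EFin//.
- by rewrite intf mule1 ltry.
- by move=> x _; rewrite lee_fin.
- exact/measurable_EFinP.
Qed.

Let shift_sq z : \int[leb]_y (f (z + y) ^+ 2)%:E = \int[leb]_y (f y ^+ 2)%:E.
Proof.
under eq_integral => y _ do rewrite addrC.
apply: (integral_rV_shift z (f := fun y => (f y ^+ 2)%:E)).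
  by apply/measurable_EFinP; exact: measurable_funX.
by move=> x; rewrite lee_fin exprn_ge0.
Qed.

Let corr_le z : \int[leb]_y (corr z y)%:E <= \int[leb]_y (f y ^+ 2)%:E.
Proof.
have mfz : measurable_fun setT (fun y => f (z + y)).
  have := measurableT_comp mf (@measurable_rV_shift R n z).
  by congr (measurable_fun _ _); apply/funext => y /=; rewrite addrC.
apply: (@le_trans _ _ (\int[leb]_y (2^-1%:E * ((f (z + y) ^+ 2)%:E + (f y ^+ 2)%:E)))).
  apply: ge0_le_integral => //.
  - by move=> x _; rewrite lee_fin corr0.
  - by apply/measurable_EFinP; exact: mcorr.
  - apply: measurable_funeM; apply: emeasurable_funD; apply/measurable_EFinP; exact: measurable_funX.
  - by move=> x _; rewrite -EFinD -EFinM lee_fin /corr; have := sqr_ge0 (f (z + x) - f x)%R; nra.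
rewrite ge0_integralZl_EFin//; last 2 first.
- by move=> y _; rewrite adde_ge0// lee_fin sqr_ge0.
- by apply: emeasurable_funD; apply/measurable_EFinP; exact: measurable_funX.
rewrite ge0_integralD//; last 4 first.
- by move=> y _; rewrite lee_fin sqr_ge0.
- by apply/measurable_EFinP; exact: measurable_funX.
- by move=> y _; rewrite lee_fin sqr_ge0.
- by apply/measurable_EFinP; exact: measurable_funX.
rewrite shift_sq; move: integral_sq_lty.
have : 0 <= \int[leb]_y (f y ^+ 2)%:E by apply: integral_ge0 => y _; rewrite lee_fin sqr_ge0.
case: (\int[leb]_y (f y ^+ 2)%:E) => [r||]// r0 _.
by rewrite -EFinD -EFinM lee_fin; lra.
Qed.

Lemma autocorrelationE z : (g z)%:E = \int[leb]_y (f (z + y) * f y)%:E.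
Proof.
rewrite fineK// ge0_fin_numE; last by apply: integral_ge0 => y _; rewrite lee_fin corr0.
exact: le_lt_trans (corr_le z) integral_sq_lty.
Qed.

Lemma autocorrelation_ge0 z : (0 <= g z)%R.
Proof. by apply: fine_ge0; apply: integral_ge0 => y _; rewrite lee_fin corr0. Qed.

Lemma autocorrelation0 : (g 0)%:E = \int[leb]_y (f y ^+ 2)%:E.
Proof. by rewrite autocorrelationE; apply: eq_integral => y _; rewrite add0r. Qed.

(** Since [y] is the midpoint of [x] and [2 y - x], log-concavity gives
    [f x * f (2 y - x) <= f y ^ 2]. Integrating in [y] yields [2^-n * f x] on the left and [g 0] on
    the right. *)
Lemma density_le_autocorrelation x : (f x <= 2 ^+ n * g 0)%R.
Proof.
rewrite -ler_pdivrMl ?exprn_gt0// -lee_fin autocorrelation0.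
have -> : ((2 ^+ n)^-1 * f x)%:E = \int[leb]_y ((f x)%:E * (f (2 *: (y + (- (2^-1) *: x))))%:E).
  rewrite ge0_integralZl_EFin//.
  - by rewrite integral_shift_scale// intf mule1 -EFinM mulrC.
  - by move=> y _; rewrite lee_fin.
  - apply/measurable_EFinP; apply: (measurableT_comp mf).
    have := @measurable_rV_affine R n n 2%:M (2 *: (- 2^-1 *: x)).
    by congr (measurable_fun _ _); apply/funext => y; rewrite mul_mx_scalar scalerDr.
apply: ge0_le_integral => //.
- by move=> y _; rewrite mule_ge0// lee_fin.
- apply: measurable_funeM.
  apply/measurable_EFinP; apply: (measurableT_comp mf).
  have := @measurable_rV_affine R n n 2%:M (2 *: (- 2^-1 *: x)).
  by congr (measurable_fun _ _); apply/funext => y; rewrite mul_mx_scalar scalerDr.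
- by apply/measurable_EFinP; exact: measurable_funX.
move=> y _; rewrite -EFinM lee_fin.
apply: le_trans (log_concave_midpoint _ _ lf f0) _.
rewrite le_eqVlt; apply/orP; left; apply/eqP; congr (f _ ^+ 2)%R.
rewrite scalerDr !scalerDr !scalerA; apply/rowP => i; rewrite !mxE; by field.
Qed.

Lemma autocorrelationN z : g (- z) = g z.
Proof.
apply: EFin_inj; rewrite !autocorrelationE.
rewrite -[LHS](integral_rV_shift z (f := fun y => (f (- z + y) * f y)%:E)).
- apply: eq_integral => y _; congr EFin; rewrite mulrC (addrC y); congr (f _ * f _)%R.
  by rewrite addKr.
- by apply/measurable_EFinP; exact: mcorr.
- by move=> y; rewrite lee_fin corr0.
Qed.

(** The integrand [f (z + y) * f y] is log-concave jointly in [z] and [y], and Prekopa-Leindler in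
    [y] passes this on to the integral. The endpoints [t = 0] and [t = 1] are separate because that
    inequality is stated for [0 < t < 1]. *)
Lemma log_concave_autocorrelation : log_concave g.
Proof.
move=> x y t /andP[t0 t1].
have [->|tn0] := eqVneq t 0%R.
  by rewrite powRr0 mul1r subr0 powRr1 ?autocorrelation_ge0// scale0r add0r scale1r.
have [->|tn1] := eqVneq t 1%R.
  by rewrite subrr powRr0 mulr1 powRr1 ?autocorrelation_ge0// scale0r addr0 scale1r.
have t01 : (0 < t < 1)%R by rewrite !lt_neqAle eq_sym tn0 t0 tn1 t1.
rewrite -lee_fin EFinM -!poweR_EFin !autocorrelationE.
apply: prekopa_leindler => //;
  try (by apply/measurable_EFinP; exact: mcorr);
  try (by move=> u; rewrite lee_fin corr0).
move=> u v; rewrite !poweR_EFin -EFinM lee_fin !powRM//.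
rewrite mulrACA; apply: ler_pM; rewrite ?mulr_ge0 ?powR_ge0//.
  apply: le_trans (lf _ _ _) _; first by rewrite t0.
  by rewrite !scalerDr addrACA.
by apply: lf; rewrite t0.
Qed.

Lemma measurable_autocorrelation : measurable_fun setT g.
Proof.
have := @measurable_fun_fubini_tonelli_F _ _ _ _ R leb
  (fun p : 'rV[R]_n * 'rV[R]_n => (corr p.1 p.2)%:E).
move=> /(_ _ (fun p => _)) H; apply: measurableT_comp; first exact: fine_measurable.
apply: H => [|p]; last by rewrite lee_fin corr0.
exact/measurable_EFinP.
Qed.

(** Tonelli's theorem followed by the substitution [x = z + y]; it transfers the total mass and the
    second moments from [f] to [g]. *)
Lemma integral_autocorrelation (w : 'rV[R]_n -> R) : measurable_fun setT w ->
  (forall z, 0 <= w z)%R ->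
  \int[leb]_z (w z * g z)%:E =
  \int[leb]_y ((f y)%:E * \int[leb]_x (w (x - y) * f x)%:E).
Proof.
move=> mw w0.
transitivity (\int[leb]_z \int[leb]_y (w z * corr z y)%:E).
  apply: eq_integral => z _; rewrite EFinM autocorrelationE -ge0_integralZl_EFin//.
  - by move=> y _; rewrite lee_fin corr0.
  - by apply/measurable_EFinP; exact: mcorr.
have mF : measurable_fun setT (fun p : 'rV[R]_n * 'rV[R]_n => (w p.1 * corr p.1 p.2)%:E).
  apply/measurable_EFinP; apply: measurable_funM => //.
  exact: (measurableT_comp mw measurable_fst).
rewrite (fubini_tonelli (fun p : 'rV[R]_n * 'rV[R]_n => (w p.1 * corr p.1 p.2)%:E))//=; last first.
  by move=> p; rewrite lee_fin mulr_ge0.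
apply: eq_integral => y _.
have mwy : measurable_fun setT (fun x : 'rV[R]_n => (w (x - y) * f x)%R).
  by apply: measurable_funM => //; apply: (measurableT_comp mw); exact: measurable_rV_shift.
rewrite -ge0_integralZl_EFin//; last 2 first.
- by move=> x _; rewrite lee_fin mulr_ge0.
- exact/measurable_EFinP.
rewrite -[RHS](integral_rV_shift y); last 2 first.
- by apply: measurable_funeM; exact/measurable_EFinP.
- by move=> x; apply: mule_ge0; rewrite lee_fin ?mulr_ge0.
by apply: eq_integral => x _; rewrite addrK -EFinM /corr; congr EFin; ring.
Qed.

Section second_moment.
Variables (m : 'rV[R]_n) (S : 'M[R]_n).
Hypothesis int1 : forall i, leb.-integrable setT (fun x => ((x ord0 i - m ord0 i) * f x)%:E).
Hypothesis mean0 : forall i, \int[leb]_x ((x ord0 i - m ord0 i) * f x)%:E = 0.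
Hypothesis int2 : forall i j, leb.-integrable setT
  (fun x => ((x ord0 i - m ord0 i) * (x ord0 j - m ord0 j) * f x)%:E).
Hypothesis covS : forall i j,
  \int[leb]_x ((x ord0 i - m ord0 i) * (x ord0 j - m ord0 j) * f x)%:E = (S i j)%:E.

Variable u : 'cV[R]_n.
Let a (x : 'rV[R]_n) : R := ((x - m) *m u) ord0 ord0.
Let v : R := (u^T *m S *m u) ord0 ord0.

Let afE x : (a x * f x)%:E = \sum_(i < n) (u i ord0)%:E * ((x ord0 i - m ord0 i) * f x)%:E.
Proof.
rewrite /a mxE mulr_suml -sumEFin; apply: eq_bigr => i _.
by rewrite !mxE -EFinM; congr EFin; ring.
Qed.

Let a2fE x : (a x ^+ 2 * f x)%:E = \sum_(i < n) \sum_(j < n)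
  (u i ord0 * u j ord0)%:E * ((x ord0 i - m ord0 i) * (x ord0 j - m ord0 j) * f x)%:E.
Proof.
rewrite /a mxE expr2 mulr_suml mulr_suml -sumEFin; apply: eq_bigr => i _.
rewrite mulr_sumr mulr_suml -sumEFin; apply: eq_bigr => j _.
by rewrite !mxE -EFinM; congr EFin; ring.
Qed.

Lemma integrable_linear_density : leb.-integrable setT (fun x => (a x * f x)%:E).
Proof.
under eq_fun do rewrite afE.
by apply: integrable_sum => // i _; exact: integrableZl.
Qed.

Lemma integral_linear_density : \int[leb]_x (a x * f x)%:E = 0.
Proof.
under eq_integral do rewrite afE.
rewrite integral_sum//; last by move=> i; exact: integrableZl.
by apply: big1 => i _; rewrite integralZl// mean0 mule0.
Qed.

Lemma integrable_square_density : leb.-integrable setT (fun x => (a x ^+ 2 * f x)%:E).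
Proof.
under eq_fun do rewrite a2fE.
apply: integrable_sum => // i _; apply: integrable_sum => // j _; exact: integrableZl.
Qed.

Lemma integral_square_density : \int[leb]_x (a x ^+ 2 * f x)%:E = v%:E.
Proof.
under eq_integral do rewrite a2fE.
rewrite integral_sum//; last first.
  by move=> i; apply: integrable_sum => // j _; exact: integrableZl.
transitivity (\sum_(i < n) \sum_(j < n) (u i ord0 * u j ord0 * S i j)%:E).
  apply: eq_bigr => i _; rewrite integral_sum//; last by move=> j; exact: integrableZl.
  by apply: eq_bigr => j _; rewrite integralZl// covS -EFinM.
under eq_bigr do rewrite sumEFin.
rewrite sumEFin; congr EFin; rewrite /v mxE exchange_big; apply: eq_bigr => j _.
rewrite mxE mulr_suml; apply: eq_bigr => i _; rewrite mxE; ring.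
Qed.

(** The form at [x - y] is [(a x - a y) ^ 2]; its cross term vanishes because [a] has mean zero
    under [f], and each of the two squares contributes [v]. *)
Lemma second_moment_autocorrelation :
  \int[leb]_z (((z *m u) ord0 ord0) ^+ 2 * g z)%:E = (2 * v)%:E.
Proof.
have mu2 : measurable_fun setT (fun z : 'rV[R]_n => (z *m u) ord0 ord0).
  exact: (measurableT_comp (@measurable_coord R 1 ord0) (measurable_rV_mul u)).
rewrite integral_autocorrelation; [|exact: measurable_funX|by move=> z; exact: sqr_ge0].
have intff : leb.-integrable setT (fun x => (f x)%:E).
  apply/integrableP; split; first exact/measurable_EFinP.
  under eq_integral => x _ do rewrite gee0_abs ?lee_fin//.
  by rewrite intf ltry.
have inner y : \int[leb]_x (((x - y) *m u) ord0 ord0 ^+ 2 * f x)%:E = (v + a y ^+ 2)%:E.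
  transitivity (\int[leb]_x ((a x ^+ 2 * f x)%:E +
     ((- 2 * a y)%:E * (a x * f x)%:E + (a y ^+ 2)%:E * (f x)%:E))).
    apply: eq_integral => x _; rewrite -!EFinM -!EFinD; congr EFin.
    have -> : ((x - y) *m u) ord0 ord0 = (a x - a y)%R.
      rewrite /a; have -> : (x - y = (x - m) - (y - m))%R by rewrite opprB addrA subrK.
      by rewrite mulmxBl !mxE.
    by ring.
  rewrite integralD//; last 2 first.
  - exact: integrable_square_density.
  - by apply: integrableD => //; apply: integrableZl => //; exact: integrable_linear_density.
  rewrite integral_square_density integralD//; last 2 first.
  - by apply: integrableZl => //; exact: integrable_linear_density.
  - exact: integrableZl.
  rewrite integralZl//; last exact: integrable_linear_density.
  rewrite integral_linear_density mule0 add0e integralZl// intf mule1.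
  by rewrite -EFinD.
under eq_integral => y _ do rewrite inner.
transitivity (\int[leb]_y (v%:E * (f y)%:E + (a y ^+ 2 * f y)%:E)).
  by apply: eq_integral => y _; rewrite -!EFinM -EFinD; congr EFin; ring.
rewrite integralD//; [|exact: integrableZl|exact: integrable_square_density].
rewrite integralZl// intf mule1 integral_square_density -EFinD; congr EFin; ring.
Qed.

End second_moment.

End symmetrization.

(** * Even log-concave functions on the line *)

Section half_line.
Context (R : realType).
Local Notation mu := (@lebesgue_measure R).
Local Open Scope ereal_scope.

(** Half-line integrals are written over the whole line with this weight, so that translations and
    Tonelli's theorem apply without tracking domains. *)
Definition pos (s : R) : \bar R := ((0 < s)%R%:R)%:E.

Lemma pos_ge0 s : 0 <= pos s. Proof. by rewrite lee_fin ler0n. Qed.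

Lemma posE s : pos s = (\1_(`]0%R, +oo[%classic : set (measurableTypeR R)) s)%:E.
Proof. by rewrite /pos indicE mem_setE in_itv/= andbT. Qed.

Lemma measurable_pos : measurable_fun setT (pos : measurableTypeR R -> _).
Proof.
rewrite (_ : pos = fun s : measurableTypeR R => (\1_(`]0%R, +oo[%classic : set (measurableTypeR R)) s)%:E).
  by apply/measurable_EFinP; exact: measurable_indic.
by apply/funext => s; rewrite posE.
Qed.

Lemma measurable_posB (r : R) : measurable_fun setT (fun s : measurableTypeR R => pos (s - r)).
Proof. by apply: (measurableT_comp measurable_pos); exact: measurable_funB. Qed.

Lemma measurable_posN : measurable_fun setT (fun s : measurableTypeR R => pos (- s)).
Proof. by apply: (measurableT_comp measurable_pos); exact: measurable_funN. Qed.

Lemma integral_pos_fold (H : R -> \bar R) : measurable_fun setT H -> (forall s, 0 <= H s) ->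
  \int[mu]_s (pos s * (H s + H (- s)%R)) = \int[mu]_s (pos s * H s + pos (- s)%R * H s).
Proof.
move=> mH H0.
have mHN : measurable_fun setT (fun s : measurableTypeR R => H (- s)%R).
  by apply: (measurableT_comp mH); exact: measurable_funN.
under eq_integral => s _ do rewrite ge0_muleDr//.
rewrite !ge0_integralD//;
  try (by move=> s _; apply: mule_ge0 => //; exact: pos_ge0);
  try (by apply: emeasurable_funM => //; first [exact: measurable_pos|exact: measurable_posN]).
congr (_ + _).
rewrite -[RHS]integral_oppr.
- by apply: eq_integral => s _; rewrite opprK.
- by apply: emeasurable_funM => //; exact: measurable_posN.
- by move=> s; apply: mule_ge0 => //; exact: pos_ge0.
Qed.

Lemma le_integral_pos_fold (H : R -> \bar R) : measurable_fun setT H -> (forall s, 0 <= H s) ->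
  \int[mu]_s (pos s * (H s + H (- s)%R)) <= \int[mu]_s H s.
Proof.
move=> mH H0; rewrite integral_pos_fold//; apply: ge0_le_integral => //.
- by move=> s _; apply: adde_ge0; apply: mule_ge0 => //; exact: pos_ge0.
- by apply: emeasurable_funD; apply: emeasurable_funM => //; first [exact: measurable_pos|exact: measurable_posN].
- move=> s _; rewrite /pos oppr_gt0; case: ltgtP => _; rewrite ?mul1e ?mul0e ?add0e ?adde0//.
Qed.

Lemma eq_integral_pos_fold (H : R -> \bar R) : measurable_fun setT H -> (forall s, 0 <= H s) ->
  H 0%R = 0 ->
  \int[mu]_s (pos s * (H s + H (- s)%R)) = \int[mu]_s H s.
Proof.
move=> mH H0 H00; rewrite integral_pos_fold//; apply: eq_integral => s _.
by rewrite /pos oppr_gt0; case: ltgtP => [_|_|<-]; rewrite ?H00 ?mul1e ?mul0e ?add0e ?adde0.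
Qed.

(* [s = r + a], [0 < r], [0 < a] *)
Lemma integral_pos_split (w : R -> \bar R) : measurable_fun setT w -> (forall s, 0 <= w s) ->
  \int[mu]_r (pos r * \int[mu]_a (pos a * w (r + a)%R)) =
  \int[mu]_s ((Num.max s 0)%:E * w s).
Proof.
move=> mw w0.
transitivity (\int[mu]_r \int[mu]_s (pos r * pos (s - r) * w s)).
  apply: eq_integral => r _.
  rewrite -[X in pos r * X](_ : \int[mu]_s (pos (s - r) * w s) = _); last first.
    rewrite -[LHS](integral_shift r).
    - by apply: eq_integral => a _; rewrite addrK addrC.
    - by apply: emeasurable_funM => //; exact: measurable_posB.
    - by move=> s; apply: mule_ge0 => //; exact: pos_ge0.
  rewrite -ge0_integralZl//.
  - by apply: eq_integral => s _; rewrite muleA.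
  - by apply: emeasurable_funM => //; exact: measurable_posB.
  - by move=> s _; apply: mule_ge0 => //; exact: pos_ge0.
  - exact: pos_ge0.
rewrite (fubini_tonelli (fun p : measurableTypeR R * measurableTypeR R => pos p.1 * pos (p.2 - p.1) * w p.2)); last 2 first.
- apply: emeasurable_funM; last exact: (measurableT_comp mw measurable_snd).
  apply: emeasurable_funM; first exact: (measurableT_comp measurable_pos measurable_fst).
  apply: (measurableT_comp measurable_pos).
  by apply: measurable_funB; [exact: measurable_snd|exact: measurable_fst].
- by move=> p; rewrite !mule_ge0 ?pos_ge0.
apply: eq_integral => s _ /=.
have m2 : measurable_fun setT (fun r : measurableTypeR R => pos r * pos (s - r)).
  apply: emeasurable_funM; first exact: measurable_pos.
  by apply: (measurableT_comp measurable_pos); exact: measurable_funB.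
rewrite ge0_integralZr//; last by move=> r _; rewrite mule_ge0 ?pos_ge0.
congr (_ * _).
transitivity (\int[mu]_r (\1_(`]0%R, s[%classic : set (measurableTypeR R)) r)%:E).
  apply: eq_integral => r _; rewrite /pos -EFinM -natrM mulnb indicE mem_setE in_itv/=.
  by rewrite subr_gt0.
rewrite integral_indic// setIT [LHS]lebesgue_measure_itv/= lte_fin sube0.
by case: ltP.
Qed.

(* On the half-line [int s^2 m(s) ds = 2 int int r m(r + a) dr da] and
   [int r m(r) dr = int int m(r + a) dr da]; the hypothesis is applied to each of the two. *)
Lemma even_submultiplicative_second_moment (m : R -> \bar R) : measurable_fun setT m ->
  (forall s, 0 <= m s) -> (forall s, m (- s)%R = m s) ->
  (forall r a : R, (0 < r)%R -> (0 < a)%R -> m 0%R * m (r + a)%R <= m r * m a) ->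
  2%:E * (m 0%R * (m 0%R * \int[mu]_s ((s ^+ 2)%:E * m s))) <=
  \int[mu]_s m s * (\int[mu]_s m s * \int[mu]_s m s).
Proof.
move=> mm m0 mN msub.
pose mp s := pos s * m s.
have mp0 s : 0 <= mp s by apply: mule_ge0 => //; exact: pos_ge0.
have mmp : measurable_fun setT mp by apply: emeasurable_funM => //; exact: measurable_pos.
pose J0 := \int[mu]_s mp s.
pose J1 := \int[mu]_s (s%:E * mp s).
pose J2 := \int[mu]_s ((s ^+ 2)%:E * mp s).
have J0_ge0 : 0 <= J0 by exact: integral_ge0.
have smp s : s%:E * mp s = (Num.max s 0)%:E * mp s.
  by rewrite /mp /pos; case: (ltP 0%R s) => // _; rewrite mul0e !mule0.
have smp0 s : 0 <= s%:E * mp s.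
  by rewrite smp mule_ge0// lee_fin le_max lexx orbT.
have msmp : measurable_fun setT (fun s : measurableTypeR R => (s : R)%:E * mp s).
  by apply: emeasurable_funM => //; exact/measurable_EFinP.
have J1_ge0 : 0 <= J1 by exact: integral_ge0.
have mshift (w : R -> \bar R) (r : R) : measurable_fun setT w ->
    measurable_fun setT (fun a : measurableTypeR R => w (r + a)%R).
  by move=> mw; apply: (measurableT_comp mw); exact: measurable_funD.
have minner (w : R -> \bar R) : measurable_fun setT w -> (forall s, 0 <= w s) ->
    measurable_fun setT (fun r : measurableTypeR R => \int[mu]_a (pos a * w (r + a)%R)).
  move=> mw w0.
  apply: (@measurable_fun_fubini_tonelli_F _ _ _ _ R mu
    (fun p : measurableTypeR R * measurableTypeR R => pos p.2 * w (p.1 + p.2)%R)); last first.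
    by move=> p; rewrite mule_ge0 ?pos_ge0.
  apply: emeasurable_funM; first exact: (measurableT_comp measurable_pos measurable_snd).
  by apply: (measurableT_comp mw); apply: measurable_funD; [exact: measurable_fst|exact: measurable_snd].
have inner0 (w : R -> \bar R) r : (forall s, 0 <= w s) -> 0 <= \int[mu]_a (pos a * w (r + a)%R).
  by move=> w0; apply: integral_ge0 => a _; rewrite mule_ge0 ?pos_ge0.
have step (w : R -> \bar R) (B : R -> R -> \bar R) : measurable_fun setT w -> (forall s, 0 <= w s) ->
    (forall r a, 0 <= B r a) ->
    measurable_fun setT (fun p : measurableTypeR R * measurableTypeR R => B p.1 p.2) ->
    (forall r a, (0 < r)%R -> (0 < a)%R -> m 0%R * w (r + a)%R <= B r a) ->
    m 0%R * \int[mu]_s ((Num.max s 0)%:E * w s) <= \int[mu]_r (pos r * \int[mu]_a (pos a * B r a)).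
  move=> mw w0 B0 mB wB; rewrite -integral_pos_split// -ge0_integralZl//; last 2 first.
  - by apply: emeasurable_funM; [exact: measurable_pos|exact: minner].
  - by move=> r _; apply: mule_ge0; [exact: pos_ge0|exact: inner0].
  have mBr r : measurable_fun setT (fun a : measurableTypeR R => pos a * B r a).
    apply: emeasurable_funM; first exact: measurable_pos.
    exact: (measurableT_comp mB (measurable_pair1 r)).
  apply: ge0_le_integral => //.
  - by move=> r _; rewrite !mule_ge0 ?pos_ge0 ?inner0.
  - by apply: measurable_funeM; apply: emeasurable_funM; [exact: measurable_pos|exact: minner].
  - apply: emeasurable_funM; first exact: measurable_pos.
    apply: (@measurable_fun_fubini_tonelli_F _ _ _ _ R mu
      (fun p : measurableTypeR R * measurableTypeR R => pos p.2 * B p.1 p.2)); last first.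
      by move=> p; rewrite mule_ge0 ?pos_ge0.
    by apply: emeasurable_funM => //; exact: (measurableT_comp measurable_pos measurable_snd).
  move=> r _; rewrite muleCA /pos; case: (ltP 0%R r) => [r0|_]; last by rewrite !mul0e.
  rewrite !mul1e -ge0_integralZl//; last 2 first.
  - by apply: emeasurable_funM; [exact: measurable_pos|exact: mshift].
  - by move=> a _; rewrite mule_ge0 ?pos_ge0.
  apply: ge0_le_integral => //.
  - by move=> a _; rewrite !mule_ge0 ?pos_ge0.
  - by apply: measurable_funeM; apply: emeasurable_funM; [exact: measurable_pos|exact: mshift].
  - move=> a _; rewrite muleCA /pos; case: (ltP 0%R a) => [a0|_]; last by rewrite !mul0e.
    by rewrite !mul1e; exact: wB.
have prodI (u v : R -> \bar R) : measurable_fun setT u -> measurable_fun setT v ->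
    (forall s, 0 <= u s) -> (forall s, 0 <= v s) ->
    \int[mu]_r (pos r * \int[mu]_a (pos a * (u r * v a))) =
    (\int[mu]_r (pos r * u r)) * \int[mu]_a (pos a * v a).
  move=> mu' mv u0 v0.
  transitivity (\int[mu]_r (pos r * u r * \int[mu]_a (pos a * v a))).
    apply: eq_integral => r _; rewrite -muleA; congr (_ * _).
    rewrite -ge0_integralZl//.
    - by apply: eq_integral => a _; rewrite muleCA.
    - by apply: emeasurable_funM => //; exact: measurable_pos.
    - by move=> a _; rewrite mule_ge0 ?pos_ge0.
  rewrite ge0_integralZr//.
  - by apply: emeasurable_funM => //; exact: measurable_pos.
  - by move=> a _; rewrite mule_ge0 ?pos_ge0.
  - by apply: integral_ge0 => a _; rewrite mule_ge0 ?pos_ge0.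
have pospos s : pos s * mp s = mp s.
  by rewrite /mp muleA -EFinM -natrM mulnb andbb.
have mpE s : (0 < s)%R -> mp s = m s by move=> s0; rewrite /mp /pos s0 mul1e.
have mB (u v : R -> \bar R) : measurable_fun setT u -> measurable_fun setT v ->
    measurable_fun setT (fun p : measurableTypeR R * measurableTypeR R => u p.1 * v p.2).
  move=> mu' mv; apply: emeasurable_funM; first exact: (measurableT_comp mu' measurable_fst).
  exact: (measurableT_comp mv measurable_snd).
have mJ1 : m 0%R * J1 <= J0 * J0.
  rewrite /J1; under eq_integral => s _ do rewrite smp.
  have := step mp (fun r a => mp r * mp a) mmp mp0 _ (mB _ _ mmp mmp).
  rewrite prodI//.
  under [X in _ -> _ -> _ <= X * _]eq_integral => s _ do rewrite pospos.
  under [X in _ -> _ -> _ <= _ * X]eq_integral => s _ do rewrite pospos.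
  apply=> [r a|r a r0 a0]; first exact: mule_ge0.
  by rewrite !mpE// ?addr_gt0//; exact: msub.
(* The extra weight [s = r + a] distributes over the two variables and leaves two double integrals,
   each equal to [J1 * J0]. *)
have mJ2 : m 0%R * J2 <= 2%:E * (J1 * J0).
  have E s : (s ^+ 2)%:E * mp s = (Num.max s 0)%:E * (s%:E * mp s).
    have [s0|s0] := ltP 0%R s; first by rewrite [RHS]muleA -EFinM expr2.
    by rewrite /mp /pos ltNge s0 mul0e !mule0.
  rewrite /J2; under eq_integral => s _ do rewrite E.
  have := step (fun s => s%:E * mp s) (fun r a => (r%:E * mp r) * mp a + mp r * (a%:E * mp a)) msmp smp0.
  move=> H; apply: (le_trans (H _ _ _)) => {H}.
  - by move=> r a; rewrite adde_ge0// mule_ge0.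
  - by apply: emeasurable_funD; [exact: (mB (fun s => s%:E * mp s) mp msmp mmp)|exact: (mB mp (fun s => s%:E * mp s) mmp msmp)].
  - move=> r a r0 a0; rewrite !mpE ?addr_gt0// muleCA EFinD.
    rewrite ge0_muleDl ?lee_fin ?(ltW r0) ?(ltW a0)//.
    rewrite -!muleA (muleCA (m r)); apply: leeD; rewrite lee_pmul2l ?lte_fin//; exact: msub.
  have -> : \int[mu]_r (pos r * \int[mu]_a (pos a * (r%:E * mp r * mp a + mp r * (a%:E * mp a)))) =
     \int[mu]_r (pos r * \int[mu]_a (pos a * (r%:E * mp r * mp a))) +
     \int[mu]_r (pos r * \int[mu]_a (pos a * (mp r * (a%:E * mp a)))).
    have mI (u v : R -> \bar R) : measurable_fun setT u -> measurable_fun setT v ->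
       (forall s, 0 <= u s) -> (forall s, 0 <= v s) ->
       measurable_fun setT (fun r : measurableTypeR R => pos r * \int[mu]_a (pos a * (u r * v a))).
      move=> mu' mv u0 v0; apply: emeasurable_funM; first exact: measurable_pos.
      apply: (@measurable_fun_fubini_tonelli_F _ _ _ _ R mu
        (fun p : measurableTypeR R * measurableTypeR R => pos p.2 * (u p.1 * v p.2))); last first.
        by move=> p; rewrite !mule_ge0 ?pos_ge0.
      apply: emeasurable_funM; last exact: mB.
      exact: (measurableT_comp measurable_pos measurable_snd).
    have I0 (u v : R -> \bar R) r : (forall s, 0 <= u s) -> (forall s, 0 <= v s) ->
       0 <= pos r * \int[mu]_a (pos a * (u r * v a)).
      move=> u0 v0; apply: mule_ge0; first exact: pos_ge0.
      by apply: integral_ge0 => a _; rewrite !mule_ge0 ?pos_ge0.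
    rewrite -ge0_integralD//;
      try (by move=> r _; apply: (I0 (fun s => s%:E * mp s)));
      try (by move=> r _; apply: (I0 mp (fun s => s%:E * mp s)));
      try (by apply: (mI (fun s => s%:E * mp s)));
      try (by apply: (mI mp (fun s => s%:E * mp s))).
    apply: eq_integral => r _; rewrite -ge0_muleDr; last 2 first.
    - by apply: integral_ge0 => a _; apply: mule_ge0; [exact: pos_ge0|exact: mule_ge0].
    - by apply: integral_ge0 => a _; apply: mule_ge0; [exact: pos_ge0|exact: mule_ge0].
    congr (_ * _); rewrite -ge0_integralD//.
    - by apply: eq_integral => a _; rewrite ge0_muleDr//; exact: mule_ge0.
    - by move=> a _; apply: mule_ge0; [exact: pos_ge0|exact: mule_ge0].
    - by apply: emeasurable_funM; [exact: measurable_pos|exact: measurable_funeM].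
    - by move=> a _; apply: mule_ge0; [exact: pos_ge0|exact: mule_ge0].
    - by apply: emeasurable_funM; [exact: measurable_pos|exact: measurable_funeM].
  rewrite (prodI (fun s => s%:E * mp s) mp)// (prodI mp (fun s => s%:E * mp s))//.
  have -> : \int[mu]_a (pos a * mp a) = J0 by apply: eq_integral => s _; rewrite pospos.
  have -> : \int[mu]_a (pos a * (a%:E * mp a)) = J1.
    by apply: eq_integral => s _; rewrite muleCA pospos.
  by rewrite (muleC J0) mule_natl mule2n.
have mJ : m 0%R * (m 0%R * J2) <= 2%:E * (J0 * (J0 * J0)).
  apply: (@le_trans _ _ (m 0%R * (2%:E * (J1 * J0)))); first exact: lee_wpmul2l.
  rewrite muleCA lee_pmul2l// muleA [leRHS]muleC; apply: lee_wpmul2r => //.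
have E2 : \int[mu]_s ((s ^+ 2)%:E * m s) = 2%:E * J2.
  have mH : measurable_fun setT (fun s : measurableTypeR R => (s ^+ 2)%:E * m s).
    by apply: emeasurable_funM => //; apply/measurable_EFinP; exact: measurable_funX.
  rewrite -eq_integral_pos_fold//; last 2 first.
  - by move=> s; rewrite mule_ge0// lee_fin sqr_ge0.
  - by rewrite expr0n/= mul0e.
  rewrite -ge0_integralZl//.
  - by apply: eq_integral => s _; rewrite sqrrN mN -mule2n -mule_natl muleCA (muleCA (pos s)).
  - apply: emeasurable_funM => //; apply/measurable_EFinP; exact: measurable_funX.
  - by move=> s _; rewrite mule_ge0// lee_fin sqr_ge0.
have E0 : 2%:E * J0 <= \int[mu]_s m s.
  apply: le_trans (le_integral_pos_fold mm m0).
  rewrite -ge0_integralZl// le_eqVlt; apply/orP; left; apply/eqP; apply: eq_integral => s _.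
  by rewrite mN -mule2n -mule_natl /mp muleCA.
have J20 : 0 <= 2%:E * J0 by rewrite mule_ge0.
(* By evenness the second moment is [2 J2], so 4 times [mJ] reads [2 m(0)^2 (2 J2) <= (2 J0)^3]. *)
apply: (@le_trans _ _ ((2%:E * J0) * ((2%:E * J0) * (2%:E * J0)))); last first.
  by rewrite !lee_pmul// mule_ge0.
rewrite E2.
have -> : 2%:E * (m 0%R * (m 0%R * (2%:E * J2))) = (2 * 2)%:E * (m 0%R * (m 0%R * J2)).
  by rewrite (muleCA (m 0%R) 2%:E J2) (muleCA (m 0%R) 2%:E (m 0%R * J2)) EFinM -[RHS]muleA.
have -> : 2%:E * J0 * (2%:E * J0 * (2%:E * J0)) = (2 * 2)%:E * (2%:E * (J0 * (J0 * J0))).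
  by rewrite EFinM -!muleA !(muleCA J0 2%:E).
by rewrite lee_pmul2l// lte_fin mulr_gt0.
Qed.

End half_line.

(** * Sections through the origin *)

Section cross_polytope.
Context (R : realType).
Local Notation mu := (@lebesgue_measure R).
Local Notation leb n := (lebesgue_measure_rV R n).

Lemma integral_poly (P : {poly R}) (a b : R) : a < b ->
  (\int[mu]_(x in `[a, b]) (P^`().[x])%:E = (P.[b] - P.[a])%:E)%E.
Proof.
move=> ab; rewrite (@continuous_FTC2 _ (horner P^`()) (horner P))//.
- by apply: continuous_subspaceT => x; exact: continuous_horner.
- split=> [x _||].
  + by have [] := is_derive_poly P x.
  + by apply: cvg_at_right_filter; exact: continuous_horner.
  + by apply: cvg_at_left_filter; exact: continuous_horner.
- by move=> x _; rewrite derive1E; have [_ ->] := is_derive_poly P x.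
Qed.

(** The point [tau / (k + 2)] is the mean of [s] for the weight [(tau - s)^k] on [[0, tau]], so the
    term in [kappa] integrates to zero. *)
Lemma integral_simplex_weight (k : nat) (c tau kappa : R) : 0 < tau ->
  (\int[mu]_(s in `[0%R, tau])
     (c * ((tau - s) ^+ k * (1 - kappa * (s - tau / k.+2%:R))))%:E =
   (c * (tau ^+ k.+1 / k.+1%:R))%:E)%E.
Proof.
move=> tau0; pose q : {poly R} := tau%:P - 'X.
(* An antiderivative of the weight, vanishing at [tau]. *)
pose P := q ^+ k.+1 * ((kappa / k.+2%:R) *: 'X - (k.+1%:R^-1)%:P).
have k1 : k.+1%:R != 0 :> R by rewrite pnatr_eq0.
have k2 : k.+2%:R != 0 :> R by rewrite pnatr_eq0.
have dP : P^`() = q ^+ k * (1 - kappa *: ('X - (tau / k.+2%:R)%:P)).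
  rewrite /P derivM deriv_exp /q derivB derivC derivX sub0r derivB derivZ derivX derivC subr0.
  rewrite -/q alg_polyC exprS -!mul_polyC !polyCM -mulr_natr -(polyC_natr _ k.+1) /q.
  set X := 'X; set T := tau%:P; set K := kappa%:P; set w := k.+2%:R^-1%:P.
  set d := k.+1%:R^-1%:P; set e := (k.+1%:R : R)%:P.
  have de : e * d = 1 by rewrite /e /d -polyCM mulfV.
  have ew : e * w = 1 - w.
    by rewrite /e /w -polyCM -polyC1 -polyCB; congr polyC; apply: (mulIf k2); rewrite mulrBl mulfVK// mulVf// mul1r -natr1; ring.
  transitivity ((T - X) ^+ k * ((T - X) * (K * w) - (K * X * (e * w) - e * d))); first by ring.
  by rewrite de ew; ring.
transitivity (\int[mu]_(s in `[0%R, tau]) ((c *: P)^`().[s])%:E)%E.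
  by apply: eq_integral => s _; rewrite derivZ dP /q; congr EFin; rewrite !hornerE.
rewrite integral_poly// /P /q !hornerE; congr EFin.
by rewrite subrr expr0n/= !(mul0r, mulr0, subr0, sub0r, mulrN, opprK).
Qed.

(** Jensen's inequality for the exponential: [(2 tau)^k / k!] is the volume of the cross-polytope
    and [tau / (k + 1)] the mean of each [|t_i|] on it. It is proved by slicing along the first
    coordinate, the slice at [s] being a cross-polytope of radius [tau - |s|]. *)
Lemma cross_polytope_bound (k : nat) (G tau : R) (phi : 'I_k -> R)
    (h : 'rV[R]_k -> \bar R) : 0 <= G -> 0 <= tau ->
  measurable_fun setT h -> (forall t, 0 <= h t)%E ->
  (forall t : 'rV[R]_k, \sum_i `|t ord0 i| <= tau ->
     ((G * expR (- \sum_i `|t ord0 i| * phi i))%:E <= h t)%E) ->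
  ((G * ((2 * tau) ^+ k / k`!%:R) * expR (- (tau * (\sum_i phi i) / k.+1%:R)))%:E
     <= \int[leb k]_t h t)%E.
Proof.
elim: k G tau phi h => [|k IH] G tau phi h G0 tau0 mh h0 Gh.
  rewrite integral_rV0//; apply: le_trans (Gh 0 _); last by rewrite big_ord0.
  by rewrite !big_ord0 mulr0 mul0r fact0 expr0 divr1 mulr1.
have [->|tau_neq0] := eqVneq tau 0.
  by rewrite mulr0 exprS !mul0r mulr0 mul0r integral_ge0.
have {tau0 tau_neq0} tau0 : 0 < tau by rewrite lt_neqAle eq_sym tau_neq0.
pose phi' (i : 'I_k) := phi (lift ord0 i).
pose beta := (\sum_i phi' i) / k.+1%:R.
pose kappa := phi ord0 - beta.
pose s0 := tau / k.+2%:R.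
pose K := G * (2 ^+ k / k`!%:R) * expR (- (tau * beta + kappa * s0)).
have K0 : 0 <= K by rewrite !mulr_ge0 ?expR_ge0 ?invr_ge0 ?ler0n ?exprn_ge0.
pose H s := (\int[leb k]_t h (cons_rV (s, t)))%E.
have mH : measurable_fun setT H by exact: measurable_integral_cons_rV.
have H0 s : (0 <= H s)%E by exact: integral_ge0.
(* The exponential bound on the slice at distance [s] is replaced by its tangent at the mean [s0];
   the linear term then disappears on integration. *)
pose q s : R := K * ((tau - s) ^+ k * (1 - kappa * (s - s0))).
have qH (s r : R) : 0 <= s <= tau -> `|r| = s -> ((q s)%:E <= H r)%E.
  move=> /andP[s_ge0 st] rs.
  have G'0 : 0 <= G * expR (- (s * phi ord0)) by rewrite mulr_ge0 ?expR_ge0.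
  have ts0 : 0 <= tau - s by rewrite subr_ge0.
  apply: le_trans (IH (G * expR (- (s * phi ord0))) (tau - s) phi' (fun t => h (cons_rV (r, t))) G'0 ts0 _ _ _) => //.
  - rewrite lee_fin /q /K.
    have -> : G * (2 ^+ k / k`!%:R) * expR (- (tau * beta + kappa * s0)) *
      ((tau - s) ^+ k * (1 - kappa * (s - s0))) =
      (G * ((2 * (tau - s)) ^+ k / k`!%:R)) * (expR (- (tau * beta + kappa * s0)) *
        (1 - kappa * (s - s0))) by rewrite exprMn; ring.
    have -> : G * expR (- (s * phi ord0)) * ((2 * (tau - s)) ^+ k / k`!%:R) *
      expR (- ((tau - s) * (\sum_i phi' i) / k.+1%:R)) =
      (G * ((2 * (tau - s)) ^+ k / k`!%:R)) * (expR (- (s * phi ord0)) *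
        expR (- ((tau - s) * beta))) by rewrite -(mulrA (tau - s)) -/beta; ring.
    apply: ler_wpM2l.
      by rewrite mulr_ge0// divr_ge0// ?ler0n// exprn_ge0// mulr_ge0.
    rewrite -expRD.
    have -> : - (s * phi ord0) - (tau - s) * beta =
      - (tau * beta + kappa * s0) + - (kappa * (s - s0)) by rewrite /kappa; ring.
    rewrite expRD ler_wpM2l ?expR_ge0//; exact: expR_ge1Dx.
  - exact: measurable_cons_rVl.
  - move=> t tt; have := Gh (cons_rV (r, t)).
    rewrite !big_ord_recl !cons_rV0/=.
    under eq_bigr do rewrite cons_rVS/=.
    under [X in expR (- (_ + X))]eq_bigr do rewrite cons_rVS/=.
    rewrite rs -lerBrDl => /(_ tt); apply: le_trans.
    by rewrite opprD expRD mulrA lee_fin.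
have -> : G * ((2 * tau) ^+ k.+1 / k.+1`!%:R) * expR (- (tau * (\sum_i phi i) / k.+2%:R)) =
    2 * (K * (tau ^+ k.+1 / k.+1%:R)).
  rewrite /K big_ord_recl -/phi'.
  have -> : tau * (phi ord0 + \sum_i phi' i) / k.+2%:R = tau * beta + kappa * s0.
    have -> : \sum_i phi' i = beta * k.+1%:R by rewrite /beta mulfVK// pnatr_eq0.
    have -> : k.+1%:R = k.+2%:R - 1 :> R by rewrite -[in RHS]natr1 addrK.
    have : k.+2%:R != 0 :> R by rewrite pnatr_eq0.
    by rewrite /kappa /s0; move: (k.+2%:R : R) => N N0; field.
  have : k.+1%:R != 0 :> R by rewrite pnatr_eq0.
  have : k`!%:R != 0 :> R by rewrite pnatr_eq0 -lt0n fact_gt0.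
  rewrite factS natrM exprMn (exprS 2).
  by move: (k.+1%:R : R) (k`!%:R : R) => N M M0 N0; field; rewrite N0 M0.
rewrite integral_cons_rV//; apply: le_trans (le_integral_pos_fold mH H0).
have mHN : measurable_fun setT (fun s : measurableTypeR R => H (- s)).
  by apply: (measurableT_comp mH); exact: measurable_funN.
have mpH : measurable_fun setT (fun s : measurableTypeR R => pos s * (H s + H (- s)%R))%E.
  by apply: emeasurable_funM; [exact: measurable_pos|exact: emeasurable_funD].
have pH0 s : (0 <= pos s * (H s + H (- s)%R))%E.
  by apply: mule_ge0; [exact: pos_ge0|exact: adde_ge0].
apply: (@le_trans _ _ (\int[mu]_(s in `]0%R, tau]) (pos s * (H s + H (- s)%R)))%E); last first.
  by apply: ge0_subset_integral => //; apply: measurable_funTS.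
have mq : measurable_fun setT (fun s : measurableTypeR R => (2 * q s)%:E).
  apply/measurable_EFinP; apply: measurable_funM => //; apply: measurable_funM => //.
  apply: measurable_funM; first by apply: measurable_funX; exact: measurable_funB.
  by apply: measurable_funB => //; apply: measurable_funM => //; exact: measurable_funB.
have -> : (2 * (K * (tau ^+ k.+1 / k.+1%:R)))%:E = (\int[mu]_(s in `]0%R, tau]) (2 * q s)%:E)%E.
  rewrite integral_itv_obnd_cbnd; last exact: measurable_funTS.
  have := integral_simplex_weight k (2 * K) kappa tau0.
  by rewrite -mulrA => <-; apply: eq_integral => s _; rewrite /q /s0 -!mulrA.
(* The tangent can make [q] negative; monotonicity for nonnegative integrands is applied to its
   positive part. *)
apply: (@le_trans _ _ (\int[mu]_(s in `]0%R, tau]) (Num.max (2 * q s) 0)%:E)%E).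
  rewrite integralE (_ : \int[mu]_(s in _) (Num.max _ _)%:E =
    \int[mu]_(s in `]0%R, tau]) (fun s : measurableTypeR R => (2 * q s)%:E)^\+ s)%E.
    by apply: geeDl; rewrite leeNl oppe0 integral_ge0.
  by apply: eq_integral => s _; rewrite funeposE EFin_max.
apply: ge0_le_integral => //.
- by move=> s _; rewrite lee_fin le_max lexx orbT.
- apply: measurable_funTS; apply/measurable_EFinP; apply: measurable_maxr => //.
  exact/measurable_EFinP.
- exact: measurable_funTS.
move=> s /=; rewrite in_itv/= => /andP[s0' st].
rewrite /pos s0' mul1e EFin_max ge_max adde_ge0// andbT.
rewrite mulr_natl mulr2n EFinD; apply: leeD; apply: qH; rewrite ?(ltW s0')// ?normrN gtr0_norm//.
Qed.

End cross_polytope.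

Section log_concave_peak.
Context (R : realType) (n : nat) (g : 'rV[R]_n -> R).
Hypothesis lg : log_concave g.
Hypothesis mg : measurable_fun setT g.
Hypothesis g_ge0 : forall z, 0 <= g z.
Hypothesis gN : forall z, g (- z) = g z.
Hypothesis g0_gt0 : 0 < g 0.
Local Notation mu := (@lebesgue_measure R).
Local Notation leb n := (lebesgue_measure_rV R n).

(** Log-concavity between [z] and the origin bounds the integrand by [g (t *: z)], and scaling gives
    [t^-n]. *)
Lemma integral_powR_le (t : R) : 0 < t < 1 ->
  ((\int[leb n]_z (g z `^ t * g 0 `^ (1 - t))%:E) <= (t ^- n)%:E * \int[leb n]_z (g z)%:E)%E.
Proof.
move=> /andP[t0 t1].
have mgE : measurable_fun setT (fun z => (g z)%:E) by exact/measurable_EFinP.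
have <- : (\int[leb n]_z (g (t *: z))%:E = (t ^- n)%:E * \int[leb n]_z (g z)%:E)%E.
  rewrite -(integral_rV_scale t0 mgE); last by move=> z; rewrite lee_fin.
  by rewrite muleA -EFinM mulVf ?mul1e// expf_neq0// gt_eqF.
apply: ge0_le_integral => //.
- by move=> z _; rewrite lee_fin mulr_ge0 ?powR_ge0.
- apply/measurable_EFinP; apply: measurable_funM => //.
  exact: (measurableT_comp (@measurable_powR R t) mg).
- apply/measurable_EFinP; apply: (measurableT_comp mg).
  have := measurable_rV_mul (t%:M : 'M[R]_n).
  by congr (measurable_fun _ _); apply/funext => x; rewrite mul_mx_scalar.
move=> z _; rewrite lee_fin.
have := @lg z 0 t; rewrite scaler0 addr0; apply.
by rewrite !ltW.
Qed.

Lemma powR_expR_scale (G a t : R) : 0 < G -> (G * expR a) `^ t = G `^ t * expR (a * t).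
Proof. by move=> G0; rewrite powRM ?expR_ge0 ?(ltW G0)// expRM. Qed.

(** The missing weight [1 - \sum_i l i] rests on the origin, where the exponent is zero. The
    induction splits off the first point and renormalises the remaining weights by [1 - l ord0]. *)
Lemma log_concave_sum (k : nat) (l : 'I_k -> R) (x : 'I_k -> 'rV[R]_n) (phi : 'I_k -> R) :
  (forall i, 0 <= l i) -> \sum_i l i <= 1 ->
  (forall i, g (x i) = g 0 * expR (- phi i)) ->
  g 0 * expR (- \sum_i l i * phi i) <= g (\sum_i l i *: x i).
Proof.
elim: k l x phi => [|k IH] l x phi l0 l1 gx.
  by rewrite !big_ord0 oppr0 expR0 mulr1.
rewrite !big_ord_recl/=.
set l' := l ord0; set S := \sum_(i < k) l (lift ord0 i) *: x (lift ord0 i).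
have sum_ge0 : 0 <= \sum_(i < k) l (lift ord0 i) by exact: sumr_ge0.
have l'0 : 0 <= l' by exact: l0.
have l'1 : l' <= 1 by apply: le_trans l1; rewrite big_ord_recl lerDl.
have [l'e1|l'n1] := eqVneq l' 1.
  have li0 i : l (lift ord0 i) = 0.
    have : \sum_(i < k) l (lift ord0 i) <= 0.
      by move: l1; rewrite big_ord_recl -/l' l'e1 -lerBrDl subrr.
    move=> s0; apply/eqP; rewrite eq_le l0 andbT; apply: le_trans s0.
    by rewrite (bigD1 i)//= lerDl; exact: sumr_ge0.
  have -> : S = 0 by rewrite /S big1// => i _; rewrite li0 scale0r.
  have -> : \sum_(i < k) l (lift ord0 i) * phi (lift ord0 i) = 0.
    by rewrite big1// => i _; rewrite li0 mul0r.
  by rewrite !addr0 l'e1 scale1r mul1r gx.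
have l'lt1 : 0 < 1 - l' by rewrite subr_gt0 lt_neqAle l'n1.
have := IH (fun i => l (lift ord0 i) / (1 - l')) (fun i => x (lift ord0 i))
  (fun i => phi (lift ord0 i)).
set S' := \sum_(i < k) (l (lift ord0 i) / (1 - l')) *: x (lift ord0 i).
have SE : S = (1 - l') *: S'.
  rewrite /S /S' scaler_sumr; apply: eq_bigr => i _.
  by rewrite scalerA mulrC divfK// gt_eqF.
move=> /(_ _ _ _) IH'.
have {}IH' : g 0 * expR (- \sum_(i < k) l (lift ord0 i) / (1 - l') * phi (lift ord0 i)) <= g S'.
  apply: IH' => [i||i]; [|rewrite -mulr_suml ler_pdivrMr// mul1r lerBrDl|exact: gx].
    by rewrite divr_ge0// ltW.
  by move: l1; rewrite big_ord_recl.
rewrite SE; have := @lg (x ord0) S' l'; rewrite l'0 l'1 => /(_ isT); apply: le_trans.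
rewrite gx powR_expR_scale//.
apply: (@le_trans _ _ (g 0 `^ l' * expR (- phi ord0 * l') *
  (g 0 * expR (- \sum_(i < k) l (lift ord0 i) / (1 - l') * phi (lift ord0 i))) `^ (1 - l'))).
  rewrite powR_expR_scale// mulrACA -powRD ?subrKC ?powRr1 ?oner_eq0 ?(ltW g0_gt0)// -expRD.
  rewrite le_eqVlt; apply/orP; left; apply/eqP; congr (_ * expR _).
  rewrite opprD !mulNr mulr_suml (mulrC (phi ord0)); congr (_ - _).
  by apply: eq_bigr => i _; field; rewrite gt_eqF.
apply: ler_wpM2l; first by rewrite mulr_ge0 ?powR_ge0 ?expR_ge0.
by apply: ge0_ler_powR; rewrite ?nnegrE ?(ltW l'lt1) ?mulr_ge0 ?expR_ge0 ?(ltW g0_gt0).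
Qed.

Section section_bound.
Variables (k : nat) (V : 'M[R]_(k, n)).

(** A combination of the rows with coefficients [t_i] is one of the rows up to sign with weights
    [|t_i|], and [g] does not see the signs. For [\sum_i |t_i| <= tau <= 1] log-concavity then
    provides the exponential lower bound required on the cross-polytope. *)
Lemma section_bound (phi : 'I_k -> R) (tau : R) : 0 <= tau <= 1 ->
  (forall i, g (row i V) = g 0 * expR (- phi i)) ->
  ((g 0 * ((2 * tau) ^+ k / k`!%:R) * expR (- (tau * (\sum_i phi i) / k.+1%:R)))%:E <=
   \int[leb k]_t (g (t *m V))%:E)%E.
Proof.
move=> /andP[tau0 tau1] gV; apply: cross_polytope_bound => //.
- apply/measurable_EFinP; apply: (measurableT_comp mg); exact: measurable_rV_mul.
- by move=> t; rewrite lee_fin.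
move=> t tt; rewrite lee_fin.
have -> : t *m V = \sum_i `|t ord0 i| *: (Num.sg (t ord0 i) *: row i V).
  rewrite mulmx_sum_row; apply: eq_bigr => i _.
  by rewrite scalerA mulrC -numEsg.
have sgr i : Num.sg (t ord0 i) = 0 \/ g (Num.sg (t ord0 i) *: row i V) = g 0 * expR (- phi i).
  case: sgrP => _; [by left|right|right].
    by rewrite scale1r.
  by rewrite scaleN1r gN.
(* [Num.sg 0 = 0] would put the origin in place of the row, with another value of [g]; the weight
   being zero there, the row itself is kept. *)
pose x i := if t ord0 i == 0 then row i V else Num.sg (t ord0 i) *: row i V.
rewrite (eq_bigr (fun i => `|t ord0 i| *: x i)); last first.
  by move=> i _; rewrite /x; case: eqP => // ->; rewrite normr0 !scale0r.
apply: log_concave_sum => //; first exact: le_trans tt _.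
move=> i; rewrite /x; case: eqP => // /eqP ti0.
by have [/eqP|//] := sgr i; rewrite sgr_eq0 (negbTE ti0).
Qed.

Variable e : 'rV[R]_n.
Let m (s : R) : \bar R := (\int[leb k]_t (g (s *: e + t *m V))%:E)%E.

Let msection s : measurable_fun setT (fun t : 'rV[R]_k => g (s *: e + t *m V)).
Proof.
apply: (measurableT_comp mg).
have := @measurable_rV_affine R k n V (s *: e).
by congr (measurable_fun _ _); apply/funext => t; rewrite addrC.
Qed.

Let m_ge0 s : (0 <= m s)%E. Proof. by apply: integral_ge0 => t _; rewrite lee_fin. Qed.

Let mm : measurable_fun setT m.
Proof.
apply: (@measurable_fun_fubini_tonelli_F _ _ _ _ R (leb k)
  (fun p : measurableTypeR R * 'rV[R]_k => (g (p.1 *: e + p.2 *m V))%:E)); last first.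
  by move=> p; rewrite lee_fin.
apply/measurable_EFinP; apply: (measurableT_comp mg).
apply/measurable_fun_rVP => i.
under eq_fun do rewrite !mxE.
apply: measurable_funD.
  by apply: measurable_funM => //; exact: measurable_fst.
apply: measurable_sum => j; apply: measurable_funM => //.
exact: (measurableT_comp (@measurable_coord R k j) measurable_snd).
Qed.

Let mN s : m (- s) = m s.
Proof.
rewrite /m -[LHS]integral_rVN.
- by apply: eq_integral => t _; rewrite scaleNr mulNmx -opprD gN.
- by apply/measurable_EFinP; exact: msection.
- by move=> t; rewrite lee_fin.
Qed.

Let m_log_concave s r l : 0 < l < 1 ->
  (m s `^ l * m r `^ (1 - l) <= m (l * s + (1 - l) * r)%R)%E.
Proof.
move=> l01; apply: prekopa_leindler => //;
  try (by apply/measurable_EFinP; exact: msection);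
  try (by move=> t; rewrite lee_fin).
move=> x y; rewrite !poweR_EFin -EFinM lee_fin.
have /andP[l0 l1] := l01.
apply: le_trans (@lg _ _ l _) _; first by rewrite !ltW.
rewrite !scalerDr !scalerA mulmxDl -!scalemxAl addrACA -scalerDl//.
Qed.

(** Both [r] and [a] lie between 0 and [r + a], with complementary weights [l] and [1 - l]; the
    product of the two log-concavity inequalities is the claim. *)
Let m_submul (r a : R) : 0 < r -> 0 < a -> (m 0%R * m (r + a)%R <= m r * m a)%E.
Proof.
move=> r0 a0; have ra0 : 0 < r + a by rewrite addr_gt0.
pose l := r / (r + a).
have l01 : 0 < l < 1 by rewrite divr_gt0//= ltr_pdivrMr// mul1r ltrDl.
have /andP[l0 l1] := l01.
have h1 := m_log_concave (r + a) 0 l01.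
have l'01 : 0 < 1 - l < 1 by rewrite subr_gt0 l1 ltrBlDr ltrDl.
have h2 := m_log_concave (r + a) 0 l'01.
rewrite mulr0 addr0 in h1; rewrite mulr0 addr0 in h2.
have E1 : l * (r + a) = r by rewrite /l divfK// gt_eqF.
have E2 : (1 - l) * (r + a) = a by rewrite mulrBl E1 mul1r addrC addKr.
rewrite E1 in h1; rewrite E2 in h2.
apply: le_trans (lee_pmul _ _ h1 h2); rewrite ?mule_ge0 ?poweR_ge0//.
rewrite muleACA subKr -!poweRD ?add_neq0_poweRD_def ?subrKC ?subrK ?oner_neq0// !poweRe1//.
by rewrite muleC.
Qed.

Lemma section_second_moment :
  let m := fun s : R => (\int[leb k]_t (g (s *: e + t *m V))%:E)%E in
  (2%:E * (m 0%R * (m 0%R * \int[mu]_s ((s ^+ 2)%:E * m s))) <=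
   \int[mu]_s m s * (\int[mu]_s m s * \int[mu]_s m s))%E.
Proof. exact: (even_submultiplicative_second_moment mm m_ge0 mN m_submul). Qed.

Lemma measurable_section_marginal :
  measurable_fun setT (fun s : measurableTypeR R => \int[leb k]_t (g (s *: e + t *m V))%:E)%E.
Proof. exact: mm. Qed.

End section_bound.
End log_concave_peak.

Section hyperplane_section.
Context (R : realType) (k : nat) (g : 'rV[R]_k.+1 -> R).
Hypothesis lg : log_concave g.
Hypothesis mg : measurable_fun setT g.
Hypothesis g_ge0 : forall z, 0 <= g z.
Hypothesis gN : forall z, g (- z) = g z.
Hypothesis g0_gt0 : 0 < g 0.
Hypothesis intg : (\int[lebesgue_measure_rV R k.+1]_z (g z)%:E = 1)%E.
Local Notation mu := (@lebesgue_measure R).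
Local Notation leb n := (lebesgue_measure_rV R n).

(** A linear functional of [z] vanishing on the row span of [V], hence a multiple of the transverse
    coordinate. Its square is a Gram determinant up to a constant, which makes its second moment
    computable. *)
Definition det_with (V : 'M[R]_(k, k.+1)) (z : 'rV[R]_k.+1) : R :=
  \det (col_mx z V : 'M[R]_(1 + k)).

Lemma det_with_combination (V : 'M[R]_(k, k.+1)) (e : 'rV[R]_k.+1) (s : R) (t : 'rV[R]_k) :
  det_with V (s *: e + t *m V) = s * det_with V e.
Proof.
rewrite /det_with -[X in X * _](_ : \det (block_mx s%:M t 0 1%:M : 'M[R]_(1 + k)) = s).
  rewrite -det_mulmx; congr (\det _).
  by rewrite [RHS](mul_block_col s%:M t 0 1%:M e V) !mul_scalar_mx mul0mx scale1r add0r.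
by rewrite (det_ublock (s%:M : 'M[R]_1)) det_scalar1 det1 mulr1.
Qed.

Lemma measurable_det_with (V : 'M[R]_(k, k.+1)) : measurable_fun setT (det_with V).
Proof.
rewrite /det_with; under eq_fun do rewrite (expand_det_row _ (@ord0 k)).
apply: measurable_sum => j.
under eq_fun => z.
  rewrite (_ : col_mx z V ord0 j = z ord0 j); last first.
    have -> : @ord0 k = lshift k (@ord0 0) by exact/val_inj.
    by rewrite [LHS](col_mxEu z V).
  rewrite (_ : cofactor (col_mx z V) ord0 j = cofactor (col_mx 0 V : 'M[R]_(1 + k)) ord0 j); last first.
    rewrite /cofactor; congr (_ * \det _); apply/matrixP => a b.
    rewrite [LHS]mxE [RHS]mxE [LHS]mxE [RHS]mxE.
    have -> : lift (@ord0 k) a = rshift 1 a by exact/val_inj.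
    by rewrite [LHS](col_mxEd z V) [RHS](col_mxEd 0 V).
  over.
apply: measurable_funM => //; exact: measurable_coord.
Qed.

(** In the coordinates [z = s e + t V], of Jacobian [|d|], the marginal [m] in [s] has mass
    [1 / |d|], satisfies [m 0 >= c], and [det_with V z = s * d]. The left side is [2 c^2 |d|^3]
    times the second moment of [m], which the one-dimensional inequality bounds by
    [|d|^3 (1 / |d|)^3]: the choice of [e] drops out. *)
Lemma det_with_second_moment (V : 'M[R]_(k, k.+1)) (e : 'rV[R]_k.+1)
    (phi : 'I_k -> R) (tau c : R) : 0 <= tau <= 1 -> det_with V e != 0 ->
  (forall i, g (row i V) = g 0 * expR (- phi i)) ->
  c = g 0 * ((2 * tau) ^+ k / k`!%:R) * expR (- (tau * (\sum_i phi i) / k.+1%:R)) ->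
  ((2 * c ^+ 2)%:E * \int[leb k.+1]_z (det_with V z ^+ 2 * g z)%:E <= 1)%E.
Proof.
move=> tau01 d0 gV cE; set d := det_with V e in d0.
pose A : 'M[R]_k.+1 := (col_mx e V : 'M[R]_(1 + k)).
have detA : \det A = d by [].
pose m (s : R) : \bar R := (\int[leb k]_t (g (s *: e + t *m V))%:E)%E.
have m_ge0 s : (0 <= m s)%E by apply: integral_ge0 => t _; rewrite lee_fin.
have mm : measurable_fun setT m by exact: measurable_section_marginal.
have mmul (w : R -> R) : measurable_fun setT w -> (forall s, 0 <= w s) ->
    (\int[leb k.+1]_z (w (det_with V z) * g z)%:E =
     `|d|%:E * \int[mu]_s ((w (s * d))%:E * m s))%E.
  move=> mw w0.
  have mwg : measurable_fun setT (fun z => (w (det_with V z) * g z)%:E).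
    apply/measurable_EFinP; apply: measurable_funM => //.
    by apply: (measurableT_comp mw); exact: measurable_det_with.
  have := @integral_linear_change R k.+1 A; rewrite detA => /(_ d0) <- //; last first.
    by move=> z; rewrite lee_fin mulr_ge0.
  congr (_ * _)%E; rewrite integral_cons_rV//; last 2 first.
  - by apply: (measurableT_comp mwg); exact: measurable_rV_mul.
  - by move=> z; rewrite lee_fin mulr_ge0.
  apply: eq_integral => s _; rewrite /m -ge0_integralZl_EFin//; last 2 first.
  - by move=> t _; rewrite lee_fin.
  - apply/measurable_EFinP; apply: (measurableT_comp mg).
    have := @measurable_rV_affine R k k.+1 V (s *: e).
    by congr (measurable_fun _ _); apply/funext => t; rewrite addrC.
  apply: eq_integral => t _.
  by rewrite mul_cons_rV_col det_with_combination -EFinM.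
have I1 : (`|d|%:E * \int[mu]_s m s = 1)%E.
  have := mmul (fun=> 1) _ (fun=> ler01); under eq_integral do rewrite mul1r.
  rewrite intg => ->//; congr (_ * _)%E; by apply: eq_integral => s _; rewrite mul1e.
have mom := @section_second_moment R k.+1 g lg mg g_ge0 gN k V e.
rewrite /= -/m in mom.
have cm : (c%:E <= m 0%R)%E.
  rewrite /m; under eq_integral do rewrite scale0r add0r.
  by rewrite cE; exact: section_bound.
have c0 : 0 <= c.
  rewrite cE !mulr_ge0 ?expR_ge0 ?invr_ge0 ?ler0n ?exprn_ge0//; by case/andP: tau01 => ? _; rewrite mulr_ge0.
rewrite (mmul (fun s => s ^+ 2)); [|exact: exprn_measurable|exact: sqr_ge0].
set J := (\int[mu]_s ((s ^+ 2)%:E * m s))%E in mom.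
have -> : (\int[mu]_s (((s * d) ^+ 2)%:E * m s) = (d ^+ 2)%:E * J)%E.
  rewrite -ge0_integralZl_EFin ?sqr_ge0//.
  - by apply: eq_integral => s _; rewrite exprMn mulrC EFinM muleA.
  - by move=> s _; rewrite mule_ge0// lee_fin sqr_ge0.
  - by apply: emeasurable_funM => //; apply/measurable_EFinP; exact: exprn_measurable.
have J0 : (0 <= J)%E by apply: integral_ge0 => s _; rewrite mule_ge0// lee_fin sqr_ge0.
have nd0 : 0 < `|d| by rewrite normr_gt0.
have IE : (\int[mu]_s m s = (`|d|^-1)%:E)%E.
  have := congr1 (fun x => (`|d|^-1)%:E * x)%E I1.
  by rewrite muleA -EFinM mulVf ?gt_eqF// mul1e mule1.
rewrite IE -!EFinM in mom.
have -> : ((2 * c ^+ 2)%:E * (`|d|%:E * ((d ^+ 2)%:E * J)) = (`|d| ^+ 3)%:E * (2%:E * (c%:E * (c%:E * J))))%E.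
  rewrite !muleA -!EFinM; congr (_%:E * _)%E; have -> : d ^+ 2 = `|d| ^+ 2 by rewrite real_normK ?num_real.
  by ring.
apply: (@le_trans _ _ ((`|d| ^+ 3)%:E * (2%:E * (m 0%R * (m 0%R * J))))%E).
  rewrite lee_pmul2l ?lte_fin ?exprn_gt0//; apply: lee_wpmul2l => //.
  by apply: lee_pmul; rewrite ?lee_fin ?mule_ge0//; exact: lee_wpmul2r.
apply: (@le_trans _ _ ((`|d| ^+ 3)%:E * (`|d|^-1 * (`|d|^-1 / `|d|))%:E)%E).
  by rewrite lee_pmul2l ?lte_fin ?exprn_gt0.
by rewrite -EFinM lee_fin le_eqVlt; apply/orP; left; apply/eqP; field; rewrite gt_eqF.
Qed.

End hyperplane_section.

(** * Gram determinants and the peak of a log-concave density *)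

Section gram.
Context (R : realType) (n : nat) (S : 'M[R]_n).
Hypothesis S_sym : S^T = S.
Hypothesis S_unit : S \in unitmx.
Local Notation T := (invmx S).

Definition gram (k : nat) (V : 'M[R]_(k, n)) : R := \det (V *m T *m V^T).

(** A Schur complement. For positive definite [S] it is the quadratic form of the squared distance
    to the row span of [V], measured by [T]. *)
Definition gram_form (k : nat) (V : 'M[R]_(k, n)) : 'M[R]_n :=
  T - T *m V^T *m invmx (V *m T *m V^T) *m V *m T.

Lemma gram_col_mx (k : nat) (V : 'M[R]_(k, n)) (z : 'rV[R]_n) : gram V != 0 ->
  gram (col_mx z V) = gram V * (z *m gram_form V *m z^T) ord0 ord0.
Proof.
move=> V0; set G := V *m T *m V^T.
have G_unit : G \in unitmx by rewrite unitmxE unitfE.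
rewrite /gram mul_col_mx tr_col_mx mul_col_row -/G.
have -> : block_mx (z *m T *m z^T) (z *m T *m V^T) (V *m T *m z^T) G =
    block_mx 1%:M (z *m T *m V^T *m invmx G) 0 1%:M *m
    block_mx (z *m gram_form V *m z^T) 0 (V *m T *m z^T) G.
  rewrite mulmx_block !mul1mx !mul0mx !add0r mulmxKV//.
  congr block_mx; rewrite /gram_form -/G mulmxBr mulmxBl !mulmxA.
  by rewrite subrK.
by rewrite det_mulmx det_ublock !det1 !mul1r det_lblock det_mx11 mulrC.
Qed.

(** After multiplication by [S] the form becomes the identity minus a projection of rank [k]. *)
Lemma trace_gram_form (k : nat) (V : 'M[R]_(k, n)) : gram V != 0 ->
  \tr (gram_form V *m S) = n%:R - k%:R.
Proof.
move=> V0; have G_unit : V *m T *m V^T \in unitmx by rewrite unitmxE unitfE.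
rewrite /gram_form mulmxBl mulVmx// -(mulmxA _ T S) mulVmx// mulmx1 linearB/= mxtrace1.
by rewrite -(mulmxA _ (invmx _) V) mxtrace_mulC -(mulmxA (invmx _) V) (mulmxA V T) mulVmx// mxtrace1.
Qed.

Lemma gram_square (A : 'M[R]_n) : \det S * gram A = \det A ^+ 2.
Proof.
rewrite /gram !det_mulmx det_tr det_inv.
have : \det S != 0 by rewrite -unitfE -unitmxE.
by move=> S0; field.
Qed.

Lemma gram0 (V : 'M[R]_(0, n)) : gram V = 1.
Proof. by rewrite /gram det_mx00. Qed.

End gram.

Section selection.
Context (R : realType) (n : nat) (g : 'rV[R]_n -> R) (S : 'M[R]_n).
Hypothesis mg : measurable_fun setT g.
Hypothesis g_ge0 : forall z, 0 <= g z.
Hypothesis g0_gt0 : 0 < g 0.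
Hypothesis S_sym : S^T = S.
Hypothesis S_unit : S \in unitmx.
Local Notation leb := (lebesgue_measure_rV R n).
Hypothesis moment : forall u : 'cV[R]_n,
  (\int[leb]_z (((z *m u) ord0 ord0) ^+ 2 * g z)%:E = ((u^T *m S *m u) ord0 ord0)%:E)%E.

Let linear_coord (u : 'cV[R]_n) : measurable_fun setT (fun z : 'rV[R]_n => (z *m u) ord0 ord0).
Proof. exact: (measurableT_comp (@measurable_coord R 1 ord0) (measurable_rV_mul u)). Qed.

Let integrable_sq (u : 'cV[R]_n) :
  leb.-integrable setT (fun z => (((z *m u) ord0 ord0) ^+ 2 * g z)%:E).
Proof.
apply/integrableP; split.
  by apply/measurable_EFinP; apply: measurable_funM => //; apply: measurable_funX; exact: linear_coord.
rewrite (eq_integral (fun z => (((z *m u) ord0 ord0) ^+ 2 * g z)%:E)); first by rewrite moment ltry.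
by move=> z _; rewrite gee0_abs// lee_fin mulr_ge0// sqr_ge0.
Qed.

Let unitc (i : 'I_n) : 'cV[R]_n := delta_mx i ord0.

Let mul_unitc (z : 'rV[R]_n) i : (z *m unitc i) ord0 ord0 = z ord0 i.
Proof. by rewrite -colE mxE. Qed.

Let form_unitc i j : ((unitc i)^T *m S *m unitc j) ord0 ord0 = S i j.
Proof. by rewrite trmx_delta -rowE -colE !mxE. Qed.

(** Polarization: [moment] speaks of squares of linear forms, and this recovers the mixed moments,
    hence the mean of every quadratic form. *)
Let coordsE i j (z : 'rV[R]_n) : (z ord0 i * z ord0 j * g z)%:E =
  (2^-1%:E * ((((z *m (unitc i + unitc j)) ord0 ord0) ^+ 2 * g z)%:E -
    ((((z *m unitc i) ord0 ord0) ^+ 2 * g z)%:E + (((z *m unitc j) ord0 ord0) ^+ 2 * g z)%:E)))%E.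
Proof.
rewrite mulmxDr [X in X ^+ 2]mxE !mul_unitc -[in RHS]EFinD -?EFinB -EFinM.
by congr EFin; field.
Qed.

Let integrable_polar i j : leb.-integrable setT (fun z =>
  ((((z *m (unitc i + unitc j)) ord0 ord0) ^+ 2 * g z)%:E -
    ((((z *m unitc i) ord0 ord0) ^+ 2 * g z)%:E + (((z *m unitc j) ord0 ord0) ^+ 2 * g z)%:E))%E).
Proof.
exact: (integrableB measurableT (integrable_sq _)
  (integrableD measurableT (integrable_sq _) (integrable_sq _))).
Qed.

Let integrable_coords i j : leb.-integrable setT (fun z => (z ord0 i * z ord0 j * g z)%:E).
Proof.
under eq_fun do rewrite coordsE.
by apply: integrableZl => //; exact: integrable_polar.
Qed.

Let integral_coords i j :
  (\int[leb]_z (z ord0 i * z ord0 j * g z)%:E = (S i j)%:E)%E.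
Proof.
under eq_integral do rewrite coordsE.
rewrite (integralZl measurableT (integrable_polar i j)).
rewrite (integralB measurableT (integrable_sq _) (integrableD measurableT (integrable_sq _) (integrable_sq _))).
rewrite (integralD measurableT (integrable_sq _) (integrable_sq _)).
rewrite !moment -?EFinD -?EFinB -EFinM; congr EFin.
have addE (A B : 'M[R]_1) : (A + B) ord0 ord0 = A ord0 ord0 + B ord0 ord0 by rewrite mxE.
rewrite linearD/= [(_ + _)^T]linearD/= !mulmxDl !addE !form_unitc.
have -> : S j i = S i j by rewrite -[in LHS]S_sym mxE.
by field.
Qed.

Let formE (Q : 'M[R]_n) (z : 'rV[R]_n) : ((z *m Q *m z^T) ord0 ord0 * g z)%:E =
  (\sum_(i < n) \sum_(j < n) (Q i j)%:E * (z ord0 i * z ord0 j * g z)%:E)%E.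
Proof.
rewrite mxE mulr_suml -sumEFin exchange_big/=; apply: eq_bigr => j _.
rewrite mxE mulr_suml mulr_suml -sumEFin; apply: eq_bigr => i _.
by rewrite mxE -EFinM; congr EFin; ring.
Qed.

Lemma integrable_form (Q : 'M[R]_n) :
  leb.-integrable setT (fun z => ((z *m Q *m z^T) ord0 ord0 * g z)%:E).
Proof.
under eq_fun do rewrite formE.
by apply: integrable_sum => // i _; apply: integrable_sum => // j _; exact: integrableZl.
Qed.

Lemma integral_form (Q : 'M[R]_n) :
  (\int[leb]_z ((z *m Q *m z^T) ord0 ord0 * g z)%:E = (\tr (Q *m S))%:E)%E.
Proof.
under eq_integral do rewrite formE.
rewrite integral_sum//; last first.
  by move=> i; apply: integrable_sum => // j _; exact: integrableZl.
rewrite /mxtrace -sumEFin; apply: eq_bigr => i _.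
rewrite integral_sum//; last by move=> j; exact: integrableZl.
rewrite mxE -sumEFin; apply: eq_bigr => j _.
by rewrite integralZl// integral_coords -EFinM -[in RHS]S_sym mxE.
Qed.

Lemma integrable_gram (k : nat) (V : 'M[R]_(k, n)) : gram S V != 0 ->
  leb.-integrable setT (fun z => (gram S (col_mx z V) * g z)%:E).
Proof.
move=> V0.
rewrite (_ : (fun z => _) = (fun z => (gram S V)%:E * ((z *m gram_form S V *m z^T) ord0 ord0 * g z)%:E)%E).
  by apply: integrableZl => //; exact: integrable_form.
by apply/funext => z; rewrite gram_col_mx// -EFinM mulrA.
Qed.

Lemma integral_gram (k : nat) (V : 'M[R]_(k, n)) : gram S V != 0 ->
  (\int[leb]_z (gram S (col_mx z V) * g z)%:E = ((n%:R - k%:R) * gram S V)%:E)%E.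
Proof.
move=> V0.
rewrite (eq_integral (fun z => (gram S V)%:E * ((z *m gram_form S V *m z^T) ord0 ord0 * g z)%:E)%E).
  rewrite integralZl//; last exact: integrable_form.
  by rewrite integral_form trace_gram_form// -EFinM mulrC.
by move=> z _; rewrite gram_col_mx// -EFinM mulrA.
Qed.

Variables (t W : R).
Hypothesis t01 : 0 < t < 1.
Hypothesis W_gt0 : 0 < W.
Hypothesis W_gt : ((\int[leb]_z (g z `^ t * g 0 `^ (1 - t))%:E) < W%:E)%E.

(** If no point qualified, then [gram S (col_mx z V) * g z <= C * (g z)^t * (g 0)^(1-t)] for every
    [z], trivially where [g z = 0]. The left side integrates to [(n - k) * gram S V = C * W], the
    right side to strictly less by [W_gt]. The exponent [phi] is [ln (g 0 / g z)]. *)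
Lemma gram_select (k : nat) (V : 'M[R]_(k, n)) : (k < n)%N -> 0 < gram S V ->
  exists z phi, g z = g 0 * expR (- phi) /\
    (n%:R - k%:R) * gram S V / W * expR ((1 - t) * phi) <= gram S (col_mx z V).
Proof.
move=> kn V0; have nk : 0 < n%:R - k%:R :> R by rewrite subr_gt0 ltr_nat.
set C := (n%:R - k%:R) * gram S V / W.
have C0 : 0 < C by rewrite divr_gt0// mulr_gt0.
apply: contrapT => H.
have mI : measurable_fun setT (fun z => g z `^ t * g 0 `^ (1 - t)).
  by apply: measurable_funM => //; exact: (measurableT_comp (@measurable_powR R t) mg).
have le z : gram S (col_mx z V) * g z <= C * (g z `^ t * g 0 `^ (1 - t)).
  have := g_ge0 z; rewrite le_eqVlt => /predU1P[<-|gz0].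
    by rewrite mulr0 powR0 ?gt_eqF ?mul0r ?mulr0//; case/andP: t01.
  pose phi := ln (g 0 / g z).
  have gE : g z = g 0 * expR (- phi).
    rewrite expRN lnK ?posrE ?divr_gt0// invf_div mulrCA mulfV ?mulr1// gt_eqF//.
  have [//|lt] := leP (gram S (col_mx z V) * g z) _.
  exfalso; apply: H; exists z, phi; split => //.
  rewrite -(ler_pM2r gz0); apply: le_trans (ltW lt).
  rewrite -(mulrA C) ler_pM2l// le_eqVlt; apply/orP; left; apply/eqP.
  rewrite [in LHS]gE [in RHS]gE powR_expR_scale// mulrCA -expRD mulrAC -powRD; last first.
    by rewrite subrKC oner_eq0.
  by rewrite subrKC powRr1 ?(ltW g0_gt0)//; congr (_ * expR _); ring.
have iI : leb.-integrable setT (fun z => (g z `^ t * g 0 `^ (1 - t))%:E).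
  apply/integrableP; split; first exact/measurable_EFinP.
  rewrite (eq_integral (fun z => (g z `^ t * g 0 `^ (1 - t))%:E)); first exact: lt_trans W_gt (ltry _).
  by move=> z _; rewrite gee0_abs// lee_fin mulr_ge0// powR_ge0.
have := @le_integral _ _ _ leb setT measurableT _ _ (integrable_gram (lt0r_neq0 V0))
  (integrableZl measurableT C iI).
move=> /(_ _) HH; have {HH} : (((n%:R - k%:R) * gram S V)%:E <=
   C%:E * \int[leb]_z (g z `^ t * g 0 `^ (1 - t))%:E)%E.
  rewrite -integral_gram ?lt0r_neq0// -integralZl//; apply: HH => z _.
  by rewrite -EFinM lee_fin; exact: le.
apply/negP; rewrite -ltNge.
have -> : (n%:R - k%:R) * gram S V = C * W by rewrite /C divfK// gt_eqF.
by rewrite (EFinM C W) lte_pmul2l.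
Qed.

(** The empty family has Gram determinant 1; selecting a vector after [j] others contributes the
    factor [(n - j) / W], and the numerators form the falling factorial. *)
Lemma gram_chain (k : nat) : (k <= n)%N ->
  exists (V : 'M[R]_(k, n)) (phi : 'I_k -> R),
    (forall i, g (row i V) = g 0 * expR (- phi i)) /\
    (n ^_ k)%:R / W ^+ k * expR ((1 - t) * \sum_i phi i) <= gram S V.
Proof.
elim: k => [_|k IH kn].
  exists 0, (fun=> 0); split; first by case.
  by rewrite gram0 big_ord0 mulr0 expR0 ffactn0 expr0 divr1 mulr1.
have [V [phi [gV hV]]] := IH (ltnW kn).
have V0 : 0 < gram S V.
  apply: lt_le_trans hV; rewrite mulr_gt0 ?expR_gt0// divr_gt0 ?exprn_gt0//.
  by rewrite ltr0n ffact_gt0 ltnW.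
have [z [psi [gz hz]]] := gram_select kn V0.
exists (col_mx z V), (fun i : 'I_(1 + k) => match fintype.split i with inl _ => psi | inr j => phi j end).
have Sl (j : 'I_1) : fintype.split (lshift k j) = inl j := unsplitK (inl j).
have Sr (j : 'I_k) : fintype.split (rshift 1 j) = inr j := unsplitK (inr j).
split=> [i|].
  have [j ->|j ->] := @fintype.split_ordP 1 k i.
    rewrite (_ : row _ _ = z)//.
    by apply/rowP => l; rewrite mxE [LHS](col_mxEu z V) ord1.
  rewrite ?Sr -gV; congr g.
  by apply/rowP => l; rewrite mxE [LHS](col_mxEd z V) mxE.
apply: le_trans hz; rewrite (@big_split_ord R 0 +%R 1 k)/= big_ord1 Sl.
under eq_bigr do rewrite Sr.
rewrite ffactnSr natrM natrB ?(ltnW kn)// exprS invfM (mulrDr (1 - t)) expRD.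
have nk : 0 <= (n%:R - k%:R) / W * expR ((1 - t) * psi).
  by rewrite mulr_ge0 ?expR_ge0// divr_ge0 ?(ltW W_gt0)// subr_ge0 ler_nat ltnW.
have := ler_wpM2l nk hV; congr (_ <= _); ring.
Qed.

End selection.

Section peak.
Context (R : realType) (k : nat) (g : 'rV[R]_k.+1 -> R) (S : 'M[R]_k.+1).
Hypothesis lg : log_concave g.
Hypothesis mg : measurable_fun setT g.
Hypothesis g_ge0 : forall z, 0 <= g z.
Hypothesis gN : forall z, g (- z) = g z.
Hypothesis g0_gt0 : 0 < g 0.
Hypothesis intg : (\int[lebesgue_measure_rV R k.+1]_z (g z)%:E = 1)%E.
Hypothesis S_sym : S^T = S.
Hypothesis S_unit : S \in unitmx.
Hypothesis moment : forall u : 'cV[R]_k.+1,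
  (\int[lebesgue_measure_rV R k.+1]_z (((z *m u) ord0 ord0) ^+ 2 * g z)%:E =
   ((u^T *m S *m u) ord0 ord0)%:E)%E.
Local Notation leb n := (lebesgue_measure_rV R n).
Local Notation n := k.+1.
Local Notation tau := (n%:R / n.+2%:R : R).

(* [tau] is such that [1 - tau = 2 * tau / n], so the factors [expR (phi i)] coming from
   [gram_chain] and from [det_with_second_moment] cancel. *)
Lemma log_concave_peak_le (W : R) : tau ^- n < W ->
  2 * (\det S * (n`!%:R / W ^+ k) * (g 0 * ((2 * tau) ^+ k / k`!%:R)) ^+ 2) <= 1.
Proof.
move=> tauW.
have n2 : 0 < n.+2%:R :> R by rewrite ltr0n.
have tau0 : 0 < tau by rewrite divr_gt0 ?ltr0n.
have tau1 : tau < 1 by rewrite ltr_pdivrMr// mul1r ltr_nat.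
have W0 : 0 < W by apply: lt_trans tauW; rewrite invr_gt0 exprn_gt0.
have t01 : 0 < tau < 1 by rewrite tau0.
have Wgt : (\int[leb n]_z (g z `^ tau * g 0 `^ (1 - tau))%:E < W%:E)%E.
  apply: le_lt_trans (integral_powR_le lg mg g_ge0 t01) _.
  by rewrite intg mule1 lte_fin.
have [V [phi [gV hV]]] := gram_chain mg g_ge0 g0_gt0 S_sym S_unit moment t01 W0 Wgt (leqnSn k).
have V0 : 0 < gram S V.
  apply: lt_le_trans hV; rewrite mulr_gt0 ?expR_gt0// divr_gt0 ?exprn_gt0//.
  by rewrite ltr0n ffact_gt0.
(* One more selection supplies a vector outside the span of [V]: its positive Gram determinant gives
   [det_with V e != 0]. *)
have [e [psi [_ he]]] := gram_select mg g_ge0 g0_gt0 S_sym S_unit moment t01 W0 Wgt (ltnSn k) V0.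
have ge0 : 0 < gram S (col_mx e V).
  apply: lt_le_trans he; rewrite mulr_gt0 ?expR_gt0// divr_gt0// mulr_gt0//.
  by rewrite subr_gt0 ltr_nat.
have detE z : det_with V z ^+ 2 = \det S * gram S (col_mx z V).
  by rewrite /det_with -(gram_square S_unit).
have d0 : det_with V e != 0.
  have : det_with V e ^+ 2 != 0.
    by rewrite detE; apply: mulf_neq0; [rewrite -unitfE -unitmxE|exact: lt0r_neq0].
  by rewrite expf_eq0.
set c := g 0 * ((2 * tau) ^+ k / k`!%:R) * expR (- (tau * (\sum_i phi i) / k.+1%:R)).
have tau01 : 0 <= tau <= 1 by rewrite !ltW.
have := det_with_second_moment lg mg g_ge0 gN g0_gt0 intg tau01 d0 gV (erefl c).
(* The factor [n - k] of the averaged Gram determinant is 1, as [V] has one row less than the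
   dimension. *)
have E2 : (\int[leb n]_z (det_with V z ^+ 2 * g z)%:E = (\det S * gram S V)%:E)%E.
  rewrite (eq_integral (fun z => (\det S)%:E * (gram S (col_mx z V) * g z)%:E)%E).
    rewrite (integralZl measurableT (integrable_gram mg g_ge0 moment (lt0r_neq0 V0))).
    rewrite (integral_gram mg g_ge0 S_sym S_unit moment) ?lt0r_neq0//.
    by rewrite -natrB// subSnn mul1r.
  by move=> z _; rewrite detE -EFinM mulrA.
have dS : 0 <= \det S.
  rewrite -(pmulr_lge0 _ V0) -lee_fin -E2; apply: integral_ge0 => z _.
  by rewrite lee_fin mulr_ge0// sqr_ge0.
rewrite E2 -EFinM lee_fin; apply: le_trans.
rewrite -[leRHS]mulrA ler_pM2l//.
set A := g 0 * _ in c *.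
rewrite [leRHS]mulrC -!mulrA; apply: ler_wpM2l => //.
apply: le_trans (ler_wpM2r (sqr_ge0 c) hV).
have -> : (n ^_ k = n`!)%N by rewrite -ffactnn ffactnSr subSnn muln1.
rewrite -!mulrA ler_wpM2l ?ler0n// ler_wpM2l ?invr_ge0 ?exprn_ge0 ?(ltW W0)//.
rewrite [c ^+ 2]exprMn -expRM_natr mulrCA -expRD.
rewrite (_ : _ + _ = 0) ?expR0 ?mulr1//.
have -> : k.+1%:R = n.+2%:R - 2 :> R by rewrite -natrB.
have : n.+2%:R - 2 != 0 :> R by rewrite -natrB// pnatr_eq0.
by move: (n.+2%:R : R) n2 => N N0 N2; field; rewrite N2 gt_eqF.
Qed.

End peak.

Section density_peak.
Context (R : realType) (k : nat) (f : 'rV[R]_k.+1 -> R).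
Hypothesis df : probability_density f.
Hypothesis lf : log_concave f.
Local Notation n := k.+1.
Local Notation leb := (lebesgue_measure_rV R n).
Local Notation tau := (n%:R / n.+2%:R : R).
Variables (m : 'rV[R]_n) (S : 'M[R]_n).
Hypothesis S_sym : S^T = S.
Hypothesis int1 : forall i, leb.-integrable setT (fun x => ((x ord0 i - m ord0 i) * f x)%:E).
Hypothesis mean0 : forall i, (\int[leb]_x ((x ord0 i - m ord0 i) * f x)%:E = 0)%E.
Hypothesis int2 : forall i j, leb.-integrable setT
  (fun x => ((x ord0 i - m ord0 i) * (x ord0 j - m ord0 j) * f x)%:E).
Hypothesis covS : forall i j,
  (\int[leb]_x ((x ord0 i - m ord0 i) * (x ord0 j - m ord0 j) * f x)%:E = (S i j)%:E)%E.

(** The peak bound is applied to the autocorrelation with the matrix [2 *: S]. The loss [4^n] in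
    [(f x)^2 <= 4^n (g 0)^2] against the gain [\det (2 *: S) = 2^n \det S] leaves the factor
    [2^n]. *)
Lemma density_peak_le (x : 'rV[R]_n) (W : R) : tau ^- n < W ->
  f x ^+ 2 * \det S <=
  2 ^+ n * k`!%:R / (2 * n%:R) * (W / (4 * tau ^+ 2)) ^+ k.
Proof.
move=> tauW.
have n2 : 0 < n.+2%:R :> R by rewrite ltr0n.
have tau0 : 0 < tau by rewrite divr_gt0 ?ltr0n.
have W0 : 0 < W by apply: lt_trans tauW; rewrite invr_gt0 exprn_gt0.
have rhs0 : 0 <= 2 ^+ n * k`!%:R / (2 * n%:R) * (W / (4 * tau ^+ 2)) ^+ k.
  apply: mulr_ge0; last first.
    apply: exprn_ge0; apply: divr_ge0; first exact: ltW.
    by rewrite mulr_ge0// exprn_ge0// ltW.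
  by apply: divr_ge0; apply: mulr_ge0; rewrite ?exprn_ge0 ?ler0n.
(* A nonpositive determinant makes the left side nonpositive; otherwise [S] is invertible, as the
   Gram argument requires. *)
have [S0|S0] := leP (\det S) 0.
  by apply: le_trans rhs0; rewrite mulr_ge0_le0// sqr_ge0.
have [mf f0 intf] := df.
pose g := autocorrelation f.
have g0 : 0 < g 0.
  rewrite lt_neqAle autocorrelation_ge0 ?andbT//; apply/negP => /eqP g0.
  have fx0 y : f y = 0.
    apply/eqP; rewrite eq_le f0 andbT.
    by apply: le_trans (density_le_autocorrelation df lf y) _; rewrite -/g -g0 mulr0.
  by move: intf; under eq_integral do rewrite fx0; rewrite integral0 => /eqP; rewrite eq_sym onee_eq0.
have intg : (\int[leb]_z (g z)%:E = 1)%E.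
  transitivity (\int[leb]_z ((fun=> 1) z * g z)%:E)%E.
    by apply: eq_integral => z _; rewrite mul1r.
  rewrite integral_autocorrelation// -[RHS]intf; apply: eq_integral => y _.
  rewrite [X in (_ * X)%E](_ : _ = 1%E) ?mule1//.
  by rewrite -[RHS]intf; apply: eq_integral => x' _; rewrite mul1r.
have S2_sym : (2 *: S)^T = 2 *: S by rewrite linearZ/= S_sym.
have S2_unit : 2 *: S \in unitmx.
  by rewrite unitmxE detZ unitfE; apply: mulf_neq0; [rewrite expf_neq0|exact: lt0r_neq0].
have mom (u : 'cV[R]_n) : (\int[leb]_z (((z *m u) ord0 ord0) ^+ 2 * g z)%:E =
   ((u^T *m (2 *: S) *m u) ord0 ord0)%:E)%E.
  rewrite (second_moment_autocorrelation df lf int1 mean0 int2 covS).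
  by rewrite -scalemxAr -scalemxAl [in RHS]mxE.
have := log_concave_peak_le (log_concave_autocorrelation df lf) (measurable_autocorrelation df)
  (autocorrelation_ge0 df) (autocorrelationN df lf) g0 intg S2_sym S2_unit mom tauW.
rewrite -/g detZ => H.
have fg : f x ^+ 2 <= (2 ^+ n * g 0) ^+ 2.
  by rewrite ler_pXn2r ?nnegrE ?mulr_ge0 ?exprn_ge0 ?(ltW g0)//; exact: density_le_autocorrelation.
apply: (@le_trans _ _ ((2 ^+ n * g 0) ^+ 2 * \det S)); first by rewrite ler_pM2r.
have Wk : 0 < W ^+ k by rewrite exprn_gt0.
have tk : 0 < tau ^+ k by rewrite exprn_gt0.
have kf : 0 < k`!%:R :> R by rewrite ltr0n fact_gt0.
set B := (X in _ <= X).
have B0 : 0 <= B by [].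
have -> : (2 ^+ n * g 0) ^+ 2 * \det S =
   B * (2 * (2 ^+ n * \det S * (n`!%:R / W ^+ k) * (g 0 * ((2 * tau) ^+ k / k`!%:R)) ^+ 2)).
  have -> : B = 2 ^+ n * k`!%:R / (2 * n%:R) * (W ^+ k / ((2 ^+ k) ^+ 2 * (tau ^+ k) ^+ 2)).
    rewrite /B expr_div_n exprMn -![(_ ^+ k) ^+ 2]exprM (mulnC k) !exprM.
    by have -> : 2 ^+ 2 = 4 :> R by rewrite expr2 -natrM.
  rewrite (exprMn k 2 tau) factS natrM.
  have p0 : (2 ^+ k : R) != 0 by rewrite expf_neq0.
  have N0 : n%:R != 0 :> R by rewrite pnatr_eq0.
  move: (lt0r_neq0 Wk) (lt0r_neq0 kf) (lt0r_neq0 tk) p0 N0.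
  move: (n%:R : R) (W ^+ k) (k`!%:R : R) (tau ^+ k) (2 ^+ k : R) (2 ^+ n : R) (\det S) (g 0).
  move=> a1 a2 a3 a4 a5 a6 a7 a8 h2 h3 h4 h5 h1; field.
  by rewrite h1 h2 h3 h4 h5.
by rewrite ler_piMr.
Qed.

End density_peak.

(** * Numerical estimates of the constants *)

Local Ltac nonneg := repeat first
  [ done | by apply: ltW | exact: expR_ge0 | exact: ler0n | rewrite invr_ge0
  | apply: mulr_ge0 | apply: exprn_ge0 | apply: addr_ge0 ].

Section numeric.
Context (R : realType).
Local Notation e := (expR 1 : R).

(** This bound and the next come from [1 + x <= expR x], at [x = 1 / 8] and [x = - 1 / 6]. *)
Lemma expR1_ge : 5 / 2 <= e.
Proof.
have -> : e = expR (8^-1) ^+ 8 by rewrite -expRM_natl mulfV.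
apply: (@le_trans _ _ ((1 + 8^-1) ^+ 8)); first by lra.
by rewrite ler_pXn2r ?nnegrE ?expR_ge0 ?expR_ge1Dx//; lra.
Qed.

Lemma expR1_le : e <= 3.
Proof.
have -> : e = (expR (- (6^-1)) ^+ 6)^-1.
  by rewrite -expRM_natl mulrN mulfV// expRN invrK.
rewrite invf_ple ?posrE ?exprn_gt0 ?expR_gt0//.
apply: (@le_trans _ _ ((1 + - 6^-1) ^+ 6)); first by lra.
by rewrite ler_pXn2r ?nnegrE ?expR_ge0 ?expR_ge1Dx//; lra.
Qed.

Lemma sqrt2_bounds : 0 < Num.sqrt (2 : R) <= 17 / 12.
Proof.
have h : (0 : R) <= 17 / 12 by lra.
rewrite sqrtr_gt0 ltr0n/= -(@ler_pXn2r _ 2) ?nnegrE ?sqrtr_ge0// sqr_sqrtr//; lra.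
Qed.

(** The induction step amounts to [2 <= (1 + 1 / (k + 1))^(k + 1)], a case of Bernoulli's
    inequality. *)
Lemma fact_le_expn (k : nat) : k`!%:R <= (k.+1%:R / 2 : R) ^+ k.
Proof.
elim: k => [|k IH]; first by rewrite fact0 expr0.
rewrite factS natrM.
have k0 : 0 < k.+1%:R :> R by rewrite ltr0n.
apply: (@le_trans _ _ (k.+1%:R * (k.+1%:R / 2) ^+ k)); first by rewrite ler_pM2l.
have -> : k.+1%:R * (k.+1%:R / 2) ^+ k = 2 * (k.+1%:R / 2 : R) ^+ k.+1.
  by rewrite exprS; field.
have -> : (k.+2%:R / 2 : R) = (1 + k.+1%:R^-1) * (k.+1%:R / 2).
  by rewrite -natr1; field; rewrite gt_eqF.
rewrite [leRHS]exprMn; apply: ler_wpM2r; rewrite ?exprn_ge0 ?divr_ge0 ?ler0n//.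
have bern (x : R) m : 0 <= x -> 1 + m%:R * x <= (1 + x) ^+ m.
  move=> x0; elim: m => [|m IHm]; first by rewrite mul0r addr0 expr0.
  rewrite exprS -natr1.
  apply: (@le_trans _ _ ((1 + x) * (1 + m%:R * x))).
    have : 0 <= m%:R * x * x :> R by rewrite !mulr_ge0 ?ler0n.
    by move: (m%:R : R) => M; nra.
  by rewrite ler_pM2l// ltr_pwDl.
have := bern (k.+1%:R^-1) k.+1; rewrite mulfV ?gt_eqF// invr_ge0 ltW// => /(_ isT).
by apply: le_trans; lra.
Qed.

Lemma D_boundE (n : nat) : (0 < n)%N ->
  D_bound R n ^+ 2 = ((n%:R ^+ 2 * e ^+ 2) / (2 * Num.sqrt 2 * (n%:R + 2))) ^+ n.
Proof.
move=> n0; rewrite /D_bound -powR_mulrn ?powR_ge0// -powRrM divfK//.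
rewrite powR_mulrn// divr_ge0 ?mulr_ge0 ?exprn_ge0 ?expR_ge0 ?ler0n ?sqrtr_ge0//.
Qed.

(** The factor [17 / 16] is the slack above [tau ^- n] needed by the selection. The condition
    [0 < k] matters: at [k = 0] the left side is 1 and the right side [e^2 / (6 sqrt 2) < 1]. For
    large [k] the bounds [k! <= (n / 2)^k] and [r^n <= e^2], with [r = 1 / tau], leave a geometric
    factor of ratio [17/64 * 17/6 < 1]. *)
Lemma peak_constant_le (k n : nat) (tau : R) : (0 < k)%N -> n = k.+1 ->
  tau = n%:R / n.+2%:R ->
  2 ^+ n * k`!%:R / (2 * n%:R) * ((17 / 16 * tau ^- n) / (4 * tau ^+ 2)) ^+ k <=
  ((n%:R ^+ 2 * e ^+ 2) / (2 * Num.sqrt 2 * (n%:R + 2))) ^+ n.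
Proof.
move=> k0 nE tauE.
have /andP[s0 s1] := sqrt2_bounds.
have n0 : 0 < n%:R :> R by rewrite nE ltr0n.
have n2 : 0 < n%:R + 2 :> R by rewrite addr_gt0.
pose r : R := (n%:R + 2) / n%:R.
have r_gt0 : 0 < r by rewrite divr_gt0.
have tauV : tau = r^-1 by rewrite tauE /r invf_div -natrD addn2.
have -> : (17 / 16 * tau ^- n) / (4 * tau ^+ 2) = 17 / 64 * (r ^+ n * r ^+ 2).
  by rewrite tauV !exprVn invrK; field; rewrite gt_eqF.
(* The geometric decay is sufficient from [k = 6] on. For [k] from 1 to 5, replacing [e] by [5 / 2]
   and [sqrt 2] by [17 / 12] leaves five rational inequalities. *)
have [k6|k5] := ltnP k 6.
  apply: (@le_trans _ _ (((n%:R ^+ 2 * (5 / 2) ^+ 2) / (17 / 6 * (n%:R + 2))) ^+ n)).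
    have -> : (n%:R ^+ 2 * (5 / 2) ^+ 2) / (17 / 6 * (n%:R + 2)) = n%:R * (75 / 34) * (n%:R / n.+2%:R) :> R.
      by rewrite -addn2 natrD; field; rewrite gt_eqF.
    rewrite /r -natrD addn2 nE {s0 s1 n0 n2 tau tauE tauV r r_gt0 nE n}; move: k0 k6.
    by do 6?[case: k => [|k]] => //= _ _; rewrite /factorial/=; lra.
  have h52 : (0 : R) <= 5 / 2 by lra.
  have h176 : (0 : R) < 17 / 6 by lra.
  apply: lerXn2r; rewrite ?nnegrE.
  - by nonneg.
  - by nonneg.
  apply: ler_pM.
  - by nonneg.
  - by nonneg.
  - by rewrite ler_pM2l ?exprn_gt0// lerXn2r ?nnegrE ?expR_ge0 ?expR1_ge.
  - rewrite lef_pV2 ?posrE ?mulr_gt0// ler_pM2r//; lra.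
have r1 : 1 <= r by rewrite ler_pdivlMr// mul1r lerDl.
have e0 : 0 < e by exact: expR_gt0.
have rn : r ^+ n <= e ^+ 2.
  have -> : r = 1 + 2 / n%:R by rewrite /r; field; rewrite gt_eqF.
  have -> : e ^+ 2 = expR (2 / n%:R) ^+ n.
    by rewrite -!expRM_natl mulr1 mulrCA mulfV ?mulr1// gt_eqF.
  by apply: lerXn2r; rewrite ?nnegrE; [nonneg|nonneg|exact: expR_ge1Dx].
pose s : R := 2 * Num.sqrt 2.
have s_gt0 : 0 < s by rewrite mulr_gt0.
(* What remains after cancelling common powers of [n] and [e]. As [3 k + 1 <= 3 n], the power of [r]
   is at most [e^6], of which [e^2] is kept and [e^4 <= 3^4]; the other factors decay in [k], and at
   [k = 6] the total is below [7^2 <= n^2]. *)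
have key : (17 / 64) ^+ k * s ^+ n * r ^+ (3 * k).+1 <= n%:R ^+ 2 * e ^+ 2.
  have r6 : r ^+ (3 * k).+1 <= e ^+ 6.
    apply: (@le_trans _ _ (r ^+ (n * 3))).
      by apply: ler_weXn2l => //; rewrite nE (mulnC 3%N) mulSn add3n ltnS; exact: leqW (leqW (leqnn _)).
    rewrite exprM (_ : 6 = 2 * 3)%N// (exprM e); apply: lerXn2r => //;
      by rewrite nnegrE exprn_ge0 ?(ltW r_gt0) ?(ltW e0).
  have s176 : s <= 17 / 6 by rewrite /s; lra.
  have kk : (17 / 64 * (17 / 6)) ^+ k <= (17 / 64 * (17 / 6)) ^+ 6 :> R.
    by apply: ler_wiXn2l => //; lra.
  have e4 : e ^+ 4 <= 3 ^+ 4.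
    by apply: lerXn2r; rewrite ?nnegrE ?(ltW e0)//; exact: expR1_le.
  apply: (@le_trans _ _ ((17 / 64) ^+ k * (17 / 6) ^+ n * e ^+ 6)).
    apply: ler_pM => //.
    - by nonneg.
    - by nonneg.
    - apply: ler_wpM2l; first by nonneg.
      by apply: lerXn2r => //; rewrite nnegrE; nonneg.
  rewrite (exprD e 4 2) mulrA ler_pM2r ?exprn_gt0//.
  have -> : (17 / 64) ^+ k * (17 / 6) ^+ n = 17 / 6 * (17 / 64 * (17 / 6)) ^+ k :> R.
    by rewrite nE exprS mulrCA -exprMn.
  apply: (@le_trans _ _ (17 / 6 * (17 / 64 * (17 / 6)) ^+ 6 * 3 ^+ 4)).
    apply: ler_pM => //; try by nonneg.
    by apply: ler_wpM2l => //; lra.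
  apply: (@le_trans _ _ (7 ^+ 2)); first by lra.
  by apply: lerXn2r; rewrite ?nnegrE ?ler0n// ler_nat nE.
have kf := fact_le_expn k; rewrite -nE in kf.
have -> : n%:R ^+ 2 * e ^+ 2 / (2 * Num.sqrt 2 * (n%:R + 2)) = n%:R * e ^+ 2 / (s * r).
  by rewrite /r -/s; field; rewrite !gt_eqF.
apply: (@le_trans _ _ (n%:R ^+ k / n%:R * ((17 / 64) ^+ k * (e ^+ 2 * r ^+ 2) ^+ k))).
  rewrite exprMn; apply: ler_pM.
  - by nonneg.
  - by nonneg.
  - apply: (@le_trans _ _ (2 ^+ n * (n%:R / 2) ^+ k / (2 * n%:R))).
      rewrite ler_pM2r ?invr_gt0 ?mulr_gt0// ler_pM2l ?exprn_gt0//.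
    rewrite le_eqVlt; apply/orP; left; apply/eqP.
    rewrite [in LHS]nE exprS expr_div_n -nE.
    have : (2 : R) ^+ k != 0 by rewrite expf_neq0.
    by move: ((2 : R) ^+ k) (n%:R ^+ k) => a b a0; field; rewrite a0 gt_eqF.
  - apply: ler_wpM2l; first by nonneg.
    apply: lerXn2r; rewrite ?nnegrE; [by nonneg|by nonneg|].
    by rewrite ler_pM2r ?exprn_gt0.
have sn : 0 < s ^+ n by rewrite exprn_gt0.
have rn' : 0 < r ^+ n by rewrite exprn_gt0.
have -> : (n%:R * e ^+ 2 / (s * r)) ^+ n = (n%:R ^+ n * (e ^+ 2) ^+ n) / (s ^+ n * r ^+ n).
  by rewrite expr_div_n (exprMn n n%:R) (exprMn n s).
rewrite ler_pdivlMr ?mulr_gt0//.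
have -> : n%:R ^+ k / n%:R * ((17 / 64) ^+ k * (e ^+ 2 * r ^+ 2) ^+ k) * (s ^+ n * r ^+ n) =
  (n%:R ^+ k / n%:R * (e ^+ 2) ^+ k) * ((17 / 64) ^+ k * s ^+ n * r ^+ (3 * k).+1).
  rewrite (exprMn k (e ^+ 2)) nE -(exprM r 2).
  have -> : r ^+ (3 * k).+1 = r ^+ (2 * k) * r ^+ k.+1 by rewrite -exprD addnS addnC -mulSn.
  by ring.
have -> : n%:R ^+ n * (e ^+ 2) ^+ n = (n%:R ^+ k / n%:R * (e ^+ 2) ^+ k) * (n%:R ^+ 2 * e ^+ 2).
  rewrite {2 3}nE 2!exprSr.
  by move: (n%:R ^+ k : R) ((e ^+ 2) ^+ k) => a b; field; rewrite gt_eqF.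
apply: ler_wpM2l => //.
Qed.

End numeric.

(** * Comparison with the Gaussian density *)

Section cholesky.
Context (R : rcfType).

(** Eliminating the first variable leaves the Schur complement [D - a^-1 *: (b^T *m b)], to which
    the induction applies. *)
Lemma cholesky (n : nat) (S : 'M[R]_n) : S^T = S ->
  (forall u : 'cV[R]_n, u != 0 -> 0 < (u^T *m S *m u) ord0 ord0) ->
  exists2 B : 'M[R]_n, \det B != 0 & S = B *m B^T.
Proof.
elim: n S => [|n IH] S Ssym Spos.
  by exists 0; [rewrite det_mx00 oner_neq0|apply/matrixP => -[]].
move: (S : 'M[R]_(1 + n)) Ssym Spos => {}S Ssym Spos.
set b := ursubmx S; set D := drsubmx S; set a := S ord0 ord0.
have SE : S = block_mx a%:M b b^T D.
  rewrite -[LHS]submxK; congr block_mx.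
    apply/matrixP => i j; rewrite !ord1 !mxE eqxx mulr1n /a.
    by congr (S _ _); exact/val_inj.
  by rewrite /b -[in RHS]Ssym; apply/matrixP => i j; rewrite !mxE.
have quadE (w : 'M[R]_1) (u : 'cV[R]_n) :
    (col_mx w u)^T *m S *m col_mx w u =
    w^T *m a%:M *m w + u^T *m b^T *m w + (w^T *m b *m u + u^T *m D *m u).
  by rewrite SE tr_col_mx mul_row_block mul_row_col !mulmxDl.
have a0 : 0 < a.
  have := Spos (col_mx 1%:M 0 : 'cV[R]_(1 + n)).
  rewrite quadE !trmx0 !mul0mx mulmx0 !addr0 trmx1 mul1mx mulmx1 !mxE eqxx mulr1n.
  apply; apply/eqP => /(congr1 (fun M : 'cV[R]_(1 + n) => usubmx M)).
  by rewrite col_mxKu linear0 => /matrixP /(_ ord0 ord0) /eqP; rewrite !mxE eqxx oner_eq0.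
have an0 : a != 0 by rewrite gt_eqF.
have [|u u0|B detB BE] := IH (D - a^-1 *: (b^T *m b)).
- rewrite linearB linearZ /= trmx_mul trmxK; congr (_ - _).
  by rewrite /D -[in RHS]Ssym; apply/matrixP => i j; rewrite !mxE.
(* This first coordinate minimises the form of [S] for given [u]; the minimum is the Schur
   complement at [u]. *)
- have := Spos (col_mx (- a^-1 *: (b *m u)) u : 'cV[R]_(1 + n)).
  rewrite quadE; set w := - a^-1 *: _.
  have -> : w^T *m a%:M *m w + u^T *m b^T *m w + (w^T *m b *m u + u^T *m D *m u) =
      u^T *m (D - a^-1 *: (b^T *m b)) *m u.
    have -> : w^T = - a^-1 *: (u^T *m b^T) by rewrite /w linearZ /= trmx_mul.
    rewrite mul_mx_scalar !scalerA mulrN mulfV// scaleN1r mulNmx /w addNr add0r mulmxBr mulmxBl -!scalemxAl -!scalemxAr -!scalemxAl.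
    by rewrite addrC scaleNr !mulmxA.
  apply; apply: contraNneq u0 => /(congr1 (fun M : 'cV[R]_(1 + n) => dsubmx M)); rewrite col_mxKd => ->.
  by rewrite linear0.
exists (block_mx (Num.sqrt a)%:M 0 ((Num.sqrt a)^-1 *: b^T) B : 'M[R]_(1 + n)).
  by rewrite (@det_lblock _ 1 n) det_scalar1 mulf_neq0// gt_eqF// sqrtr_gt0.
have s0 : Num.sqrt a != 0 by rewrite gt_eqF// sqrtr_gt0.
rewrite (@tr_block_mx _ 1 n 1 n) (@mulmx_block _ 1 n 1 n 1 n) !trmx0 !mul0mx !mulmx0 !addr0 SE; apply: (f_equal4 (@block_mx R 1 n 1 n)).
- by rewrite tr_scalar_mx -scalar_mxM -expr2 sqr_sqrtr// ltW.
- by rewrite linearZ /= trmxK mul_scalar_mx scalerA mulfV// scale1r.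
- by rewrite tr_scalar_mx mul_mx_scalar scalerA mulfV// scale1r.
- rewrite -BE linearZ /= trmxK -scalemxAl -scalemxAr scalerA -invfM -expr2.
  by rewrite sqr_sqrtr ?(ltW a0)// addrC subrK.
Qed.

End cholesky.

Section hyperplane.
Context (R : realType).
Local Open Scope ereal_scope.
Local Notation leb := (lebesgue_measure_rV R).

Lemma measurable_hyperplane (n : nat) (u : 'cV[R]_n) (c : R) :
  measurable [set x : 'rV[R]_n | (x *m u) ord0 ord0 = c].
Proof.
have m : measurable_fun setT (fun x : 'rV[R]_n => (x *m u) ord0 ord0).
  exact: (measurableT_comp (@measurable_coord R 1 ord0) (measurable_rV_mul u)).
by have := m measurableT [set c] (measurable_set1 c); rewrite setTI.
Qed.

(** If only the first entry of [u] is nonzero, slices along the first coordinate are single points;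
    otherwise slices at a fixed first coordinate are hyperplanes one dimension lower. It rules out
    degenerate covariance matrices. *)
Lemma lebesgue_measure_rV_hyperplane (n : nat) (u : 'cV[R]_n) (c : R) : u != 0%R ->
  leb n [set x | (x *m u) ord0 ord0 = c] = 0.
Proof.
elim: n u c => [|n IH] u c u0; first by case/eqP: u0; apply/matrixP => -[].
have mH := measurable_hyperplane u c.
rewrite -[[set x | _]]setIT -(@integral_indic _ _ R (leb n.+1) setT measurableT _ mH).
set H := [set x | _]; move: (u : 'cV[R]_(1 + n)) u0 @H mH => {}u u0 H mH.
have mI : measurable_fun setT (fun x : 'rV[R]_n.+1 => (\1_H x : R)%:E).
  by apply/measurable_EFinP; exact: measurable_indic.
have HE s (t : 'rV[R]_n) : H (cons_rV (s, t)) =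
    ((s * usubmx u ord0 ord0)%R + (t *m dsubmx u) ord0 ord0 = c)%R.
  rewrite /H /= -[u in LHS]vsubmxK mul_cons_rV_col !mxE.
  by congr (_ + _ = _)%R; rewrite !mxE.
have [v0|v0] := eqVneq (dsubmx u) 0%R.
- have e0 : usubmx u ord0 ord0 != 0%R.
    apply: contraNneq u0 => e0; rewrite -(vsubmxK u) v0.
    rewrite (_ : usubmx u = 0%R) ?col_mx0//.
    by apply/matrixP => i j; rewrite !ord1 e0 mxE.
  rewrite integral_cons_rV_sym//; apply: integral0_eq => t _.
  have z : (t *m dsubmx u) ord0 ord0 = 0%R by rewrite v0 mulmx0 mxE.
  rewrite (eq_integral (fun s : measurableTypeR R =>
     (\1_[set (c / usubmx u ord0 ord0)%R] s)%:E)) => [|s _]; last first.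
    congr (_%:E); rewrite !indicE; congr ((nat_of_bool _)%:R); apply/idP/idP.
      rewrite !inE HE z addr0 => <- /=; by rewrite mulfK.
    by rewrite !inE HE z addr0 /= => ->; rewrite divfK.
  by rewrite integral_indic// setIT; exact: lebesgue_measure_set1.
rewrite integral_cons_rV//; apply: integral0_eq => s _.
rewrite (eq_integral (fun t : 'rV[R]_n =>
   (\1_[set t | (t *m dsubmx u) ord0 ord0 = c - s * usubmx u ord0 ord0]%R t)%:E)) => [|t _].
  have mHs := measurable_hyperplane (dsubmx u) (c - s * usubmx u ord0 ord0).
  by rewrite integral_indic// setIT; apply: IH.
congr (_%:E); rewrite !indicE; congr ((nat_of_bool _)%:R); apply/idP/idP.
  by rewrite !inE HE /= => <-; rewrite addrC addKr.
by rewrite !inE HE /= => ->; rewrite addrC subrK.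
Qed.

End hyperplane.

Section gaussian.
Context (R : realType).
Local Notation leb := (lebesgue_measure_rV R).
Local Notation mu := (@lebesgue_measure R).
Local Open Scope ereal_scope.

Definition sqnorm (n : nat) (x : 'rV[R]_n) : R := (\sum_i x ord0 i ^+ 2)%R.

Lemma measurable_sqnorm (n : nat) : measurable_fun setT (@sqnorm n).
Proof.
apply: measurable_sum => i; apply: measurable_funX; exact: measurable_coord.
Qed.

Lemma sqnorm_cons_rV (n : nat) (s : R) (t : 'rV[R]_n) :
  sqnorm (cons_rV (s, t)) = (s ^+ 2 + sqnorm t)%R.
Proof.
rewrite /sqnorm big_ord_recl cons_rV0; congr (_ + _)%R.
by apply: eq_bigr => i _; rewrite cons_rVS.
Qed.

Lemma integral_gaussian_line :
  \int[mu]_s (expR (- (s ^+ 2 / 2)))%:E = (Num.sqrt (2 * pi))%:E.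
Proof.
have s2 : (0 < Num.sqrt 2 :> R)%R by rewrite sqrtr_gt0.
rewrite sqrtrM// EFinM -integralT_gauss.
rewrite -(@integral_affine R (Num.sqrt 2)^-1 0 (fun s => (gauss_fun s)%:E)); last 3 first.
- by rewrite invr_eq0 gt_eqF.
- by apply/measurable_EFinP; exact: measurable_gauss_fun.
- by move=> s; rewrite lee_fin gauss_fun_ge0.
rewrite muleA gtr0_norm ?invr_gt0// -EFinM mulfV ?gt_eqF// mul1e.
apply: eq_integral => s _; rewrite addr0 /gauss_fun; congr (expR (- _))%:E.
by rewrite exprMn exprVn sqr_sqrtr// mulrC.
Qed.

Lemma measurable_gaussian (n : nat) :
  measurable_fun setT (fun x : 'rV[R]_n => (expR (- (sqnorm x / 2)))%:E).
Proof.
apply/measurable_EFinP.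
apply: measurableT_comp => //; apply: measurable_funN; apply: measurable_funM => //.
exact: measurable_sqnorm.
Qed.

Lemma integral_gaussian (n : nat) :
  \int[leb n]_x (expR (- (sqnorm x / 2)))%:E = (Num.sqrt (2 * pi) ^+ n)%:E.
Proof.
elim: n => [|n IH].
  rewrite (integral_rV0 (@measurable_gaussian 0)) => [|x]; last by rewrite lee_fin expR_ge0.
  by rewrite /sqnorm big_ord0 mul0r oppr0 expR0 expr0.
rewrite (integral_cons_rV (@measurable_gaussian n.+1)); last first.
  by move=> x; rewrite lee_fin expR_ge0.
rewrite (eq_integral (fun s : measurableTypeR R =>
   (Num.sqrt (2 * pi) ^+ n)%:E * (expR (- (s ^+ 2 / 2)))%:E)) => [|s _]; last first.
  rewrite -IH muleC -ge0_integralZl_EFin ?expR_ge0//.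
  - apply: eq_integral => t _; rewrite sqnorm_cons_rV -EFinM -expRD.
    by congr (expR _)%:E; ring.
  - exact: measurable_gaussian.
rewrite ge0_integralZl_EFin//.
- by rewrite integral_gaussian_line -EFinM exprSr.
- apply/measurable_EFinP; apply: measurableT_comp => //; apply: measurable_funN.
  by apply: measurable_funM => //; exact: measurable_funX.
Qed.

End gaussian.

Section covariance.
Context (R : realType) (n : nat) (f : 'rV[R]_n -> R).
Hypothesis df : probability_density f.
Local Notation leb := (lebesgue_measure_rV R n).
Local Open Scope ereal_scope.
Variables (m : 'rV[R]_n) (S : 'M[R]_n).
Hypothesis S_sym : (S^T = S)%R.
Hypothesis int2 : forall i j, leb.-integrable setT
  (fun x => ((x ord0 i - m ord0 i) * (x ord0 j - m ord0 j) * f x)%:E).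
Hypothesis covS : forall i j,
  \int[leb]_x ((x ord0 i - m ord0 i) * (x ord0 j - m ord0 j) * f x)%:E = (S i j)%:E.

Let mf : measurable_fun setT f. Proof. by case: df. Qed.
Let f0 x : (0 <= f x)%R. Proof. by case: df => _ f0 _. Qed.
Let intf : \int[leb]_x (f x)%:E = 1. Proof. by case: df. Qed.

(** A zero variance in the direction [u] would concentrate [f] on a hyperplane, a null set, against
    total mass 1. *)
Lemma covariance_posdef (u : 'cV[R]_n) : u != 0%R -> (0 < (u^T *m S *m u) ord0 ord0)%R.
Proof.
move=> u0; have := integral_square_density int2 covS u.
set v := (X in X%:E) => vE.
have sq0 x : (0 <= ((x - m) *m u) ord0 ord0 ^+ 2 * f x)%R by rewrite mulr_ge0 ?sqr_ge0.
rewrite lt_neqAle -lee_fin -vE integral_ge0 ?andbT => [|x _]; last by rewrite lee_fin.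
apply/eqP => v0; suff : \int[leb]_x (f x)%:E = 0.
  by rewrite intf => /eqP; rewrite onee_eq0.
have mq : measurable_fun setT (fun x : 'rV[R]_n => (((x - m) *m u) ord0 ord0 ^+ 2 * f x)%:E).
  exact: measurable_int (integrable_square_density int2 u).
have q0 : \int[leb]_x `|(((x - m) *m u) ord0 ord0 ^+ 2 * f x)%:E| = 0.
  transitivity v%:E; last by rewrite /v -v0.
  by rewrite -vE; apply: eq_integral => x _; rewrite gee0_abs// lee_fin.
have ae0 := (ae_eq_integral_abs leb measurableT mq).1 q0.
have aeH : {ae leb, forall x, (x *m u) ord0 ord0 <> (m *m u) ord0 ord0}.
  exists [set x | (x *m u) ord0 ord0 = (m *m u) ord0 ord0]; split.
  - exact: measurable_hyperplane.
  - exact: lebesgue_measure_rV_hyperplane.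
  - by move=> x /= /contrapT.
rewrite (ge0_ae_eq_integral (g := cst 0))//; first by rewrite integral0.
- by apply/measurable_EFinP.
- by move=> x _; rewrite lee_fin.
move: ae0 aeH; apply: filterS2 => x /= /(_ I) [q] xu _; congr EFin; apply/eqP.
move/eqP: q; rewrite mulf_eq0 sqrf_eq0 => /orP[|//] /eqP e.
by case: xu; apply/eqP; rewrite -subr_eq0 -e mulmxBl !mxE.
Qed.

Lemma covariance_cholesky : exists2 B : 'M[R]_n, (\det B != 0)%R & (S = B *m B^T)%R.
Proof. exact: (cholesky S_sym covariance_posdef). Qed.

Lemma det_covariance_gt0 : (0 < \det S)%R.
Proof.
have [B B0 ->] := covariance_cholesky.
by rewrite det_mulmx det_tr -expr2 exprn_even_gt0.
Qed.

(** With [S = B B^T], the witness is the whitening map sending [x] to [x - m] times the inverse of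
    [B^T]. The first integrand is then the Gaussian density of mean [m] and covariance [S], and each
    of the [n] coordinates of [y] has second moment 1 under [f]. *)
Lemma gaussian_density_exists : exists y : 'rV[R]_n -> 'rV[R]_n,
  [/\ measurable_fun setT (fun x => sqnorm (y x)),
      \int[leb]_x ((Num.sqrt (2 * pi) ^+ n * Num.sqrt (\det S))^-1 *
        expR (- (sqnorm (y x) / 2)))%:E = 1,
      leb.-integrable setT (fun x => (sqnorm (y x) * f x)%:E) &
      \int[leb]_x (sqnorm (y x) * f x)%:E = n%:R%:E].
Proof.
have [B B0 SE] := covariance_cholesky.
have BT : (B^T \in unitmx)%R by rewrite unitmxE det_tr unitfE.
set C := invmx B^T.
have CTB : (C^T *m B = 1%:M)%R by rewrite -[B]trmxK -trmx_mul mulmxV// trmx1.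
have CSC : (C^T *m S *m C = 1%:M)%R.
  by rewrite SE mulmxA CTB mul1mx mulmxV.
have detC : (\det C != 0)%R by rewrite det_inv det_tr invr_eq0.
have detCE : (`|\det C| = (Num.sqrt (\det S))^-1)%R.
  by rewrite det_inv det_tr SE det_mulmx det_tr -expr2 sqrtr_sqr normfV.
exists (fun x => (x - m) *m C)%R.
have sqE x : sqnorm ((x - m) *m C)%R = (\sum_j (((x - m) *m col j C) ord0 ord0) ^+ 2)%R.
  apply: eq_bigr => j _; congr (_ ^+ 2)%R; rewrite !mxE; apply: eq_bigr => i _.
  by rewrite !mxE.
have mshift : measurable_fun setT (fun x : 'rV[R]_n => x - m)%R by exact: measurable_rV_shift.
have mG := @measurable_gaussian R n.
have mGC : measurable_fun setT (fun x : 'rV[R]_n => (expR (- (sqnorm (x *m C)%R / 2)))%:E).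
  exact: (measurableT_comp mG (measurable_rV_mul C)).
have mGs : measurable_fun setT (fun x : 'rV[R]_n => (expR (- (sqnorm ((x - m) *m C)%R / 2)))%:E).
  exact: (measurableT_comp mGC mshift).
split.
- apply: (measurableT_comp (@measurable_sqnorm R n)).
  exact: (measurableT_comp (measurable_rV_mul C) mshift).
- have pi0 : (0 < Num.sqrt (2 * pi) ^+ n :> R)%R.
    by rewrite exprn_gt0// sqrtr_gt0 mulr_gt0// pi_gt0.
  have S0 : (0 < Num.sqrt (\det S))%R by rewrite sqrtr_gt0 det_covariance_gt0.
  rewrite (eq_integral (fun x : 'rV[R]_n => ((Num.sqrt (2 * pi) ^+ n)^-1 * `|\det C|)%:E *
      (expR (- (sqnorm ((x - m) *m C)%R / 2)))%:E)) => [|x _]; last first.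
    by rewrite -EFinM detCE invfM.
  rewrite ge0_integralZl_EFin//.
  rewrite (integral_rV_shift (- m) mGC); last by move=> x; rewrite lee_fin expR_ge0.
  rewrite EFinM -muleA (integral_linear_change detC mG); last first.
    by move=> x; rewrite lee_fin expR_ge0.
  by rewrite integral_gaussian -EFinM mulVf// gt_eqF.
- under eq_fun => x do rewrite sqE mulr_suml -sumEFin.
  by apply: integrable_sum => // j _; exact: integrable_square_density.
- under eq_integral => x _ do rewrite sqE mulr_suml -sumEFin.
  rewrite integral_sum//; last by move=> j; exact: integrable_square_density.
  transitivity (\sum_(j < n) (1%R : R)%:E); last first.
    by rewrite sumEFin sumr_const card_ord.
  apply: eq_bigr => j _; rewrite (integral_square_density int2 covS); congr EFin.
  have -> : ((col j C)^T *m S *m col j C = row j (C^T *m S *m col j C))%R.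
    by apply/matrixP => a b; rewrite !mxE; apply: eq_bigr => i _; rewrite !mxE; congr (_ * _)%R;
       apply: eq_bigr => k _; rewrite !mxE.
  have -> : (C^T *m S *m col j C = col j (C^T *m S *m C))%R.
    by apply/matrixP => a b; rewrite !mxE; apply: eq_bigr => i _; rewrite !mxE.
  by rewrite CSC !mxE eqxx.
Qed.

Lemma C_boundE : (C_bound R n = Num.sqrt (2 * pi) ^+ n * expR (n%:R / 2))%R.
Proof.
have pi2 : (0 <= 2 * pi :> R)%R by rewrite mulr_ge0// pi_ge0.
rewrite /C_bound powRM ?expR_ge0//; congr (_ * _)%R.
  by rewrite (mulrC n%:R) powRrM powR12_sqrt// powR_mulrn// sqrtr_ge0.
by rewrite /powR gt_eqF ?expR_gt0// expRK mulr1.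
Qed.

(* With [K^-1 * expR (- s / 2)] the Gaussian density at a point and [a := K^-1 * expR (- N / 2)],
   this is [t ^ q / a ^ (q - 1) >= t * (1 + (q - 1) * ln (t / a))] followed by [ln z <= z - 1]. *)
Lemma powR_gaussian_ge (K s N t q : R) : (0 < K)%R -> (0 <= t)%R -> (1 < q)%R ->
  ((K^-1 * expR (- (N / 2))) `^ (q - 1) *
     (t + (q - 1) * ((N / 2 + 1) * t - s * t / 2 - K^-1 * expR (- (s / 2)))) <= t `^ q)%R.
Proof.
move=> K0 t0 q1; have q0 : (0 <= q - 1)%R by rewrite subr_ge0 ltW.
have Ki0 : (0 < K^-1)%R by rewrite invr_gt0.
have a0 : (0 < K^-1 * expR (- (N / 2)))%R by rewrite mulr_gt0// expR_gt0.
have [->|tn0] := eqVneq t 0%R.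
  rewrite powR0 ?gt_eqF ?(lt_trans _ q1)// !mulr0 !mul0r subr0 !sub0r add0r mulrN mulrN oppr_le0.
  by rewrite !mulr_ge0 ?powR_ge0 ?expR_ge0// ltW.
have {t0 tn0}t0 : (0 < t)%R by rewrite lt_neqAle eq_sym tn0.
set a := (K^-1 * expR _)%R in a0 *; set g := (K^-1 * expR (- (s / 2)))%R.
have g0 : (0 < g)%R by rewrite mulr_gt0// expR_gt0.
have lng : (ln g = ln K^-1 - s / 2)%R by rewrite lnM ?posrE ?expR_gt0// expRK.
have lna : (ln a = ln K^-1 - N / 2)%R by rewrite lnM ?posrE ?expR_gt0// expRK.
have lngt : (ln g - ln t <= g / t - 1)%R.
  rewrite -ln_div ?posrE//; have := @le_ln1Dx R (g / t - 1)%R.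
  have -> : (1 + (g / t - 1) = g / t)%R by rewrite addrC subrK.
  by apply; rewrite ltrBrDl subrr divr_gt0.
have -> : (t `^ q = a `^ (q - 1) * (t * expR ((q - 1) * (ln t - ln a))))%R.
  rewrite /powR !gt_eqF//=.
  transitivity (expR ((q - 1) * ln a) * (expR (ln t) * expR ((q - 1) * (ln t - ln a))))%R.
    by rewrite -!expRD; congr (expR _); ring.
  by rewrite lnK ?posrE.
rewrite ler_pM2l ?powR_gt0//.
apply: le_trans (_ : t * (1 + (q - 1) * (ln t - ln a)) <= _)%R; last first.
  by rewrite ler_pM2l// expR_ge1Dx.
rewrite (mulrDr t) mulr1 lerD2l (mulrCA t) ler_wpM2l//.
have : (t * (ln g - ln t) <= g - t)%R.
  rewrite -ler_pdivlMl//; apply: le_trans lngt _.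
  by rewrite mulrBr mulVf ?gt_eqF// mulrC.
rewrite lna lng; move: (ln t) (ln K^-1) => u v h.
have -> : (t * (u - (v - N / 2)) = t * u - t * v + t * N / 2)%R by ring.
have -> : ((N / 2 + 1) * t - s * t / 2 - g = t * N / 2 + t - s * t / 2 - g)%R by ring.
have : (t * (v - s / 2 - u) = t * v - s * t / 2 - t * u)%R by ring.
lra.
Qed.

(** The pointwise bound is integrated with [N = n]: since [f], [sqnorm (y x) * f x] and the Gaussian
    density have integrals 1, [n] and 1, all multiples of [q - 1] cancel and [A] remains. An
    infinite integral of [f^q] is set aside beforehand, as comparing with a signed function requires
    integrability. *)
Lemma integral_powR_ge (q : R) : (1 < q)%R ->
  (((C_bound R n * Num.sqrt (\det S))^-1 `^ (q - 1))%:E <= \int[leb]_x (f x `^ q)%:E).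
Proof.
move=> q1; have [y [my intg inty meany]] := gaussian_density_exists.
set K := (Num.sqrt (2 * pi) ^+ n * Num.sqrt (\det S))%R.
have K0 : (0 < K)%R.
  by rewrite mulr_gt0 ?exprn_gt0 ?sqrtr_gt0 ?det_covariance_gt0// mulr_gt0// pi_gt0.
have -> : ((C_bound R n * Num.sqrt (\det S))^-1 = K^-1 * expR (- (n%:R / 2)))%R.
  by rewrite C_boundE /K expRN -invfM; congr (_^-1)%R; ring.
set A := (_ `^ (q - 1))%R; set g := (fun x => K^-1 * expR (- (sqnorm (y x) / 2)))%R.
have A0 : (0 <= A)%R by rewrite powR_ge0.
have mfq : measurable_fun setT (fun x => (f x `^ q)%:E).
  by apply/measurable_EFinP; exact: (measurableT_comp (@measurable_powR R q) mf).
have fq0 x : (0 <= (f x `^ q)%:E) by rewrite lee_fin powR_ge0.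
have [/eqP ->|fin] := boolP (\int[leb]_x (f x `^ q)%:E == +oo); first by rewrite leey.
have ifq : leb.-integrable setT (fun x => (f x `^ q)%:E).
  apply/integrableP; split=> //; under eq_integral => x _ do rewrite gee0_abs//.
  by rewrite ltey.
have if1 : leb.-integrable setT (fun x => (f x)%:E).
  apply/integrableP; split; first by apply/measurable_EFinP.
  by under eq_integral => x _ do rewrite gee0_abs ?lee_fin//; rewrite intf ltry.
have ig : leb.-integrable setT (fun x => (g x)%:E).
  apply/integrableP; split.
    apply/measurable_EFinP; apply: measurable_funM => //; apply: measurableT_comp => //.
    by apply: measurable_funN; exact: measurable_funM.
  under eq_integral => x _ do rewrite gee0_abs ?lee_fin ?mulr_ge0 ?invr_ge0 ?(ltW K0) ?expR_ge0//.
  by rewrite intg ltry.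
pose h (x : 'rV[R]_n) := (A * (1 + (q - 1) * (n%:R / 2 + 1)))%:E * (f x)%:E +
  ((- (A * (q - 1) / 2))%:E * (sqnorm (y x) * f x)%:E + (- (A * (q - 1)))%:E * (g x)%:E).
have i1 := integrableZl measurableT (A * (1 + (q - 1) * (n%:R / 2 + 1)))%R if1.
have i2 := integrableZl measurableT (- (A * (q - 1) / 2))%R inty.
have i3 := integrableZl measurableT (- (A * (q - 1)))%R ig.
have i23 := integrableD measurableT i2 i3.
have inth : \int[leb]_x h x = A%:E.
  rewrite /h (integralD measurableT i1 i23) (integralD measurableT i2 i3).
  rewrite (integralZl measurableT if1) (integralZl measurableT inty) (integralZl measurableT ig).
  by rewrite intf meany intg -!EFinM -!EFinD; congr EFin; field.
rewrite -inth; apply: le_integral => //; first exact: integrableD.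
move=> x _; have := @powR_gaussian_ge K (sqnorm (y x)) n%:R (f x) q K0 (f0 x) q1.
rewrite /h -!EFinM -!EFinD lee_fin; apply: le_trans; rewrite le_eqVlt; apply/orP; left.
by apply/eqP; rewrite -/A /g; ring.
Qed.

End covariance.

(** * Random vectors and norms *)

Section integral_with_density.
Context d (T : measurableType d) (R : realType).
Variables (mu nu : {measure set T -> \bar R}) (g : T -> R).
Hypothesis mg : measurable_fun setT g.
Hypothesis g0 : forall x, 0 <= g x.
Local Open Scope ereal_scope.
Hypothesis nuE : forall A, measurable A -> nu A = \int[mu]_(x in A) (g x)%:E.

Import HBNNSimple.

Let integral_density_indic (A : set T) : measurable A ->
  \int[nu]_x (\1_A x : R)%:E = \int[mu]_x ((\1_A x : R)%:E * (g x)%:E).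
Proof.
move=> mA; rewrite integral_indic// setIT nuE// integral_mkcond.
apply: eq_integral => x _; rewrite patchE indicE.
by case: (x \in A); rewrite ?mul1e ?mul0e.
Qed.

Let integral_density_nnsfun (h : {nnsfun T >-> R}) :
  \int[nu]_x (h x)%:E = \int[mu]_x ((h x)%:E * (g x)%:E).
Proof.
have mgE : measurable_fun setT (EFin \o g) by exact/measurable_EFinP.
under [LHS]eq_integral do rewrite fimfunE -fsumEFin//.
rewrite [LHS]ge0_integral_fsum//; last 2 first.
  - by move=> r; exact/measurable_EFinP/measurableT_comp.
  - by move=> n x _; rewrite EFinM nnfun_muleindic_ge0.
under [RHS]eq_integral.
  move=> x xD; rewrite fimfunE -fsumEFin// muleC ge0_mule_fsumr; last first.
    by move=> r; rewrite EFinM nnfun_muleindic_ge0.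
  over.
rewrite [RHS]ge0_integral_fsum//; last 2 first.
  - move=> r; apply: emeasurable_funM => //.
    by apply/measurable_EFinP; exact: measurableT_comp.
  - by move=> n x _; apply: mule_ge0; [rewrite lee_fin|rewrite EFinM nnfun_muleindic_ge0].
apply: eq_fsbigr => r /[!inE] -[x _ <-].
have mh : measurable (h @^-1` [set h x]) by exact: measurable_funPTI.
rewrite (eq_integral (fun y => (h x)%:E * (\1_(h @^-1` [set h x]) y : R)%:E))//.
rewrite ge0_integralZl_EFin//; last by apply/measurable_EFinP.
rewrite integral_density_indic// -ge0_integralZl_EFin//.
- by apply: eq_integral => y _; rewrite [(h x * _)%:E]EFinM [RHS]muleC -muleA.
- by move=> y _; rewrite mule_ge0// lee_fin.
- by apply: emeasurable_funM => //; apply/measurable_EFinP.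
Qed.

(** The usual passage from indicators to simple functions and on to the limit by monotone
    convergence. *)
Lemma ge0_integral_density (h : T -> \bar R) : measurable_fun setT h ->
  (forall x, 0 <= h x) -> \int[nu]_x h x = \int[mu]_x (h x * (g x)%:E).
Proof.
move=> mh h0; pose h_ := nnsfun_approx measurableT mh.
have mgE : measurable_fun setT (EFin \o g) by exact/measurable_EFinP.
transitivity (lim (\int[nu]_x (h_ n x)%:E @[n --> \oo])).
  rewrite -monotone_convergence//=.
  - apply: eq_integral => ? /[!inE] xD; apply/esym/cvg_lim => //=.
    exact: cvg_nnsfun_approx.
  - by move=> n; exact/measurable_EFinP/measurable_funTS.
  - by move=> n ? _; rewrite lee_fin.
  - by move=> ? _ ? ? mn; rewrite lee_fin; exact/lefP/nd_nnsfun_approx.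
under eq_fun do rewrite integral_density_nnsfun.
rewrite -monotone_convergence//=.
- apply: eq_integral => x /[!inE] xD; apply/cvg_lim => //=.
  rewrite muleC; under eq_fun do rewrite muleC.
  by apply: cvgeZl => //; exact: cvg_nnsfun_approx.
- move=> n; apply: emeasurable_funM => //.
  by exact/measurable_EFinP/measurable_funTS.
- by move=> n x _; rewrite mule_ge0// lee_fin.
- move=> x _ a b ab; rewrite lee_wpmul2r ?lee_fin//.
  exact/lefP/nd_nnsfun_approx.
Qed.

Lemma integrable_density (h : T -> R) : measurable_fun setT h ->
  nu.-integrable setT (EFin \o h) -> mu.-integrable setT (fun x => (h x * g x)%:E).
Proof.
move=> mh /integrableP[_ hoo]; apply/integrableP; split.
  by apply/measurable_EFinP; exact: measurable_funM.
move: hoo; rewrite ge0_integral_density//; last first.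
  by apply: measurableT_comp => //; apply/measurable_EFinP.
congr (_ < _); apply: eq_integral => x _.
by rewrite [(h x * _)%:E]EFinM abseM [X in _ = _ * X]gee0_abs// lee_fin.
Qed.

Lemma integral_density (h : T -> R) : measurable_fun setT h ->
  \int[nu]_x (h x)%:E = \int[mu]_x (h x * g x)%:E.
Proof.
move=> mh; rewrite integralE [RHS]integralE.
rewrite !ge0_integral_density//.
- congr (_ - _); apply: eq_integral => x _.
  + by rewrite !funeposE -!EFin_max -EFinM maxr_pMl// mul0r.
  + by rewrite !funenegE -!EFinN -!EFin_max -EFinM maxr_pMl// mul0r mulNr.
- by apply: measurable_funeneg; apply/measurable_EFinP.
- by apply: measurable_funepos; apply/measurable_EFinP.
Qed.

End integral_with_density.

Section density_moments.
Context d (T : measurableType d) (R : realType) (n : nat) (f : 'rV[R]_n -> R).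
Context (P : probability T R) (X : {RV P >-> 'rV[R]_n}).
Hypothesis df : probability_density f.
Hypothesis dX : has_density X f.
Hypothesis covX : finite_covariance X.
Local Notation leb := (lebesgue_measure_rV R n).
Local Open Scope ereal_scope.

Let mf : measurable_fun setT f. Proof. by case: df. Qed.
Let f0 x : (0 <= f x)%R. Proof. by case: df => _ f0 _. Qed.

Lemma integrable_has_density (h : 'rV[R]_n -> R) : measurable_fun setT h ->
  P.-integrable setT (fun w => (h (X w))%:E) ->
  leb.-integrable setT (fun x => (h x * f x)%:E).
Proof.
move=> mh ih; apply: (integrable_density mf f0 dX mh).
apply: integrable_pushforward => //; exact/measurable_EFinP.
Qed.

Lemma integral_has_density (h : 'rV[R]_n -> R) : measurable_fun setT h ->
  P.-integrable setT (fun w => (h (X w))%:E) ->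
  \int[leb]_x (h x * f x)%:E = \int[P]_w (h (X w))%:E.
Proof.
move=> mh ih; rewrite -(integral_density mf f0 dX mh).
by rewrite integral_distribution//; exact/measurable_EFinP.
Qed.

Definition mean_rV : 'rV[R]_n := \row_i fine 'E_P[component X i].

Let mcoor i : measurable_fun setT (fun x : 'rV[R]_n => x ord0 i - mean_rV ord0 i)%R.
Proof. by apply: measurable_funB => //; exact: measurable_coord. Qed.

Let icoor i : P.-integrable setT (fun w => (X w ord0 i - mean_rV ord0 i)%:E).
Proof.
have := integrableB measurableT (covX.1 i)
  (finite_measure_integrable_cst P (mean_rV ord0 i) measurableT).
by apply: eq_integrable => // w _; rewrite EFinB.
Qed.

Let icov i j : P.-integrable setT (fun w =>
  ((X w ord0 i - mean_rV ord0 i) * (X w ord0 j - mean_rV ord0 j))%:E).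
Proof.
have := covX.2 i j; apply: eq_integrable => // w _ /=.
by rewrite !mxE.
Qed.

Lemma integrable_centered i : leb.-integrable setT
  (fun x => ((x ord0 i - mean_rV ord0 i) * f x)%:E).
Proof. exact: (integrable_has_density (mcoor i) (icoor i)). Qed.

Lemma integral_centered i :
  \int[leb]_x ((x ord0 i - mean_rV ord0 i) * f x)%:E = 0.
Proof.
rewrite (integral_has_density (mcoor i) (icoor i)).
under eq_integral do rewrite EFinB.
rewrite integralB//; last 2 first.
- exact: covX.1.
- exact: finite_measure_integrable_cst.
rewrite integral_cst// [X in _ - _ * X](_ : _ = 1); last exact: probability_setT.
have fin : \int[P]_w (X w ord0 i)%:E \is a fin_num.
  by apply: integrable_fin_num => //; exact: covX.1.
by rewrite mule1 mxE unlock fineK// subee.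
Qed.

Lemma integrable_centered2 i j : leb.-integrable setT
  (fun x => ((x ord0 i - mean_rV ord0 i) * (x ord0 j - mean_rV ord0 j) * f x)%:E).
Proof.
by apply: (integrable_has_density (h := fun x => _)) (icov i j); exact: measurable_funM.
Qed.

Lemma integral_centered2 i j :
  \int[leb]_x ((x ord0 i - mean_rV ord0 i) * (x ord0 j - mean_rV ord0 j) * f x)%:E =
  (covariance_mx X i j)%:E.
Proof.
rewrite (integral_has_density (h := fun x => _) _ (icov i j)); last exact: measurable_funM.
have -> : covariance_mx X i j = fine (\int[P]_w
    ((X w ord0 i - mean_rV ord0 i) * (X w ord0 j - mean_rV ord0 j))%:E).
  rewrite [LHS]mxE covariance.unlock [in LHS]expectation.unlock; congr fine.
  by apply: eq_integral => w _; rewrite !mxE expectation.unlock.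
by rewrite fineK//; exact: integrable_fin_num (icov i j).
Qed.

Lemma tr_covariance_mx : (covariance_mx X)^T%R = covariance_mx X.
Proof. by apply/matrixP => i j; rewrite !mxE covarianceC. Qed.

End density_moments.

Section norm_bounds.
Context (R : realType) (n : nat) (f : 'rV[R]_n -> R).
Hypothesis df : probability_density f.
Local Notation leb := (lebesgue_measure_rV R n).
Local Open Scope ereal_scope.

Let mf : measurable_fun setT f. Proof. by case: df. Qed.
Let f0 x : (0 <= f x)%R. Proof. by case: df => _ f0 _. Qed.
Let intf : \int[leb]_x (f x)%:E = 1. Proof. by case: df. Qed.

Let mfE : measurable_fun setT (EFin \o f). Proof. by apply/measurable_EFinP. Qed.

Let mfp (p : R) : measurable_fun setT (fun x => (f x `^ p)%:E).
Proof. by apply/measurable_EFinP; exact: (measurableT_comp (@measurable_powR R p) mf). Qed.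

(** The norm of exponent [+oo] takes a default value when the whole space is null. That is
    impossible here, since [f] has integral 1. *)
Lemma lebesgue_measure_rV_gt0 : 0 < leb setT.
Proof.
rewrite lt_neqAle measure_ge0 andbT; apply/eqP => leb0.
move: intf.
rewrite null_set_integral//; first by move/eqP; rewrite eq_sym onee_eq0.
Qed.

Lemma Lnorm_density_EFin (p : R) : 'N[leb]_p%:E[EFin \o f] =
  (\int[leb]_x (f x `^ p)%:E) `^ p^-1.
Proof.
rewrite unlock; congr (_ `^ _); apply: eq_integral => x _.
by rewrite /= ger0_norm// poweR_EFin.
Qed.

Lemma powR_split (t p : R) : (0 <= t)%R -> (1 <= p)%R -> (t `^ p = t `^ (p - 1) * t)%R.
Proof.
move=> t0 p1; rewrite -[X in _ = (_ * X)%R]powRr1// -powRD ?subrK//.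
by apply/implyP => /eqP p0; rewrite p0 ler10 in p1.
Qed.

Lemma recip_EFin (p : R) : (1 <= p)%R -> recip p%:E = p^-1%R.
Proof. by move=> p1; rewrite /recip inver gt_eqF// (lt_le_trans _ p1). Qed.

Lemma recip_pinfty : recip +oo = 0%R :> R.
Proof. by rewrite /recip invey. Qed.

(** For finite [p], [f^p <= M^(p-1) f] and [f] has mass 1. *)
Lemma Lnorm_density_le (M : R) (p : \bar R) : (forall x, f x <= M)%R -> 1 <= p ->
  'N[leb]_p[EFin \o f] <= (M `^ (1 - recip p))%:E.
Proof.
move=> fM; have M0 : (0 <= M)%R by exact: le_trans (f0 0%R) (fM _).
case: p => [p| |//].
- rewrite lee_fin => p1; have p0 : (0 < p)%R by exact: lt_le_trans p1.
  rewrite Lnorm_density_EFin recip_EFin//.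
  have -> : (M `^ (1 - p^-1) = (M `^ (p - 1)) `^ p^-1)%R.
    by rewrite -powRrM mulrBl mul1r mulfV ?gt_eqF.
  rewrite -poweR_EFin gt0_ler_poweR ?invr_ge0 ?(ltW p0)//.
  + by rewrite in_itv/= leey andbT; apply: integral_ge0 => x _; rewrite lee_fin powR_ge0.
  + by rewrite in_itv/= leey andbT lee_fin powR_ge0.
  rewrite -[leRHS]mule1 -intf -ge0_integralZl_EFin ?powR_ge0//; last first.
    by move=> x _; rewrite lee_fin.
  apply: ge0_le_integral => //.
  + by move=> x _; rewrite lee_fin powR_ge0.
  + by apply: emeasurable_funM.
  move=> x _; rewrite -EFinM lee_fin powR_split// ler_wpM2r//.
  by rewrite ge0_ler_powR ?nnegrE ?subr_ge0.
- move=> _; rewrite unlock lebesgue_measure_rV_gt0 recip_pinfty subr0 powRr1//.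
  apply/ess_supP; apply: nearW => x /=.
  by rewrite lee_fin ger0_norm.
Qed.

(** Finite [q > 1] is a root of the hypothesis; at [q = 1] both sides are 1. For [q = +oo] the
    hypothesis at [r = 2] suffices: [a] is at most the integral of [f^2], hence at most the
    essential supremum times the mass 1. *)
Lemma Lnorm_density_ge (a : R) (q : \bar R) : (0 <= a)%R ->
  (forall r, (1 < r)%R -> (a `^ (r - 1))%:E <= \int[leb]_x (f x `^ r)%:E) -> 1 <= q ->
  (a `^ (1 - recip q))%:E <= 'N[leb]_q[EFin \o f].
Proof.
move=> a0 lower; case: q => [q| |//].
- rewrite lee_fin le_eqVlt => /predU1P[<-|q1].
    rewrite Lnorm_density_EFin recip_EFin// invr1 subrr powRr0 poweRe1; last first.
      by apply: integral_ge0 => x _; rewrite lee_fin powR_ge0.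
    rewrite -[leLHS]intf le_eqVlt; apply/orP; left; apply/eqP.
    by apply: eq_integral => x _; rewrite powRr1.
  have q0 : (0 < q)%R by exact: lt_trans q1.
  rewrite Lnorm_density_EFin recip_EFin ?(ltW q1)//.
  have -> : (a `^ (1 - q^-1) = (a `^ (q - 1)) `^ q^-1)%R.
    by rewrite -powRrM mulrBl mul1r mulfV ?gt_eqF.
  rewrite -poweR_EFin gt0_ler_poweR ?invr_ge0 ?(ltW q0) ?lower//.
  + by rewrite in_itv/= leey andbT lee_fin powR_ge0.
  + by rewrite in_itv/= leey andbT; apply: integral_ge0 => x _; rewrite lee_fin powR_ge0.
- move=> _; rewrite unlock lebesgue_measure_rV_gt0 recip_pinfty subr0 powRr1//.
  set M := ess_sup _ _.
  have fM : {ae leb, forall x, (f x)%:E <= M}.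
    have := ess_sup_ge leb (abse \o (EFin \o f)); apply: filterS => x /=.
    by rewrite ger0_norm.
  have := lower 2%R (ltr1n _ 2); rewrite (_ : 2 - 1 = 1)%R ?powRr1//; last by ring.
  move/le_trans; apply.
  have M0 : 0 <= M.
    by apply: (ess_sup_gee lebesgue_measure_rV_gt0); apply: nearW => x /=; rewrite lee_fin.
  rewrite -[leRHS]mule1 -intf -ge0_integralZl//; last by move=> x _; rewrite lee_fin.
  apply: ae_ge0_le_integral => //.
  + by move=> x _; rewrite lee_fin powR_ge0.
  + by move=> x _; rewrite mule_ge0// lee_fin.
  + exact: emeasurable_funM.
  move: fM; apply: filterS => x fxM _.
  by rewrite powR_mulrn// expr2 EFinM lee_wpmul2r// lee_fin.
Qed.

End norm_bounds.

(** * Assembly of the two bounds *)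

Lemma density_le_D_bound (R : realType) (k : nat) (f : 'rV[R]_k.+1 -> R)
    (d : measure_display) (T : measurableType d) (P : probability T R)
    (X : {RV P >-> 'rV[R]_k.+1}) (x : 'rV[R]_k.+1) :
  (0 < k)%N -> probability_density f -> log_concave f -> has_density X f ->
  finite_covariance X -> 0 < \det (covariance_mx X) ->
  f x <= D_bound R k.+1 / Num.sqrt (\det (covariance_mx X)).
Proof.
move=> k0 df lf dX cX S0; have [_ f0 _] := df.
have s0 : 0 < Num.sqrt (\det (covariance_mx X)) by rewrite sqrtr_gt0.
have D0 : 0 <= D_bound R k.+1 by rewrite powR_ge0.
rewrite ler_pdivlMr// -(@ler_pXn2r _ 2) ?nnegrE ?mulr_ge0 ?(ltW s0)// exprMn.
rewrite sqr_sqrtr ?(ltW S0)// D_boundE//.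
pose tau := k.+1%:R / k.+3%:R : R.
(* This fixes [W = 17 / 16 * tau ^- n] in the peak bound; [0 < k] is where dimension at least 2 is
   used. *)
apply: le_trans (peak_constant_le k0 (erefl k.+1) (erefl tau)).
apply: (density_peak_le df lf (tr_covariance_mx X) (integrable_centered df dX cX)
  (integral_centered df dX cX) (integrable_centered2 df dX cX) (integral_centered2 df dX cX)).
have : 0 < tau ^- k.+1 by rewrite invr_gt0 exprn_gt0// divr_gt0.
by rewrite -/tau => h; lra.
Qed.

(** The constant of the theorem is exactly the ratio of the upper bound for one norm to the lower
    bound for the other: the powers of [C] cancel, and the exponents of [S] match by [- (1 - u) / 2
    = (u - v) / 2 - (1 - v) / 2]. *)
Lemma norm_constantsE (R : realType) (C D S u v : R) : 0 < C -> 0 <= D -> 0 < S ->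
  (D / Num.sqrt S) `^ (1 - u) =
  C `^ (1 - v) * D `^ (1 - u) * S `^ (1 / 2 * (u - v)) * (C * Num.sqrt S)^-1 `^ (1 - v).
Proof.
move=> C0 D0 S0.
have CC : C `^ (1 - v) != 0 by rewrite gt_eqF// powR_gt0.
have SD a b : S `^ (a + b) = S `^ a * S `^ b by rewrite powRD // (gt_eqF S0) implybT.
have Sp a : 0 <= S `^ a by rewrite powR_ge0.
have -> : (C * Num.sqrt S)^-1 `^ (1 - v) = (C `^ (1 - v))^-1 * S `^ (2^-1 * - (1 - v)).
  rewrite -powR_inv1 ?mulr_ge0 ?sqrtr_ge0 ?(ltW C0)// -powRrM mulN1r.
  by rewrite powRM ?sqrtr_ge0 ?(ltW C0)// powRN -powR12_sqrt ?(ltW S0)// -powRrM.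
have -> : (D / Num.sqrt S) `^ (1 - u) = D `^ (1 - u) * S `^ (- 2^-1 * (1 - u)).
  by rewrite -powR12_sqrt ?(ltW S0)// -powRN powRM// powRrM.
have -> : - 2^-1 * (1 - u) = 1 / 2 * (u - v) + 2^-1 * - (1 - v) by field.
rewrite SD; move: (S `^ _) (S `^ _) (D `^ _) => x y z.
by field.
Qed.

Theorem theorem2 (R : realType) (n : nat) (f : 'rV[R]_n -> R)
    (d : measure_display) (T : measurableType d) (P : probability T R)
    (X : {RV P >-> 'rV[R]_n}) (p q : \bar R) :
  (2 <= n)%N ->
  probability_density f ->
  log_concave f ->
  has_density X f ->
  finite_covariance X ->
  (1 <= p)%E -> (1 <= q)%E ->
  ('N[lebesgue_measure_rV R n]_p[EFin \o f] <=
   (C_bound R n `^ (1 - recip q) * D_bound R n `^ (1 - recip p) *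
    \det (covariance_mx X) `^ (1 / 2 * (recip p - recip q)))%:E *
   'N[lebesgue_measure_rV R n]_q[EFin \o f])%E.
Proof.
case: n f X => [|k] // f X k0 df lf dX cX p1 q1.
have S0 : 0 < \det (covariance_mx X).
  exact: (det_covariance_gt0 df (tr_covariance_mx X) (integrable_centered2 df dX cX)
    (integral_centered2 df dX cX)).
set S := \det (covariance_mx X) in S0 *.
have C0 : 0 < C_bound R k.+1.
  by rewrite powR_gt0// !mulr_gt0 ?expR_gt0// pi_gt0.
have s0 : 0 < Num.sqrt S by rewrite sqrtr_gt0.
have a0 : 0 <= (C_bound R k.+1 * Num.sqrt S)^-1 by rewrite invr_ge0 mulr_ge0// ltW.
have upper := Lnorm_density_le df
  (fun x => density_le_D_bound x k0 df lf dX cX S0) p1.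
have lower := Lnorm_density_ge df a0 (integral_powR_ge df (tr_covariance_mx X)
  (integrable_centered2 df dX cX) (integral_centered2 df dX cX)) q1.
apply: (le_trans upper); set K := (_ * _ * _).
have K0 : 0 <= K by rewrite !mulr_ge0 ?powR_ge0.
apply: le_trans (lee_wpmul2l _ lower); last by rewrite lee_fin.
rewrite -EFinM lee_fin le_eqVlt; apply/orP; left; apply/eqP; rewrite /K.
move: (recip p) (recip q) => rp rq.
by apply: norm_constantsE => //; exact: powR_ge0.
Qed.
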